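(* For any $q > 2$ there is a Helson set $K \subset \mathbb{T}$ which supports a non-zero (Schwartz) distribution $S$ on $\mathbb{T}$ such that its sequence of Fourier coefficients satisfies $\widehat{S} = \{\widehat{S}(n)\}_{n\in\mathbb{Z}} \in \ell^q(\mathbb{Z})$.
   Context: $\mathbb{T} = \mathbb{R}/2\pi\mathbb{Z}$ is the circle group. A measure on $\mathbb{T}$ means a finite complex Borel measure; $\int |d\mu|$ denotes its total variation. $\widehat{S}(n)$, $n\in\mathbb{Z}$, denote the Fourier coefficients of a Schwartz distribution $S$ on $\mathbb{T}$ (and in particular $\widehat{\mu}(n)$ those of a measure $\mu$). ''$K$ supports $S$'' means that the support of $S$ is contained in $K$. $A(\mathbb{T})$ is the Wiener algebra of functions on $\mathbb{T}$ with absolutely convergent Fourier series. A compact set $K \subset \mathbb{T}$ is called a Helson set if it satisfies any one of the following equivalent conditions: (i) every continuous function on $K$ admits an extension to a function in $A(\mathbb{T})$; (ii) there is $\delta_1(K) > 0$ such that $\sup_{n \in \mathbb{Z}} |\widehat{\mu}(n)| \geq \delta_1(K) \int |d\mu|$ for every measure $\mu$ supported by $K$; (iii) there is $\delta_2(K) > 0$ such that $\limsup_{|n| \to \infty} |\widehat{\mu}(n)| \geq \delta_2(K) \int |d\mu|$ for every measure $\mu$ supported by $K$. *)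

(* Defs.v *)
(* MathComp-Analysis, over an arbitrary [R : realType]; complex numbers are [R[i]].

   The circle T = R/2piZ is handled through its universal cover: a function on T
   is a 2pi-periodic function on R, and a subset of T is identified with its
   2pi-periodic preimage in R.  A subset of T is open (closed) in the quotient
   topology iff its preimage is open (closed) in R.  As T is compact, its compact
   subsets are exactly its closed ones. *)
From HB Require Import structures.
From mathcomp Require Import all_boot all_order all_algebra.
From mathcomp Require Import complex.
From mathcomp Require Import all_classical all_reals all_analysis.

Set Implicit Arguments.
Unset Strict Implicit.
Unset Printing Implicit Defensive.

Import Order.TTheory GRing.Theory Num.Theory.
Import numFieldNormedType.Exports.
Import ComplexField.Normc.

Local Open Scope classical_set_scope.
Local Open Scope ring_scope.
Local Open Scope complex_scope.

Section Circle.
Context {R : realType}.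
Local Notation C := R[i].
Local Notation mu := (@lebesgue_measure R).
Implicit Types (f g phi psi : R -> C) (K U : set R) (S : (R -> C) -> C).

Definition re_part f : R -> R := fun t => complex.Re (f t).
Definition im_part f : R -> R := fun t => complex.Im (f t).

Definition periodic f : Prop := forall t, f (t + 2 * pi) = f t.

Definition periodic_set U : Prop := forall t, U (t + 2 * pi) <-> U t.

Definition circle_open U : Prop := periodic_set U /\ open U.

Definition circle_compact K : Prop := periodic_set K /\ closed K.

Definition expi (n : int) : R -> C :=
  fun t => cos (n%:~R * t) +i* sin (n%:~R * t).

Definition circle_mean f : C :=
  ((2 * pi)^-1 * \int[mu]_(t in `[0, 2 * pi]) re_part f t) +i*
  ((2 * pi)^-1 * \int[mu]_(t in `[0, 2 * pi]) im_part f t).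

Definition fun_fourier f (n : int) : C :=
  circle_mean (fun t => f t * expi (- n) t).

(* The sum of the [c n * expi n t] over -N <= n <= N. *)
Definition trig_partial_sum (c : int -> C) (N : nat) (t : R) : C :=
  \sum_(k < N.*2.+1) c (k%:Z - N%:Z) * expi (k%:Z - N%:Z) t.

Definition ell (p : R) (c : int -> C) : Prop :=
  (\esum_(n in [set: int]) (normc (c n) `^ p)%:E < +oo)%E.

(* The Wiener algebra A(T).  Continuity and integrability of [g] need not be
   required: they follow from the uniform convergence of the series. *)
Definition wiener g : Prop :=
  [/\ periodic g, ell 1 (fun_fourier g) &
   forall t, normc (g t - trig_partial_sum (fun_fourier g) N t) @[N --> \oo]
               --> (0 : R)].

Definition continuous_on K f : Prop :=
  {within K, continuous (re_part f)} /\ {within K, continuous (im_part f)}.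

(* A function on [K] is represented by a periodic function on R whose values
   off [K] are irrelevant. *)
Definition helson K : Prop :=
  circle_compact K /\
  forall f, periodic f -> continuous_on K f ->
    exists2 g, wiener g & forall t, K t -> g t = f t.

Definition test_function phi : Prop :=
  periodic phi /\
  forall (n : nat) (t : R), derivable (derive1n n (re_part phi)) t 1 /\
                            derivable (derive1n n (im_part phi)) t 1.

Definition cderiven (n : nat) phi : R -> C :=
  fun t => derive1n n (re_part phi) t +i* derive1n n (im_part phi) t.

Definition sup_norm f : R := sup (range (fun t => normc (f t))).

(* Only the values of [S] on test functions matter.  The last clause is
   continuity for the Frechet topology of C^oo(T). *)
Definition schwartz_distribution S : Prop :=
  (forall (a : C) phi psi, test_function phi -> test_function psi ->
     S (fun t => a * phi t + psi t) = a * S phi + S psi) /\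
  exists (N : nat) (M : R), forall phi, test_function phi ->
    normc (S phi) <= M * \sum_(k < N.+1) sup_norm (cderiven k phi).

Definition nonzero_distribution S : Prop :=
  exists2 phi, test_function phi & S phi != 0.

Definition fun_support phi : set R := closure [set t | phi t != 0].

Definition vanishes_on S U : Prop :=
  forall phi, test_function phi -> fun_support phi `<=` U -> S phi = 0.

Definition dist_support S : set R :=
  [set t | forall U, circle_open U -> U t -> ~ vanishes_on S U].

Definition supports K S : Prop := dist_support S `<=` K.

Definition dist_fourier S (n : int) : C := S (expi (- n)).

End Circle.

(* Main.v *)
Require Import Defs.
From HB Require Import structures.
From mathcomp Require Import all_boot all_order all_algebra.
From mathcomp Require Import complex.
From mathcomp Require Import all_classical all_reals all_analysis.
From mathcomp Require Import measurable_realfun.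
From mathcomp Require Import zify ring lra.
Import Order.TTheory GRing.Theory Num.Theory.
Import numFieldNormedType.Exports.
Import ComplexField.Normc.
Set Implicit Arguments.
Unset Strict Implicit.
Unset Printing Implicit Defensive.
Local Open Scope classical_set_scope.
Local Open Scope ring_scope.

(** [K] supports a limit, for convergence in l^q of Fourier coefficients, of
    bounded functions [F k] whose supports shrink to [K].  To pass from [F] to
    the next function, given a real continuous [P] with sign [h], multiply [F]
    by [sum_i w_i prod_(j < N) (1 + s_i h(t) cos (n_j t))], where the nodes
    [s_i] lie in [[s0, e s0]] and the signed weights [w_i] have sum 1 and
    vanishing moments of orders [1 .. M]; then cut off to the set where
    [P * g >= theta |P|], with [g := N^-1 sum_j cos (n_j t)].

    For lacunary frequencies the l^q norm of a Riesz product behaves like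
    [exp (C N s0^q)], and its terms of order at most [M] cancel, so the
    multiplication changes [F] little in l^q if [N s0^q] is much smaller than
    [M].  By a Chernoff bound the cut-off costs at most
    [sum_i |w_i| exp (- c N s0^2)] in L^2, where [sum_i |w_i| <= C^M].  Since
    [q > 2], a small [s0] leaves room for [N s0^q << M << N s0^2], and letting
    [M] grow with [N / M] fixed makes both errors tend to 0 while [theta], a
    multiple of [s0], is the same at all stages.

    [P] runs through a countable family separating disjoint compact sets.  If
    [u] is continuous on [K] with [|u| <= 1], choose [P] positive where
    [u >= 1/10] and negative where [u <= - 1/10]; then [|u - g / 4|] is at most
    [1 - theta / 4] on [K], and [g] has norm at most 1 in the Wiener algebra.
    Iterating writes [u] as an absolutely convergent cosine series on [K]. *)

(** * Mean values of bounded measurable functions *)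

Section Mean.
Context {R : realType}.
Implicit Types (f g : R -> R).
Local Notation mu := (@lebesgue_measure R).

(** The iteration on [K] needs one contraction factor for every [P], so [s0] is fixed once and for
    all. This rules out a single Riesz product: its terms of first order alone contribute about
    [N s0^q] to the q-th power of the l^q distance from [F], which for fixed [s0] grows with [N],
    whereas the cut-off is cheap only when [N s0^2] is large. The weights cancel these low orders;
    what is left has order above [M], where a geometric gain [Y ^+ M] outweighs the total weight.
    The cut-off is paid for likewise: its exponential gain is the [M]-th power of a constant
    prescribed through [N / M].

    The sign [h] may jump at the zeros of [P], and so may the cut-off, so the functions [F k] are
    only bounded and measurable. They are estimated through their coefficients alone, and regularity
    is used only on the side of the test functions. As [h ^+ 2 = 1], terms of even degree in the
    cosines involve the coefficients of [F] and those of odd degree the coefficients of [h F]; both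
    sequences are followed together. *)

Definition bm f : Prop :=
  measurable_fun setT f /\ exists B, forall t, `|f t| <= B.

Lemma bm_ge0 f : bm f -> exists2 B, 0 <= B & forall t, `|f t| <= B.
Proof. by move=> [_ [B fB]]; exists B => //; exact: le_trans (fB 0). Qed.

Lemma bm_cst c : bm (fun=> c).
Proof. by split; [exact: measurable_cst | exists `|c|]. Qed.

Lemma bmD f g : bm f -> bm g -> bm (fun t => f t + g t).
Proof.
move=> [mf [A fA]] [mg [B gB]]; split; first exact: measurable_funD.
by exists (A + B) => t; rewrite (le_trans (ler_normD _ _))// lerD.
Qed.

Lemma bmM f g : bm f -> bm g -> bm (fun t => f t * g t).
Proof.
move=> [mf [A fA]] [mg [B gB]]; split; first exact: measurable_funM.
by exists (A * B) => t; rewrite normrM ler_pM.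
Qed.

Lemma bmZ c f : bm f -> bm (fun t => c * f t).
Proof. by move=> bf; apply: bmM => //; exact: bm_cst. Qed.

Lemma bmB f g : bm f -> bm g -> bm (fun t => f t - g t).
Proof.
move=> bf bg; have -> : (fun t => f t - g t) = (fun t => f t + (-1) * g t).
  by apply/funext => t; rewrite mulN1r.
by apply: bmD => //; exact: bmZ.
Qed.

Lemma bmX f n : bm f -> bm (fun t => f t ^+ n).
Proof.
move=> bf; elim: n => [|n IH].
  by under eq_fun do rewrite expr0; exact: bm_cst.
by under eq_fun do rewrite exprS; exact: bmM.
Qed.

Lemma bm_sum (I : Type) (s : seq I) (F : I -> R -> R) :
  (forall i, bm (F i)) -> bm (fun t => \sum_(i <- s) F i t).
Proof.
move=> bF; elim: s => [|i s IH].
  by under eq_fun do rewrite big_nil; exact: bm_cst.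
by under eq_fun do rewrite big_cons; exact: bmD.
Qed.

Lemma bm_prod (I : Type) (s : seq I) (F : I -> R -> R) :
  (forall i, bm (F i)) -> bm (fun t => \prod_(i <- s) F i t).
Proof.
move=> bF; elim: s => [|i s IH].
  by under eq_fun do rewrite big_nil; exact: bm_cst.
by under eq_fun do rewrite big_cons; exact: bmM.
Qed.

Lemma bm_cos (a : R) : bm (fun t => cos (a * t)).
Proof.
split; last by exists 1 => t; exact: cos_max.
apply: continuous_measurable_fun => t; apply: (@continuous_comp _ _ _ _ cos).
  by apply: cvgM; [exact: cvg_cst | exact: cvg_id].
exact: continuous_cos.
Qed.

Lemma bm_sin (a : R) : bm (fun t => sin (a * t)).
Proof.
split; last by exists 1 => t; exact: sin_max.
apply: continuous_measurable_fun => t; apply: (@continuous_comp _ _ _ _ sin).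
  by apply: cvgM; [exact: cvg_cst | exact: cvg_id].
exact: continuous_sin.
Qed.

Definition mean f : R := (2 * pi)^-1 * \int[mu]_(t in `[0, 2 * pi]) f t.

Lemma twopi_gt0 : 0 < 2 * pi :> R.
Proof. by rewrite mulr_gt0 ?pi_gt0. Qed.

Lemma bm_integrable f : bm f -> mu.-integrable `[0, 2 * pi] (EFin \o f).
Proof.
move=> [mf [B fB]]; apply: measurable_bounded_integrable => //.
- by rewrite /= lebesgue_measure_itv/=; case: ifP; rewrite ?ltry// -EFinB ltry.
- by apply: measurable_funS mf.
- exists B; split; first exact: num_real.
  by move=> y By t _; exact: le_trans (fB t) (ltW By).
Qed.

Lemma meanD f g : bm f -> bm g ->
  mean (fun t => f t + g t) = mean f + mean g.
Proof.
move=> bf bg; rewrite /mean (@RintegralD _ _ _ mu _ f g); last first.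
- exact: bm_integrable.
- exact: bm_integrable.
- exact: measurable_itv.
by rewrite mulrDr.
Qed.

Lemma meanB f g : bm f -> bm g ->
  mean (fun t => f t - g t) = mean f - mean g.
Proof.
move=> bf bg; rewrite /mean (@RintegralB _ _ _ mu _ f g); last first.
- exact: bm_integrable.
- exact: bm_integrable.
- exact: measurable_itv.
by rewrite mulrBr.
Qed.

Lemma meanZ c f : bm f -> mean (fun t => c * f t) = c * mean f.
Proof.
move=> bf; rewrite /mean (@RintegralZl _ _ _ mu _ f c); last first.
- exact: bm_integrable.
- exact: measurable_itv.
by rewrite mulrCA.
Qed.

Lemma mean_cst c : mean (fun=> c) = c.
Proof.
rewrite /mean Rintegral_cst//= lebesgue_measure_itv/= lte_fin twopi_gt0.
by rewrite oppr0 addr0/= mulrCA mulVf ?mulr1// gt_eqF// twopi_gt0.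
Qed.

Lemma le_mean_on f g : bm f -> bm g ->
  (forall t, 0 <= t <= 2 * pi -> f t <= g t) -> mean f <= mean g.
Proof.
move=> bf bg fg; rewrite /mean ler_wpM2l ?invr_ge0 ?(ltW twopi_gt0)//.
apply: le_Rintegral; [by []|exact: bm_integrable|exact: bm_integrable|].
by move=> t /=; rewrite in_itv/= => /fg.
Qed.

Lemma le_mean f g : bm f -> bm g -> (forall t, f t <= g t) -> mean f <= mean g.
Proof. by move=> bf bg fg; apply: le_mean_on. Qed.

Lemma mean_ge0 f : bm f -> (forall t, 0 <= f t) -> 0 <= mean f.
Proof.
by move=> bf f0; rewrite -[leLHS](mean_cst 0) le_mean//; exact: bm_cst.
Qed.

Lemma eq_mean_on f g :
  (forall t, 0 <= t <= 2 * pi -> f t = g t) -> mean f = mean g.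
Proof.
move=> fg; congr (_ * _); apply: eq_Rintegral => t.
by rewrite inE/= in_itv/= => /fg.
Qed.

Lemma ler_norm_mean f B : bm f -> (forall t, `|f t| <= B) -> `|mean f| <= B.
Proof.
move=> bf fB; rewrite ler_norml -[leLHS]mean_cst -[B in X in _ && X]mean_cst.
apply/andP; split; apply: le_mean => //; try exact: bm_cst;
by move=> t; move: (fB t); rewrite ler_norml => /andP[].
Qed.

Lemma mean_sum (I : Type) (s : seq I) (F : I -> R -> R) :
  (forall i, bm (F i)) ->
  mean (fun t => \sum_(i <- s) F i t) = \sum_(i <- s) mean (F i).
Proof.
move=> bF; elim: s => [|i s IH].
  by under eq_fun do rewrite big_nil; rewrite mean_cst big_nil.
under eq_fun do rewrite big_cons.
by rewrite meanD ?IH ?big_cons//; exact: bm_sum.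
Qed.

(** Serves both for the orthogonality relations and, applied to a product, for integration by
    parts. *)
Lemma mean_deriv_periodic (F f : R -> R) :
  (forall t : R, is_derive t 1 F (f t)) -> continuous f -> F (2 * pi) = F 0 ->
  mean f = 0.
Proof.
move=> dF cf F2; rewrite /mean.
have cF : continuous F.
  by move=> t; apply: differentiable_continuous; apply/derivable1_diffP;
     have [] := dF t.
rewrite /Rintegral (@continuous_FTC2 R f F) ?twopi_gt0//.
- by rewrite F2 subee// mulr0.
- by apply: continuous_subspaceT.
- split.
  + by move=> x _; have [] := dF x.
  + by apply: cvg_at_right_filter; exact: cF.
  + by apply: cvg_at_left_filter; exact: cF.
- by move=> x _; rewrite derive1E; exact: derive_val.
Qed.

Lemma cos_int_2pi (n : int) : cos (n%:~R * (2 * pi)) = 1 :> R.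
Proof.
have H (m : nat) : cos (m%:R * (2 * pi)) = 1 :> R.
  have -> : m%:R * (2 * pi) = 0 + pi *+ 2 *+ m :> R.
    by rewrite add0r -[RHS]mulr_natl -[X in _ = _ * X]mulr_natl.
  by rewrite (periodicn (@cosD2pi R)) cos0.
by case: n => m; rewrite ?NegzE ?mulrNz ?mulNr ?cosN H.
Qed.

Lemma mean_cos (n : int) : mean (fun t => cos (n%:~R * t)) = (n == 0)%:R.
Proof.
have [->|n0] := eqVneq.
  by under eq_fun do rewrite mul0r cos0; rewrite mean_cst.
have n0' : n%:~R != 0 :> R by rewrite intr_eq0.
apply: (@mean_deriv_periodic (fun t => n%:~R^-1 * sin (n%:~R * t))).
- move=> t; apply: is_derive_eq; rewrite /GRing.scale/=.
  by rewrite mulr1 mulrCA mulVf ?mulr1.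
- move=> t; apply: (@continuous_comp _ _ _ _ cos).
    by apply: cvgM; [exact: cvg_cst | exact: cvg_id].
  exact: continuous_cos.
- have := cos2Dsin2 (n%:~R * (2 * pi) : R).
  rewrite cos_int_2pi expr1n => /eqP; rewrite -subr_eq0 addrAC subrr add0r.
  by rewrite expf_eq0/= => /eqP ->; rewrite mulr0 mulr0 sin0 mulr0.
Qed.

Lemma mean_sin (n : int) : mean (fun t => sin (n%:~R * t)) = 0.
Proof.
have [->|n0] := eqVneq n 0.
  by under eq_fun do rewrite mul0r sin0; rewrite mean_cst.
have n0' : n%:~R != 0 :> R by rewrite intr_eq0.
apply: (@mean_deriv_periodic (fun t => - n%:~R^-1 * cos (n%:~R * t))).
- move=> t; apply: is_derive_eq; rewrite /GRing.scale/=.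
  by rewrite mulr1 [X in _ * X]mulNr mulrNN mulrCA mulVf ?mulr1.
- move=> t; apply: (@continuous_comp _ _ _ _ sin).
    by apply: cvgM; [exact: cvg_cst | exact: cvg_id].
  exact: continuous_sin.
- by rewrite cos_int_2pi mulr0 cos0.
Qed.

End Mean.

(** * Families over the integers with bounded finite sums *)

Section SummableFamilies.
Context {R : realType}.
Implicit Types (a b : int -> R).

(** Summability in an order-free form: testing on duplicate-free lists makes reindexing, splitting
    and interchange with finite sums elementary. [ell_of_sb] converts the bound into an extended sum
    at the end. *)
Definition sb a (V : R) : Prop :=
  forall s : seq int, uniq s -> \sum_(n <- s) a n <= V.

Lemma sb_le a V n : sb a V -> a n <= V.
Proof. by move=> /(_ [:: n] isT); rewrite big_seq1. Qed.

Lemma sb_ge0 a V : sb a V -> 0 <= V.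
Proof. by move=> /(_ [::] isT); rewrite big_nil. Qed.

Lemma sb_mono a b V W : (forall n, a n <= b n) -> V <= W -> sb b V -> sb a W.
Proof.
move=> ab VW bV s us; rewrite (le_trans _ VW)// (le_trans _ (bV s us))//.
exact: ler_sum.
Qed.

Lemma sbD a b V W : sb a V -> sb b W -> sb (fun n => a n + b n) (V + W).
Proof. by move=> aV bW s us; rewrite big_split lerD ?aV ?bW. Qed.

Lemma sbZ c a V : 0 <= c -> sb a V -> sb (fun n => c * a n) (c * V).
Proof. by move=> c0 aV s us; rewrite -mulr_sumr ler_wpM2l ?aV. Qed.

Lemma sb_comp (g : int -> int) a V : injective g -> sb a V -> sb (a \o g) V.
Proof.
move=> gi aV s us; rewrite -(big_map g predT a).
by apply: aV; rewrite map_inj_uniq.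
Qed.

(** The sum over [s0] comes within [e] of the supremum of all finite sums, so a list disjoint from
    [s0] cannot add more than [e]. *)
Lemma sb_tail a (V e : R) : sb a V -> 0 < e ->
  exists s0 : seq int, forall s, uniq s -> {in s, forall n, n \notin s0} ->
    \sum_(n <- s) a n <= e.
Proof.
move=> aV e0.
pose E := [set x | exists2 s : seq int, uniq s & x = \sum_(n <- s) a n].
have supE : has_sup E.
  split; first by exists 0; exists [::]; rewrite ?big_nil.
  by exists V => x [s us ->]; exact: aV.
have [_ [s0 us0 ->] lts0] := sup_adherent e0 supE.
exists s0 => s us dis.
have : \sum_(n <- s ++ s0) a n <= sup E.
  apply: sup_upper_bound => //; exists (s ++ s0) => //.
  rewrite cat_uniq us us0 andbT/= -all_predC; apply/allP => n ns0/=.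
  by apply/negP => ns; move: (dis _ ns); rewrite ns0.
rewrite big_cat/=; lra.
Qed.

Lemma sb_vanish a (V e : R) : sb a V -> 0 < e ->
  exists D : nat, forall n : int, (D < `|n|)%N -> a n <= e.
Proof.
move=> aV e0; have [s0 s0P] := sb_tail aV e0.
exists (\max_(n <- s0) `|n|%N)%N => n Dn.
rewrite -[a n](big_seq1 +%R n a) s0P// => m; rewrite inE => /eqP ->.
apply/negP => ns0; move: Dn; rewrite ltnNge => /negP; apply.
by rewrite (big_rem n)//= leq_maxl.
Qed.

End SummableFamilies.

(** * Hartley coefficients *)

Section Hartley.
Context {R : realType}.
Implicit Types (f g : R -> R).

(* Hartley transform: [cas (n t)], for integer [n], is a real orthonormal system,
   and [hart f n], [hart f (- n)] are the sum and the difference of the cosine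
   and sine coefficients of [f]. *)
Definition cas (u : R) : R := cos u + sin u.

Definition hart f (n : int) : R := mean (fun t => f t * cas (n%:~R * t)).

Lemma cas_le2 u : `|cas u| <= 2.
Proof.
by rewrite (le_trans (ler_normD _ _))// (le_trans (lerD (cos_max u) (sin_max u))).
Qed.

Lemma bm_cas (n : int) : bm (fun t : R => cas (n%:~R * t)).
Proof. by apply: bmD; [exact: bm_cos | exact: bm_sin]. Qed.

Lemma casM u v : cas u * cas v = cos (u - v) + sin (u + v).
Proof. by rewrite /cas cosB sinD; ring. Qed.

Lemma mean_cas2 (n m : int) :
  mean (fun t => cas (n%:~R * t) * cas (m%:~R * t)) = (n == m)%:R.
Proof.
transitivity (mean (fun t => cos ((n - m)%:~R * t) + sin ((n + m)%:~R * t)) : R).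
  by congr mean; apply/funext => t; rewrite casM intrB intrD mulrBl mulrDl.
rewrite meanD; [|exact: bm_cos|exact: bm_sin].
by rewrite mean_cos mean_sin addr0 subr_eq0.
Qed.

Lemma hartD f g n : bm f -> bm g ->
  hart (fun t => f t + g t) n = hart f n + hart g n.
Proof.
move=> bf bg; rewrite /hart -meanD; first last.
- by apply: bmM => //; exact: bm_cas.
- by apply: bmM => //; exact: bm_cas.
by congr mean; apply/funext => t; rewrite mulrDl.
Qed.

Lemma hartZ c f n : bm f -> hart (fun t => c * f t) n = c * hart f n.
Proof.
move=> bf; rewrite /hart -meanZ; last by apply: bmM => //; exact: bm_cas.
by congr mean; apply/funext => t; rewrite mulrA.
Qed.

Lemma hartB f g n : bm f -> bm g ->
  hart (fun t => f t - g t) n = hart f n - hart g n.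
Proof.
move=> bf bg; rewrite /hart -meanB; first last.
- by apply: bmM => //; exact: bm_cas.
- by apply: bmM => //; exact: bm_cas.
by congr mean; apply/funext => t; rewrite mulrBl.
Qed.

Lemma hart_sum (I : Type) (s : seq I) (F : I -> R -> R) n :
  (forall i, bm (F i)) ->
  hart (fun t => \sum_(i <- s) F i t) n = \sum_(i <- s) hart (F i) n.
Proof.
move=> bF; rewrite /hart -mean_sum; last by move=> i; apply: bmM => //; exact: bm_cas.
by congr mean; apply/funext => t; rewrite mulr_suml.
Qed.

(** A cosine factor averages two shifts of the coefficient sequence, without mixing in the
    reflection of [n] into [- n]. This is what makes these coefficients convenient for products of
    cosines. *)
Lemma hart_cos_shift f (v n : int) : bm f ->
  hart (fun t => f t * cos (v%:~R * t)) n = (hart f (n + v) + hart f (n - v)) / 2.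
Proof.
move=> bf.
have bfc m : bm (fun t => f t * cas (m%:~R * t)) by apply: bmM => //; exact: bm_cas.
rewrite [RHS]mulrC /hart -meanD// -meanZ; last exact: bmD.
congr mean; apply/funext => t.
by rewrite /cas intrB intrD mulrBl mulrDl cosB cosD sinB sinD; field.
Qed.

Lemma mean_mul_cos f (v : int) : bm f ->
  mean (fun t => f t * cos (v%:~R * t)) = (hart f v + hart f (- v)) / 2.
Proof.
move=> bf; have := hart_cos_shift v 0 bf; rewrite add0r sub0r => <-.
by congr mean; apply/funext => t; rewrite mul0r /cas cos0 sin0 addr0 mulr1.
Qed.

(** The mean square of [f - P] is nonnegative, where [P] is the projection of [f] on the functions
    [cas (n t)] with [n] in [s]; the means of [f * P] and [P * P] are both the sum of squares. *)
Lemma bessel f : bm f -> sb (fun n => hart f n ^+ 2) (mean (fun t => f t ^+ 2)).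
Proof.
move=> bf s us; pose P t := \sum_(n <- s) hart f n * cas (n%:~R * t).
have bcas n : bm (fun t => hart f n * cas (n%:~R * t)) by apply: bmZ; exact: bm_cas.
have bP : bm P by exact: bm_sum.
have fP : mean (fun t => f t * P t) = \sum_(n <- s) hart f n ^+ 2.
  transitivity (mean (fun t => \sum_(n <- s) hart f n * (f t * cas (n%:~R * t)))).
    by congr mean; apply/funext => t; rewrite mulr_sumr; apply: eq_bigr => n _; ring.
  have bfc n : bm (fun t => f t * cas (n%:~R * t)) by apply: bmM => //; exact: bm_cas.
  rewrite mean_sum; last by move=> n; exact: bmZ.
  by apply: eq_bigr => n _; rewrite meanZ// expr2.
have Pcas m : m \in s -> mean (fun t => P t * cas (m%:~R * t)) = hart f m.
  move=> ms; transitivity (mean (fun t => \sum_(n <- s)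
      hart f n * (cas (n%:~R * t) * cas (m%:~R * t)))).
    by congr mean; apply/funext => t; rewrite mulr_suml; apply: eq_bigr => n _; ring.
  have bcc n : bm (fun t : R => cas (n%:~R * t) * cas (m%:~R * t)).
    by apply: bmM; exact: bm_cas.
  rewrite mean_sum; last by move=> n; exact: bmZ.
  under eq_bigr do rewrite meanZ// mean_cas2.
  rewrite (bigD1_seq m)//= eqxx mulr1 big1 ?addr0// => n /negPf ->.
  by rewrite mulr0.
have PP : mean (fun t => P t * P t) = \sum_(n <- s) hart f n ^+ 2.
  transitivity (mean (fun t => \sum_(n <- s) hart f n * (P t * cas (n%:~R * t)))).
    congr mean; apply/funext => t; rewrite {2}/P mulr_sumr.
    by apply: eq_bigr => n _; ring.
  have bPc n : bm (fun t => P t * cas (n%:~R * t)) by apply: bmM => //; exact: bm_cas.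
  rewrite mean_sum; last by move=> n; exact: bmZ.
  rewrite big_seq [RHS]big_seq; apply: eq_bigr => n ns.
  by rewrite meanZ// Pcas// expr2.
have : 0 <= mean (fun t => f t ^+ 2 - (2 * (f t * P t) - P t * P t)).
  apply: mean_ge0.
    apply: bmB; first exact: bmX.
    by apply: bmB; [apply: bmZ; exact: bmM | exact: bmM].
  move=> t; have := sqr_ge0 (f t - P t); rewrite sqrrB; lra.
rewrite meanB; [|exact: bmX|by apply: bmB; [apply: bmZ; exact: bmM|exact: bmM]].
rewrite meanB; [|by apply: bmZ; exact: bmM|exact: bmM].
rewrite meanZ; last exact: bmM.
rewrite fP PP; lra.
Qed.

Lemma riemann_lebesgue f (e : R) : bm f -> 0 < e ->
  exists D : nat, forall n : int, (D < `|n|)%N -> `|hart f n| <= e.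
Proof.
move=> bf e0; have [D DP] := sb_vanish (bessel bf) (exprn_gt0 2 e0).
exists D => n /DP; rewrite -[hart f n ^+ 2]real_normK ?num_real//.
by rewrite ler_pXn2r// ?nnegrE// ltW.
Qed.

Lemma riemann_lebesgue_cos f (e : R) : bm f -> 0 < e ->
  exists D : nat, forall n : nat, (D < n)%N ->
    `|mean (fun t => f t * cos (n%:R * t))| <= e.
Proof.
move=> bf e0; have [D DP] := riemann_lebesgue bf e0.
exists D => n Dn; have := mean_mul_cos n%:Z bf; rewrite -[n%:~R]/(n%:R) => ->.
have h1 := DP n%:Z Dn; have h2 : `|hart f (- n%:Z)| <= e by apply: DP; rewrite abszN.
rewrite normrM [`|2^-1|]ger0_norm//.
rewrite ler_pdivrMr// (le_trans (ler_normD _ _))//; lra.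
Qed.

End Hartley.

(** * Sums of q-th powers *)

Section PowerQ.
Context {R : realType} (q : R).
Context (q2 : 2 < q).
Implicit Types (x y : R).

(** No q-th root is ever taken: sums of q-th powers add up over nearly disjoint coefficient
    sequences, which is how lacunarity is exploited. *)
Definition normpow x : R := `|x| `^ q.

Let q0 : 0 <= q. Proof. by rewrite (le_trans _ (ltW q2)). Qed.

Local Notation pw := normpow.

Lemma pw_ge0 x : 0 <= pw x. Proof. exact: powR_ge0. Qed.

Lemma pw0 : pw 0 = 0.
Proof. by rewrite /normpow normr0 powR0// gt_eqF// (lt_trans _ q2). Qed.

Lemma le_pw x y : `|x| <= `|y| -> pw x <= pw y.
Proof. by move=> xy; apply: ge0_ler_powR => //; rewrite nnegrE. Qed.

Lemma pwM x y : pw (x * y) = pw x * pw y.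
Proof. by rewrite /normpow normrM powRM. Qed.

Lemma pwV x : pw x^-1 = (pw x)^-1.
Proof.
have [->|x0] := eqVneq x 0; first by rewrite invr0 pw0 invr0.
apply: (mulfI (x := pw x)).
  by rewrite /normpow powR_eq0 negb_and normr_eq0 x0.
rewrite -pwM divff// divff ?/normpow ?normr1 ?powR1//.
by rewrite powR_eq0 negb_and normr_eq0 x0.
Qed.

Lemma pwX x n : pw (x ^+ n) = pw x ^+ n.
Proof.
elim: n => [|n IH]; first by rewrite /normpow normr1 powR1.
by rewrite !exprS pwM IH.
Qed.

Lemma pwD_max x y : pw (x + y) <= pw 2 * Num.max (pw x) (pw y).
Proof.
wlog xy : x y / `|x| <= `|y|.
  move=> H; have [|/ltW] := leP `|x| `|y|; first exact: H.
  by rewrite addrC maxC; exact: H.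
rewrite (le_trans _ (_ : pw 2 * pw y <= _))//; last first.
  by rewrite ler_wpM2l ?pw_ge0// le_max lexx orbT.
by rewrite -pwM le_pw// normrM [`|2|]ger0_norm// mulr_natl mulr2n
  (le_trans (ler_normD _ _))// lerD2r.
Qed.

Lemma max_le_add (a b : R) : 0 <= a -> 0 <= b -> Num.max a b <= a + b.
Proof. by move=> a0 b0; rewrite ge_max lerDl lerDr a0 b0. Qed.

Lemma pwD x y : pw (x + y) <= pw 2 * (pw x + pw y).
Proof.
by rewrite (le_trans (pwD_max x y))// ler_wpM2l ?pw_ge0// max_le_add ?pw_ge0.
Qed.

Lemma pw_half x y : pw ((x + y) / 2) <= pw x + pw y.
Proof.
rewrite pwM pwV ler_pdivrMr; last by rewrite powR_gt0// ger0_norm.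
by rewrite mulrC pwD.
Qed.

Lemma pw_cont x (e : R) : 0 < e ->
  exists2 d : R, 0 < d & forall z, `|z| <= d -> pw (x + z) <= pw x + e.
Proof.
move=> e0; have [->|x0] := eqVneq x 0.
  exists (e `^ q^-1); first exact: powR_gt0.
  move=> z ze; rewrite add0r pw0 add0r.
  rewrite (le_trans (ge0_ler_powR q0 _ _ ze)) ?nnegrE ?powR_ge0//.
  by rewrite -powRrM mulVf ?powRr1 ?(ltW e0)// (gt_eqF (lt_trans _ q2)).
have nx0 : 0 < `|x| by rewrite normr_gt0.
have dx : derivable (@powR R ^~ q) `|x| 1.
  by apply: derivable_powR; rewrite in_itv/= nx0.
have cx : {for `|x|, continuous (@powR R ^~ q)}.
  by apply: differentiable_continuous; exact/derivable1_diffP.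
have /cvgrPdist_le/(_ _ e0) := cx => -[d/= d0 dP].
exists (d / 2); first by rewrite divr_gt0.
move=> z zd.
have : pw (`|x| + `|z|) <= pw x + e.
  have : `| (`|x| `^ q - (`|x| + `|z|) `^ q) | <= e.
    apply: dP => /=; rewrite opprD addrA subrr add0r normrN normr_id.
    by rewrite (le_lt_trans zd)// ltr_pdivrMr// mulr_natr mulr2n ltrDl.
  rewrite /normpow ler_norml => /andP[+ _]; rewrite [`|_ + _|]ger0_norm ?addr_ge0//.
  by move: (_ `^ _) => a; move: (_ `^ _) => b; lra.
apply: le_trans; apply: le_pw.
by rewrite [leRHS]ger0_norm ?addr_ge0// ler_normD.
Qed.

(** Either the first term is at least the sum of the others, and [i = 0] works, or the whole sum is
    at most twice the sum of the others, and the search continues there. *)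
Lemma sum_le_dyadic n (x : nat -> R) : (forall i, 0 <= x i) ->
  \sum_(i < n) x i = 0 \/
  exists2 i, (i < n)%N & \sum_(j < n) x j <= 2 ^+ i.+1 * x i.
Proof.
elim: n x => [x _|n IH x x0]; first by left; rewrite big_ord0.
right; rewrite big_ord_recl/=.
have [h|h] := leP (\sum_(j < n) x (bump 0 j)) (x 0%N).
  by exists 0%N; rewrite // expr1 mulr_natl mulr2n lerD2l.
have [E|[i ilt iP]] := IH (fun i => x i.+1) (fun i => x0 _).
  by move: h; rewrite (_ : \sum_(j < n) _ = 0)// => /(le_lt_trans (x0 _)); rewrite ltxx.
exists i.+1 => //; rewrite exprS -mulrA mulr_natl mulr2n lerD//.
exact: le_trans (ltW h) iP.
Qed.

(* A finite sum is at most [2 ^+ i.+1] times its [i]-th term for some [i]; this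
   replaces the triangle inequality in l^q. *)
Lemma pw_sum n (x : nat -> R) :
  pw (\sum_(i < n) x i) <= \sum_(i < n) pw (2 ^+ i.+1) * pw (x i).
Proof.
have s0 : 0 <= \sum_(i < n) pw (2 ^+ i.+1) * pw (x i).
  by apply: sumr_ge0 => i _; rewrite mulr_ge0 ?pw_ge0.
have le1 : `|\sum_(i < n) x i| <= \sum_(i < n) `|x i| by exact: ler_norm_sum.
have [E|[i ilt iP]] := @sum_le_dyadic n (fun i => `|x i|) (fun i => normr_ge0 _).
  move: le1; rewrite E normr_le0 => /eqP ->; by rewrite pw0.
rewrite [leRHS](bigD1 (Ordinal ilt))//= -pwM.
apply: (@le_trans _ _ (pw (2 ^+ i.+1 * x i))).
  by apply: le_pw; rewrite (le_trans le1)// normrM [`|2 ^+ _|]ger0_norm ?exprn_ge0.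
by rewrite lerDl sumr_ge0// => j _; rewrite mulr_ge0 ?pw_ge0.
Qed.

Lemma pw_le_sqr x : `|x| <= 1 -> pw x <= x ^+ 2.
Proof.
move=> x1; have [->|x0] := eqVneq x 0; first by rewrite pw0 expr0n.
rewrite -[x ^+ 2]real_normK ?num_real// -powR_mulrn// /normpow.
by apply: ger_powR; [rewrite normr_gt0 x0 | exact: ltW].
Qed.

Lemma sb_pw_sqr (x : int -> R) W : W <= 1 -> sb (fun n => x n ^+ 2) W ->
  sb (fun n => pw (x n)) W.
Proof.
move=> W1 xW; apply: (@sb_mono _ _ (fun n => x n ^+ 2) W) => // n; apply: pw_le_sqr.
have := le_trans (sb_le n xW) W1.
by rewrite -[x n ^+ 2]real_normK ?num_real// expr_le1.
Qed.

Lemma sb_pw_sqr_ex (x : int -> R) W : sb (fun n => x n ^+ 2) W ->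
  exists2 V, 0 < V & sb (fun n => pw (x n)) V.
Proof.
(* Since [W <= c ^+ 2], every [x n / c] has absolute value at most 1, where [pw_le_sqr] applies. *)
move=> xW; have W0 := sb_ge0 xW; pose c := 1 + W.
have c1 : 1 <= c by rewrite lerDl.
have c0 : 0 < c by rewrite (lt_le_trans _ c1).
exists (pw c * c).
  by rewrite mulr_gt0 // powR_gt0// gtr0_norm.
apply: (@sb_mono _ _ (fun n => pw c * x n ^+ 2) (pw c * W)); last 1 first.
- by apply: sbZ; rewrite ?pw_ge0.
- move=> n; have xn : `|x n / c| <= 1.
    rewrite normrM [`|c^-1|]gtr0_norm ?invr_gt0// ler_pdivrMr// mul1r.
    have : `|x n| ^+ 2 <= c ^+ 2.
      rewrite real_normK ?num_real// (le_trans (sb_le n xW))// expr2.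
      by rewrite (le_trans _ (ler_peMl _ c1)) ?(ltW c0)// /c lerDr.
    by rewrite ler_pXn2r// nnegrE ltW.
  have -> : x n = x n / c * c by rewrite divfK// gt_eqF.
  rewrite pwM mulrC.
  rewrite divfK ?gt_eqF// ler_wpM2l ?pw_ge0// (le_trans (pw_le_sqr xn))// expr_div_n.
  by rewrite ler_pdivrMr ?exprn_gt0// ler_peMr ?sqr_ge0// exprn_ege1.
- by rewrite ler_wpM2l ?pw_ge0// /c lerDr.
Qed.

(** For large [v] both shifts of [y] are negligible on a finite set that carries almost all of [x].
    It matters that [V] has coefficient 1: the lemma is iterated once per frequency, and only the
    part created by the new cosine may pick up a constant. *)
Lemma sb_shift_perturb (x y : int -> R) (V W e : R) : 0 < e ->
  sb (fun n => pw (x n)) V -> sb (fun n => pw (y n)) W ->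
  exists D : nat, forall v : nat, (D < v)%N ->
    sb (fun n => pw (x n + (y (n + v%:Z) + y (n - v%:Z)) / 2))
       (V + pw 2 * 2 * W + e).
Proof.
move=> e0 xV yW.
have pw2 : 0 < pw 2 by rewrite powR_gt0// ger0_norm.
(* Off [s0] the bound [pwD] multiplies the tail of [x] by [pw 2], hence the division. *)
have e1 : 0 < e / 2 / pw 2 by rewrite divr_gt0// divr_gt0.
have [s0 s0P] := sb_tail xV e1.
have e2 : 0 < e / 2 / (size s0).+1%:R by rewrite divr_gt0// divr_gt0.
have y_small (d : R) : 0 < d -> exists D : nat, forall n : int, (D < `|n|)%N -> `|y n| <= d.
  move=> d0; have [|D DP] := @sb_vanish _ _ _ (pw d) yW.
    by rewrite powR_gt0// gtr0_norm.
  exists D => n /DP; rewrite leNgt => h; rewrite leNgt; apply/negP => dy.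
  move/negP: h; apply; apply: gt0_ltr_powR; rewrite ?nnegrE//.
    exact: lt_trans q2.
  by rewrite gtr0_norm.
have [D DP] : exists D : nat, forall v : nat, (D < v)%N -> {in s0, forall n,
    pw (x n + (y (n + v%:Z) + y (n - v%:Z)) / 2) <= pw (x n) + e / 2 / (size s0).+1%:R}.
  move: (_ / _%:R) e2 => e' e2; elim: (s0) => [|m s [D IH]]; first by exists 0%N.
  have [d d0 dP] := pw_cont (x m) e2.
  have [D' D'P] := y_small _ d0.
  exists (maxn D (D' + `|m|)) => v; rewrite gtn_max => /andP[Dv D'v] n.
  rewrite inE => /predU1P[->|]; last by move=> ns; exact: IH.
  have h1 : `|y (m + v%:Z)| <= d by apply: D'P; lia.
  have h2 : `|y (m - v%:Z)| <= d by apply: D'P; lia.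
  apply: dP; rewrite normrM [`|2^-1|]ger0_norm// ler_pdivrMr//.
  rewrite (le_trans (ler_normD _ _))//; lra.
exists D => v Dv; set z := fun n => (y (n + v%:Z) + y (n - v%:Z)) / 2.
have zW : sb (fun n => pw (z n)) (2 * W).
  rewrite mulr_natl mulr2n; apply: (@sb_mono _ _
    (fun n => pw (y (n + v%:Z)) + pw (y (n - v%:Z))) (W + W)) => //.
    by move=> n; exact: pw_half.
  apply: sbD.
    exact: (@sb_comp _ (fun n => n + v%:Z) _ _ (addIr _) yW).
  exact: (@sb_comp _ (fun n => n - v%:Z) _ _ (addIr _) yW).
move=> s us; rewrite (bigID (mem s0))/=.
rewrite -[X in X + _]big_filter -[X in _ + X]big_filter.
set s1 := [seq i <- s | i \in s0]; set s2 := [seq i <- s | i \notin s0].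
have us1 : uniq s1 by exact: filter_uniq.
have us2 : uniq s2 by exact: filter_uniq.
have S1 : \sum_(n <- s1) pw (x n + z n) <= V + e / 2.
  apply: (@le_trans _ _ (\sum_(n <- s1) (pw (x n) + e / 2 / (size s0).+1%:R))).
    rewrite big_seq [leRHS]big_seq; apply: ler_sum => n.
    by rewrite mem_filter => /andP[ns0 _]; exact: DP.
  rewrite big_split/= lerD ?xV// big_const_seq count_predT iter_addr_0.
  rewrite -[_ *+ _]mulr_natr -mulrA ger_pMr ?divr_gt0// mulrC ler_pdivrMr// mul1r.
  rewrite ler_nat leqW// uniq_leq_size// => n.
  by rewrite mem_filter => /andP[].
have S2 : \sum_(n <- s2) pw (x n + z n) <= pw 2 * (2 * W) + e / 2.
  apply: (@le_trans _ _ (\sum_(n <- s2) pw 2 * (pw (x n) + pw (z n)))).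
    by apply: ler_sum => n _; exact: pwD.
  rewrite -mulr_sumr big_split/= mulrDr addrC lerD//.
    by rewrite ler_pM2l// zW.
  rewrite mulrC -ler_pdivlMr// s0P// => n.
  by rewrite mem_filter => /andP[].
by apply: le_trans (lerD S1 S2) _; lra.
Qed.

End PowerQ.

Section Eventually.

Lemma eventually_ltn (P : nat -> nat -> Prop) K :
  (forall m, exists D : nat, forall v : nat, (D < v)%N -> P m v) ->
  exists D : nat, forall v : nat, (D < v)%N -> forall m, (m < K)%N -> P m v.
Proof.
move=> PD; elim: K => [|K [D IH]]; first by exists 0%N.
have [D' D'P] := PD K; exists (maxn D D') => v.
rewrite gtn_max => /andP[Dv D'v] m; rewrite ltnS leq_eqVlt => /predU1P[->|].
  exact: D'P.
exact: IH.
Qed.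

Lemma eventually_seq (T : eqType) (s : seq T) (P : T -> nat -> Prop) :
  (forall m, m \in s -> exists D : nat, forall v : nat, (D < v)%N -> P m v) ->
  exists D : nat, forall v : nat, (D < v)%N -> forall m, m \in s -> P m v.
Proof.
elim: s => [_|x s IH PD]; first by exists 0%N.
have [D DP] := PD x (mem_head _ _).
have [|D' D'P] := IH; first by move=> m ms; apply: PD; rewrite inE ms orbT.
exists (maxn D D') => v; rewrite gtn_max => /andP[Dv D'v] m.
rewrite inE => /predU1P[->|ms]; [exact: DP | exact: D'P].
Qed.

End Eventually.

(** * Riesz products *)

Section Riesz.
Context {R : realType}.
Implicit Types (f h : R -> R) (s : seq nat).

Definition cosn (n : nat) (t : R) : R := cos (n%:R * t).

Lemma bm_cosn n : bm (cosn n). Proof. exact: bm_cos. Qed.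

Lemma cosn_le1 n t : `|cosn n t| <= 1. Proof. exact: cos_max. Qed.

Lemma cosn_sqr n t : cosn n t ^+ 2 = (1 + cosn (2 * n) t) / 2.
Proof.
by rewrite /cosn natrM -mulrA (mulr_natl (n%:R * t) 2) cos_mulr2n; field.
Qed.

Definition riesz (h : R -> R) (c : R) s (t : R) : R :=
  \prod_(n <- s) (1 + c * (h t * cosn n t)).

(* [esym f h s m] is [f] times the elementary symmetric polynomial of degree [m]
   in the functions [h * cosn n], [n] in [s]. *)
Fixpoint esym f h s (m : nat) {struct s} : R -> R :=
  match m, s with
  | 0%N, _ => f
  | _.+1, [::] => fun=> 0
  | m'.+1, n :: s' => fun t => esym f h s' m t + h t * esym f h s' m' t * cosn n t
  end.

Lemma esym0 f h s : esym f h s 0 = f.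
Proof. by case: s. Qed.

Lemma bm_riesz h c s : bm h -> bm (riesz h c s).
Proof.
move=> bh; apply: bm_prod => n; apply: bmD; first exact: bm_cst.
by apply: bmZ; apply: bmM => //; exact: bm_cosn.
Qed.

Lemma bm_esym f h s m : bm f -> bm h -> bm (esym f h s m).
Proof.
move=> bf bh; elim: s m => [|n s IH] [|m]//=; first exact: bm_cst.
apply: bmD; first exact: IH.
by apply: bmM; [apply: bmM => //; exact: IH | exact: bm_cosn].
Qed.

Lemma esym_gt f h s m t : (size s < m)%N -> esym f h s m t = 0.
Proof.
elim: s m => [|n s IH] [|m]//= sm.
by rewrite !IH ?mulr0 ?mul0r ?addr0// ltnW.
Qed.

Lemma riesz_esym f h c s t :
  f t * riesz h c s t = \sum_(m < (size s).+1) c ^+ m * esym f h s m t.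
Proof.
elim: s => [|n s IH]; first by rewrite /riesz big_nil big_ord1 esym0 mulr1 mul1r.
rewrite /riesz big_cons mulrCA -/(riesz h c s t) IH.
rewrite [RHS]big_ord_recl expr0 mul1r esym0.
rewrite [X in _ = _ + X](eq_bigr (fun i : 'I_(size s).+1 =>
    c ^+ i.+1 * esym f h s i.+1 t +
    c * (h t * cosn n t) * (c ^+ i * esym f h s i t))); last first.
  by move=> i _; rewrite /= /bump add1n exprS; ring.
rewrite big_split/= -mulr_sumr mulrDl mul1r addrA; congr (_ + _).
(* The degree [(size s).+1] exceeds the number of cosines in [s], so that term vanishes and the two
   ranges of summation match. *)
by rewrite big_ord_recl [in RHS]big_ord_recr/= esym0 expr0 mul1r esym_gt// mulr0 addr0.
Qed.

End Riesz.

(** * Adding one frequency *)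

Section Lacunary.
Context {R : realType} (q : R).
Context (q2 : 2 < q).
Implicit Types (f h : R -> R) (s : seq nat).
Local Notation pw := (normpow q).

(* Dominates [riesz h c s ^+ 2] tilted by [expR (- c * h * sum_n cosn n)], see
   [riesz_sqr_bad]; being quadratic in each cosine, it has mean close to
   [(1 - c ^+ 2 / 8) ^+ size s] for lacunary frequencies. *)
Definition damp (h : R -> R) (c : R) s (t : R) : R :=
  \prod_(n <- s) (1 + c * (h t * cosn n t) - (c * (h t * cosn n t)) ^+ 2 / 4).

Lemma bm_damp h c s : bm h -> bm (damp h c s).
Proof.
move=> bh; apply: bm_prod => n.
have b1 : bm (fun t => c * (h t * cosn n t)).
  by apply: bmZ; apply: bmM => //; exact: bm_cosn.
apply: bmB; first by apply: bmD => //; exact: bm_cst.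
by apply: bmM; [exact: bmX | exact: bm_cst].
Qed.

(** As [h ^+ 2 = 1], the new factor is [1 - c ^+ 2 / 8] plus two terms oscillating with frequencies
    [v] and [2 v]. By the Riemann-Lebesgue lemma each of them costs at most [c ^+ 2 / 32] times the
    previous bound, which together uses up the gap between [c ^+ 2 / 8] and [c ^+ 2 / 16]. *)
Lemma damp_step h (c : R) s j : bm h -> (forall t, h t ^+ 2 = 1) -> 0 < c <= 1 ->
  mean (damp h c s) <= (1 - c ^+ 2 / 16) ^+ j ->
  exists D : nat, forall v : nat, (D < v)%N ->
    mean (damp h c (v :: s)) <= (1 - c ^+ 2 / 16) ^+ j.+1.
Proof.
move=> bh h1 /andP[c0 c1] ; set T := (1 - _) ^+ j; set u := damp h c s => uT.
have T0 : 0 < T.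
  by rewrite exprn_gt0// subr_gt0; nra.
have e0 : 0 < c * T / 32 by rewrite divr_gt0// mulr_gt0.
have bu : bm u by exact: bm_damp.
have buh : bm (fun t => u t * h t) by exact: bmM.
have [D1 D1P] := riemann_lebesgue_cos buh e0.
have [D2 D2P] := riemann_lebesgue_cos bu e0.
exists (maxn D1 D2) => v; rewrite gtn_max => /andP[D1v D2v].
have bc n : bm (fun t => u t * cosn n t) by apply: bmM => //; exact: bm_cosn.
have bhc n : bm (fun t => u t * h t * cosn n t) by apply: bmM => //; exact: bm_cosn.
have -> : mean (damp h c (v :: s)) = mean (fun t => (1 - c ^+ 2 / 8) * u t +
    (c * (u t * h t * cosn v t) - c ^+ 2 / 8 * (u t * cosn (2 * v) t))).
  congr mean; apply/funext => t; rewrite /damp big_cons -/(damp h c s t) -/(u t).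
  rewrite !exprMn h1 cosn_sqr; by field.
rewrite meanD; last 2 first.
- exact: bmZ.
- by apply: bmB; exact: bmZ.
rewrite meanB; [|exact: bmZ|exact: bmZ].
rewrite !meanZ//.
have := D1P v D1v; rewrite -/(cosn v) ler_norml => /andP[_ h2].
have := D2P (2 * v)%N; rewrite -/(cosn _) ler_norml => /(_ _)/andP[|h3 _].
  by rewrite (leq_trans D2v)// leq_pmull.
rewrite [X in _ <= X]exprSr -/T.
change (is_true (mean (fun t => u t * h t * cosn v t) <= c * T / 32)) in h2.
change (is_true (- (c * T / 32) <= mean (fun t => u t * cosn (2 * v) t))) in h3.
move: (mean _) h2 => X2 h2; move: (mean _) h3 => X3 h3; move: (mean _) uT => X1 uT.
have c20 : 0 <= c ^+ 2 by exact: sqr_ge0.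
have H1 : (1 - c ^+ 2 / 8) * X1 <= (1 - c ^+ 2 / 8) * T.
  by rewrite ler_wpM2l//; nra.
have H2 : c * X2 <= c ^+ 2 / 32 * T by nra.
have H3 : - (c ^+ 2 / 8 * X3) <= c ^+ 2 / 8 * (c * T / 32) by nra.
have H4 : c ^+ 2 / 8 * (c * T / 32) <= c ^+ 2 / 32 * T.
  have : c * T <= T by nra.
  nra.
lra.
Qed.

Definition fam_bound (F : R -> R) (A : R) : Prop := sb (fun n => pw (hart F n)) A.

(** The recurrence for [esym] multiplies the lower degree by [h], so a bound for [esym] calls for
    one on [h * esym]. Because [h ^+ 2 = 1], multiplying the recurrence by [h] exchanges the roles
    of [A] and [B], and the system closes. *)
Lemma esym_step f h s (A B : nat -> R) (e : R) m : 0 < e -> bm f -> bm h ->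
  (forall t, h t ^+ 2 = 1) ->
  (forall m, fam_bound (esym f h s m) (A m)) ->
  (forall m, fam_bound (fun t => h t * esym f h s m t) (B m)) ->
  exists D : nat, forall v : nat, (D < v)%N ->
    fam_bound (esym f h (v :: s) m.+1) (A m.+1 + pw 2 * 2 * B m + e) /\
    fam_bound (fun t => h t * esym f h (v :: s) m.+1 t) (B m.+1 + pw 2 * 2 * A m + e).
Proof.
move=> e0 bf bh h1 HA HB.
have be k : bm (esym f h s k) by exact: bm_esym.
have bhe k : bm (fun t => h t * esym f h s k t) by exact: bmM.
have [D1 D1P] := sb_shift_perturb q2 e0 (HA m.+1) (HB m).
have [D2 D2P] := sb_shift_perturb q2 e0 (HB m.+1) (HA m).
exists (maxn D1 D2) => v; rewrite gtn_max => /andP[D1v D2v]; split.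
  move: (D1P v D1v); congr sb; apply/funext => n; congr pw.
  rewrite -hart_cos_shift// -hartD//.
  by apply: bmM => //; exact: bm_cos.
move: (D2P v D2v); congr sb; apply/funext => n; congr pw.
rewrite -hart_cos_shift// -hartD//; last by apply: bmM => //; exact: bm_cos.
congr hart; apply/funext => t /=.
by rewrite mulrDr -[h t * _ * cosn v t]mulrA mulrA -expr2 h1 mul1r.
Qed.

End Lacunary.

(** * Choice of the frequencies and the Chernoff bound *)

Section LacunaryFrequencies.
Context {R : realType} (q : R).
Context (q2 : 2 < q).
Implicit Types (f h : R -> R) (s : seq nat).
Local Notation pw := (normpow q).

Lemma fam_bound0 : fam_bound q (fun=> 0) 0.
Proof.
move=> s us; rewrite big1// => n _; rewrite /hart.
under eq_fun do rewrite mul0r.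
by rewrite mean_cst pw0.
Qed.

Lemma fam_bound_ge0 f A : fam_bound q f A -> 0 <= A.
Proof. exact: sb_ge0. Qed.

(** Each frequency is taken beyond thresholds depending on the previous ones. In the generating sum
    with weights [y ^+ m], a new cosine adds at most [pw 2 * 2 * y] times the old value, and one
    further [y] in the growth factor pays for all perturbation errors. *)
Lemma lacunary_frequencies f h (nodes : seq R) (y V1 V2 : R) K :
  bm f -> bm h -> (forall t, h t ^+ 2 = 1) ->
  (forall c, c \in nodes -> 0 < c <= 1) -> 0 < y -> 0 < V1 ->
  fam_bound q f V1 -> fam_bound q (fun t => h t * f t) V2 ->
  forall j, exists s, [/\ size s = j,
    forall c, c \in nodes -> mean (damp h c s) <= (1 - c ^+ 2 / 16) ^+ j &
    exists A : nat -> R, (forall m, (m < K)%N -> fam_bound q (esym f h s m) (A m)) /\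
      \sum_(m < K) y ^+ m * A m <= (1 + (pw 2 * 2 + 1) * y) ^+ j * (V1 + V2)].
Proof.
move=> bf bh h1 nodes1 y0 V10 fV1 fV2 j.
have V20 : 0 <= V2 := fam_bound_ge0 fV2.
(* The induction carries bounds for both families and in every degree, although the weighted sum
   stops at degree [K]. *)
suff [s [sj sd [A [B [HA HB AB]]]]] : exists s, [/\ size s = j,
    forall c, c \in nodes -> mean (damp h c s) <= (1 - c ^+ 2 / 16) ^+ j &
    exists A B : nat -> R, [/\ forall m, fam_bound q (esym f h s m) (A m),
      forall m, fam_bound q (fun t => h t * esym f h s m t) (B m) &
      \sum_(m < K.+1) y ^+ m * (A m + B m) <= (1 + (pw 2 * 2 + 1) * y) ^+ j * (V1 + V2)]].
  exists s; split => //; exists A; split; first by move=> m _; exact: HA.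
  apply: le_trans AB; rewrite [leRHS]big_ord_recr/= -[leLHS]addr0 lerD//.
    apply: ler_sum => m _; rewrite ler_wpM2l ?exprn_ge0 ?(ltW y0)// lerDl.
    exact: fam_bound_ge0 (HB m).
  by rewrite mulr_ge0 ?exprn_ge0 ?(ltW y0)// addr_ge0// ?(fam_bound_ge0 (HA _)) ?(fam_bound_ge0 (HB _)).
elim: j => [|j [s [sj sd [A [B [HA HB AB]]]]]].
  exists [::]; split => // [c cn|].
    by rewrite /damp; under eq_fun do rewrite big_nil; rewrite mean_cst.
  exists (fun m => if m is 0%N then V1 else 0).
  exists (fun m => if m is 0%N then V2 else 0); split.
  - by case=> [//|m]; exact: fam_bound0.
  - by case=> [//|m]; under eq_fun do rewrite mulr0; exact: fam_bound0.
  - rewrite big_ord_recl/= big1 ?addr0 ?expr0 ?mul1r// => i _.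
    by rewrite mulr0.
set T := _ ^+ j * _ in AB.
have T0 : 0 < T.
  rewrite mulr_gt0 ?ltr_pwDl// exprn_gt0// addr_gt0// mulr_gt0//.
  by rewrite ltr_wpDl// mulr_ge0// pw_ge0.
pose Y := \sum_(m < K) y ^+ m.+1.
have Y0 : 0 <= Y by apply: sumr_ge0 => m _; rewrite exprn_ge0 ?(ltW y0).
(* Makes the accumulated error [2 * e * Y] at most [y * T]. *)
pose e := y * T / (2 * (Y + 1)).
have e0 : 0 < e by apply: divr_gt0; apply: mulr_gt0 => //; lra.
have [D1 D1P] := eventually_ltn K (fun m => esym_step q2 m e0 bf bh h1 HA HB).
have [D2 D2P] : exists D : nat, forall v : nat, (D < v)%N -> forall c, c \in nodes ->
    mean (damp h c (v :: s)) <= (1 - c ^+ 2 / 16) ^+ j.+1.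
  apply: eventually_seq => c cn; apply: damp_step => //; first exact: nodes1.
  exact: sd.
pose v := (maxn D1 D2).+1.
have D1v : (D1 < v)%N by rewrite ltnS leq_maxl.
have D2v : (D2 < v)%N by rewrite ltnS leq_maxr.
exists (v :: s); split; [by rewrite /= sj | exact: D2P |].
have big_bound F : bm F -> exists C, fam_bound q F C.
  by move=> bF; have [C _ CP] := sb_pw_sqr_ex q2 (bessel bF); exists C.
have be m : bm (esym f h (v :: s) m) by exact: bm_esym.
have bhe m : bm (fun t => h t * esym f h (v :: s) m t) by exact: bmM.
pose A0 m := projT1 (cid (big_bound _ (be m))).
pose B0 m := projT1 (cid (big_bound _ (bhe m))).
(* One frequency can meet only finitely many thresholds. Degrees above [K] lie outside the weighted
   sum, so any finite bound, here from Bessel's inequality, will do for them. *)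
pose A' m := if m is m'.+1 then (if (m' < K)%N then A m + pw 2 * 2 * B m' + e else A0 m)
             else A 0%N.
pose B' m := if m is m'.+1 then (if (m' < K)%N then B m + pw 2 * 2 * A m' + e else B0 m)
             else B 0%N.
exists A', B'; split.
- case=> [|m]; first by have := HA 0%N; rewrite !esym0.
  rewrite /A'; case: ifPn => mK; first by have [] := D1P v D1v m mK.
  by rewrite /A0; case: cid.
- case=> [|m]; first by have := HB 0%N; rewrite !esym0.
  rewrite /B'; case: ifPn => mK; first by have [] := D1P v D1v m mK.
  by rewrite /B0; case: cid.
- have AB0 m : 0 <= A m + B m.
    by rewrite addr_ge0 ?(fam_bound_ge0 (HA _)) ?(fam_bound_ge0 (HB _)).
  have S : \sum_(m < K.+1) y ^+ m * (A' m + B' m) =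
     \sum_(m < K.+1) y ^+ m * (A m + B m) +
     pw 2 * 2 * y * (\sum_(m < K) y ^+ m * (A m + B m)) + 2 * e * Y.
    rewrite big_ord_recl [in RHS]big_ord_recl/= -!addrA; congr (_ + _).
    rewrite addrA /Y !mulr_sumr -!big_split/=; apply: eq_bigr => m _.
    by rewrite /bump !add1n ltn_ord exprS; ring.
  have S1 : \sum_(m < K) y ^+ m * (A m + B m) <= T.
    apply: le_trans AB; rewrite [leRHS]big_ord_recr/= lerDl.
    by rewrite mulr_ge0// exprn_ge0// ltW.
  have S2 : 2 * e * Y <= y * T.
    have -> : 2 * e * Y = y * T * (Y / (Y + 1)) by rewrite /e; field; lra.
    have hY : Y / (Y + 1) <= 1 by rewrite ler_pdivrMr; lra.
    by rewrite -[leRHS]mulr1 ler_wpM2l// mulr_ge0 ?ltW.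
  have S3 : pw 2 * 2 * y * (\sum_(m < K) y ^+ m * (A m + B m)) <= pw 2 * 2 * y * T.
    by rewrite ler_wpM2l// mulr_ge0 ?(ltW y0)// mulr_ge0// pw_ge0.
  rewrite S exprS -[X in _ <= X]mulrA -/T.
  have -> : (1 + (pw 2 * 2 + 1) * y) * T = T + pw 2 * 2 * y * T + y * T by ring.
  exact: lerD (lerD AB S3) S2.
Qed.

Lemma geq_expR_pow (x : R) n : 0 <= x -> (1 + x) ^+ n <= expR (x * n%:R).
Proof.
move=> x0; rewrite mulrC expRM_natl lerXn2r ?nnegrE ?expR_ge0 ?addr_ge0//.
exact: expR_ge1Dx.
Qed.

(** To second order [(1 + x) ^+ 2 * expR (- x)] is [1 + x - x ^+ 2 / 2], so the coefficient [1 / 4]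
    leaves room. With [expR x] replaced by its lower bound [(1 + x / 4) ^+ 4] the difference is a
    polynomial that starts with [x ^+ 2 / 8]. *)
Lemma sqr_le_damp_expR (x : R) : `|x| <= 1 / 10 ->
  (1 + x) ^+ 2 <= (1 + x - x ^+ 2 / 4) * expR x.
Proof.
rewrite ler_norml => /andP[x1 x2].
have h : (1 + x / 4) ^+ 4 <= expR x.
  have -> : expR x = expR (x / 4) ^+ 4 by rewrite -expRM_natl; congr expR; field.
  rewrite lerXn2r ?nnegrE ?expR_ge0//; [lra | exact: expR_ge1Dx].
apply: (@le_trans _ _ ((1 + x - x ^+ 2 / 4) * (1 + x / 4) ^+ 4)); last first.
  by rewrite ler_wpM2l//; nra.
rewrite -subr_ge0.
have -> : (1 + x - x ^+ 2 / 4) * (1 + x / 4) ^+ 4 - (1 + x) ^+ 2 =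
  x ^+ 2 * (1 / 8 + x * (3 / 16 - 7 / 256 * x - 3 / 256 * x ^+ 2 - x ^+ 3 / 1024)).
  by field.
apply: mulr_ge0; first exact: sqr_ge0.
have a1 : x ^+ 2 <= 1 / 100 by nra.
have a2 : 0 <= x ^+ 2 by exact: sqr_ge0.
have a3 : `|x ^+ 3| <= 1 / 100.
  rewrite exprS normrM normrX real_normK ?num_real// (le_trans (ler_wpM2l _ a1))//.
  have : `|x| <= 1 / 10 by rewrite ler_norml x1 x2.
  by move: `|x| => a; lra.
move: a3; rewrite ler_norml => /andP[a3 a4].
move: (x ^+ 2) (x ^+ 3) a1 a2 a3 a4 => X2 X3 a1 a2 a3 a4; nra.
Qed.

Lemma scaled_cosn_le h (c t : R) n : h t ^+ 2 = 1 -> 0 < c <= 1 / 10 ->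
  `|c * (h t * cosn n t)| <= 1 / 10.
Proof.
rewrite -[h t ^+ 2]real_normK ?num_real// => /eqP.
rewrite sqrp_eq1 ?normr_ge0// => /eqP habs /andP[c0 c1].
rewrite normrM normrM habs (mul1r `|cosn n t|) (gtr0_norm c0); apply: le_trans c1.
by rewrite ger_pMr// cosn_le1.
Qed.

(** The Chernoff step: [sqr_le_damp_expR] is multiplied over the frequencies, and at a bad point the
    exponents add up to at most [c * th * size s]. *)
Lemma riesz_sqr_bad h (c th : R) s t : (forall t, h t ^+ 2 = 1) -> 0 < c <= 1 / 10 ->
  h t * (\sum_(n <- s) cosn n t) <= th * (size s)%:R ->
  riesz h c s t ^+ 2 <= expR (c * th * (size s)%:R) * damp h c s t.
Proof.
move=> h1 c01 bad; have /andP[c0 _] := c01.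
have xle n := scaled_cosn_le n (h1 t) c01.
have dpos n : 0 <= 1 + c * (h t * cosn n t) - (c * (h t * cosn n t)) ^+ 2 / 4.
  by have := xle n; rewrite ler_norml => /andP[]; move: (c * _) => x; nra.
rewrite /riesz -prodrXl.
apply: (@le_trans _ _ (\prod_(n <- s) ((1 + c * (h t * cosn n t) -
    (c * (h t * cosn n t)) ^+ 2 / 4) * expR (c * (h t * cosn n t))))).
  by apply: ler_prod => n _; rewrite sqr_ge0 sqr_le_damp_expR.
rewrite big_split/= mulrC ler_wpM2r ?prodr_ge0//.
rewrite -expR_sum ler_expR -mulr_sumr -mulrA ler_pM2l// -mulr_sumr.
exact: bad.
Qed.

End LacunaryFrequencies.

(** * Signed weights with vanishing moments *)

Section MomentWeights.
Context {R : realType}.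
Local Notation e1 := (expR 1 : R).

Lemma e1_ge2 : 2 <= e1.
Proof. by rewrite (le_trans _ (expR_ge1Dx 1)). Qed.

(** A crude Stirling bound, by induction from [(1 + 1 / n) ^ n <= e]; it makes the total weight
    [(3 M) ^ M / M!] exponential in [M]. *)
Lemma expn_le_fact n : n%:R ^+ n <= e1 ^+ n * (n`!)%:R.
Proof.
have e2 := e1_ge2.
elim: n => [|n IH]; first by rewrite !expr0 mul1r.
have [->|n0] := posnP n; first by rewrite factS fact0 muln1 mulr1 !expr1; lra.
have n0' : 0 < n%:R :> R by rewrite ltr0n.
rewrite !exprS factS natrM.
have h : n.+1%:R ^+ n <= e1 * n%:R ^+ n.
  have -> : n.+1%:R = (1 + n%:R^-1) * n%:R :> R.
    by rewrite mulrDl mul1r mulVf ?gt_eqF// -natr1 addrC.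
  rewrite exprMn ler_wpM2r ?exprn_ge0 ?ler0n//.
  rewrite (le_trans (geq_expR_pow n _)) ?invr_ge0 ?ler0n//.
  by rewrite mulVf ?gt_eqF.
have -> : e1 * e1 ^+ n * (n.+1%:R * (n`!)%:R) = n.+1%:R * (e1 * (e1 ^+ n * (n`!)%:R)) by ring.
rewrite ler_wpM2l ?ler0n// (le_trans h)// ler_wpM2l//; lra.
Qed.

(* One more moment is killed at each step by a multiplicative convolution with
   a combination of the point masses at 1 and [1 + 1/M], so the nodes stay in
   [s0, e s0]. *)
Lemma moment_weights_step M k (s0 : R) : (0 < M)%N -> 0 < s0 -> (k <= M)%N ->
  exists w : seq (R * R), [/\ forall p, p \in w -> s0 <= p.2 <= (1 + M%:R^-1) ^+ k * s0,
    \sum_(p <- w) p.1 = 1,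
    forall m, (0 < m <= k)%N -> \sum_(p <- w) p.1 * p.2 ^+ m = 0 &
    \sum_(p <- w) `|p.1| <= (3 * M%:R) ^+ k / (k`!)%:R].
Proof.
move=> M0 s00; have M0' : 0 < M%:R :> R by rewrite ltr0n.
elim: k => [_|k IH kM].
  exists [:: (1, s0)]; split.
  - by move=> p; rewrite inE => /eqP ->/=; rewrite expr0 mul1r lexx.
  - by rewrite big_seq1.
  - by move=> m; lia.
  - by rewrite big_seq1 normr1 expr0 divr1.
have [w [wn w1 wm wt]] := IH (ltnW kM).
set b := 1 + M%:R^-1; pose B := b ^+ k.+1.
have b1 : 1 < b by rewrite ltrDl invr_gt0.
have BM : 1 + k.+1%:R / M%:R <= B.
  rewrite /B; elim: (k.+1) => [|n IHn]; first by rewrite mul0r addr0 expr0.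
  rewrite exprS (le_trans _ (ler_wpM2l _ IHn)) ?(ltW (lt_trans ltr01 b1))//.
  rewrite /b -natr1; have : 0 <= n%:R / M%:R :> R by rewrite divr_ge0.
  have : 0 < M%:R^-1 :> R by rewrite invr_gt0.
  by move: (M%:R^-1) => y; nra.
have kM0 : 0 < k.+1%:R / M%:R :> R by rewrite divr_gt0.
have B1 : 0 < B - 1 by lra.
(* [a1 + a2 = 1] preserves the total weight and [a1 + a2 * B = 0] kills the moment of order [k.+1].
   Moments that vanish already stay zero, since the one of order [m] is merely multiplied by
   [a1 + a2 * b ^+ m]. *)
pose a1 := B / (B - 1); pose a2 := - (B - 1)^-1.
pose w' := [seq (a1 * p.1, p.2) | p <- w] ++ [seq (a2 * p.1, b * p.2) | p <- w].
have momE m : \sum_(p <- w') p.1 * p.2 ^+ m =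
    (a1 + a2 * b ^+ m) * \sum_(p <- w) p.1 * p.2 ^+ m.
  rewrite big_cat !big_map/= mulrDl !mulr_sumr; congr (_ + _); apply: eq_bigr => p _.
    by rewrite mulrA.
  by rewrite exprMn; ring.
exists w'; split.
- move=> p; rewrite mem_cat => /orP[] /mapP[p' /wn/andP[p1 p2] ->]/=.
    rewrite p1 (le_trans p2)// ler_wpM2r ?(ltW s00)// exprS.
    by rewrite ler_peMl ?(ltW b1)// exprn_ge0// (le_trans ler01 (ltW b1)).
  rewrite exprS -mulrA ler_wpM2l ?(le_trans ler01 (ltW b1))// andbT.
  by rewrite (le_trans p1)// ler_peMl ?(ltW b1)// (le_trans (ltW s00)).
- have := momE 0%N; rewrite expr0 mulr1.
  under eq_bigr do rewrite expr0 mulr1; move=> ->.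
  under eq_bigr do rewrite expr0 mulr1; rewrite w1 mulr1 /a1 /a2.
  by field; rewrite gt_eqF.
- move=> m /andP[m0]; rewrite leq_eqVlt => /predU1P[->|mk].
    by rewrite momE -/B /a1 /a2 mulNr [_^-1 * B]mulrC subrr mul0r.
  by rewrite momE wm ?mulr0// m0 -ltnS.
- rewrite big_cat !big_map/=.
  under eq_bigr do rewrite normrM; under [X in _ + X]eq_bigr do rewrite normrM.
  rewrite -!mulr_sumr -mulrDl exprSr factS natrM invfM mulrACA mulrC.
  rewrite mulrC -[leRHS]mulrC [leRHS](_ : _ = 3 * M%:R / k.+1%:R * ((3 * M%:R) ^+ k / (k`!)%:R)); last by ring.
  apply: ler_pM; [by rewrite addr_ge0|by apply: sumr_ge0| |exact: wt].
  have a10 : 0 <= a1 by rewrite divr_ge0 ?(ltW B1)//; lra.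
  have a20 : a2 <= 0 by rewrite oppr_le0 invr_ge0 ltW.
  rewrite (ger0_norm a10) (ler0_norm a20) /a1 /a2 opprK.
  have -> : B / (B - 1) + (B - 1)^-1 = (B + 1) / (B - 1) by rewrite mulrDl mul1r.
  rewrite ler_pdivrMr// mulrAC ler_pdivlMr ?ltr0n//.
  (* By Bernoulli's inequality [BM], the factor [(B + 1) / (B - 1) = 1 + 2 / (B - 1)] is at most
     [1 + 2 M / k.+1], and this is at most [3 M / k.+1] as [k < M]. *)
  have : k.+1%:R <= M%:R * (B - 1).
    by rewrite mulrC -ler_pdivrMr//; lra.
  have : k.+1%:R <= M%:R :> R by rewrite ler_nat.
  by move: (k.+1%:R) (M%:R) M0' => x y y0 h1 h2; nra.
Qed.

Lemma moment_weights M (s0 : R) : (0 < M)%N -> 0 < s0 ->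
  exists w : seq (R * R), [/\ forall p, p \in w -> s0 <= p.2 <= e1 * s0,
    \sum_(p <- w) p.1 = 1,
    forall m, (0 < m <= M)%N -> \sum_(p <- w) p.1 * p.2 ^+ m = 0 &
    \sum_(p <- w) `|p.1| <= (3 * e1) ^+ M].
Proof.
move=> M0 s00; have [w [wn w1 wm wt]] := moment_weights_step M0 s00 (leqnn M).
exists w; split => //.
- move=> p /wn/andP[-> h]/=; rewrite (le_trans h)// ler_wpM2r ?(ltW s00)//.
  rewrite (le_trans (geq_expR_pow M _)) ?invr_ge0 ?ler0n//.
  by rewrite mulVf ?pnatr_eq0 -?lt0n.
- rewrite (le_trans wt)// ler_pdivrMr ?ltr0n ?fact_gt0// !exprMn -mulrA.
  by rewrite ler_wpM2l ?exprn_ge0// expn_le_fact.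
Qed.

(** Cauchy-Schwarz with the absolute weights, through Lagrange's identity: the double sum of squares
    in the proof equals [2 * (S * Q - A ^+ 2)]. *)
Lemma sqr_weighted_sum (w : seq (R * R)) (x : R * R -> R) :
  (\sum_(p <- w) p.1 * x p) ^+ 2 <=
  (\sum_(p <- w) `|p.1|) * \sum_(p <- w) `|p.1| * x p ^+ 2.
Proof.
apply: (@le_trans _ _ ((\sum_(p <- w) `|p.1| * `|x p|) ^+ 2)).
  rewrite -[leLHS]real_normK ?num_real// lerXn2r ?nnegrE ?normr_ge0//.
    by apply: sumr_ge0 => p _; rewrite mulr_ge0.
  rewrite (le_trans (ler_norm_sum _ _ _))//; apply: ler_sum => p _.
  by rewrite normrM.
set A := \sum_(p <- w) _ * `|_|; set S := \sum_(p <- w) `|_|.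
set Q := \sum_(p <- w) _ * _ ^+ 2.
have : 0 <= \sum_(p <- w) \sum_(r <- w) `|p.1| * `|r.1| * (`|x p| - `|x r|) ^+ 2.
  by apply: sumr_ge0 => p _; apply: sumr_ge0 => r _;
  apply: mulr_ge0; [exact: mulr_ge0 | exact: sqr_ge0].
have -> : \sum_(p <- w) \sum_(r <- w) `|p.1| * `|r.1| * (`|x p| - `|x r|) ^+ 2 =
   2 * (S * Q - A ^+ 2).
  transitivity (\sum_(p <- w) (`|p.1| * x p ^+ 2 * S + `|p.1| * Q - 2 * (`|p.1| * `|x p|) * A)).
    apply: eq_bigr => p _; rewrite /S /Q /A !mulr_sumr -big_split -sumrB/=.
    apply: eq_bigr => r _; rewrite sqrrB !real_normK ?num_real//; ring.
  rewrite sumrB big_split/= -!mulr_suml -!mulr_sumr -/Q -/S.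
  rewrite -/A; ring.
by rewrite pmulr_rge0// subr_ge0.
Qed.

End MomentWeights.

(** * One step of the construction *)

Section Stage.
Context {R : realType} (q : R).
Context (q2 : 2 < q).
Implicit Types (f h : R -> R) (s : seq nat).
Local Notation pw := (normpow q).
Local Notation e1 := (expR 1 : R).

(** [L0 ^+ M] bounds the total weight of [moment_weights]. [kappa] will be [r * s0 ^+ 2]; its size
    makes the Chernoff gain per unit of [M] equal to [expR (- (2 * L0 ^+ 2))], which beats the
    squared weight [L0 ^+ 2] with a factor 2 to spare. [B] is the growth constant of
    [lacunary_frequencies], and [Y] is the gain per order that covers [pw L0], the growth [e1] and
    again a factor 2. *)
Let L0 : R := 3 * e1.
Let kappa : R := 64 * L0 ^+ 2.
Let B : R := pw 2 * 2 + 1.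
Let Y : R := 2 * e1 * pw L0.

Let L0_ge6 : 6 <= L0. Proof. by rewrite /L0; have := @e1_ge2 R; lra. Qed.

Lemma one_le_pw (x : R) : 1 <= x -> 1 <= pw x.
Proof.
move=> x1; have -> : 1 = pw 1 by rewrite /normpow normr1 powR1.
by apply: le_pw => //; rewrite normr1 ger0_norm// (le_trans ler01).
Qed.

(** Here [2 < q] decides: [r] is of order [s0 ^ (-2)], so [r * pw (2 * e1 * s0)] is of order
    [s0 ^ (q - 2)] and becomes as small as desired once [s0] is small. *)
Lemma stage_parameters : exists (r : nat) (s0 : R),
  [/\ (0 < r)%N, 0 < s0, r%:R * s0 ^+ 2 = kappa, e1 * s0 <= 1 / 10 &
      B * (pw (2 * e1 * s0) * Y) * r%:R <= 1].
Proof.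
have e2 := @e1_ge2 R; have e0 : 0 < e1 by exact: expR_gt0.
have L6 := L0_ge6.
have k0 : 0 < kappa by rewrite mulr_gt0// exprn_gt0//; lra.
have B1 : 1 <= B by rewrite lerDr mulr_ge0// pw_ge0.
have Y1 : 1 <= Y.
  by rewrite /Y; have : 1 <= pw L0 by [apply: one_le_pw; lra]; nra.
pose eta := (B * Y * (4 * e1 ^+ 2 * kappa))^-1.
have eta0 : 0 < eta.
  rewrite invr_gt0; apply: mulr_gt0; first by apply: mulr_gt0; lra.
  by apply: mulr_gt0 => //; apply: mulr_gt0 => //; rewrite exprn_gt0.
have q20 : 0 < q - 2 by rewrite subr_gt0.
pose eta' := eta `^ (q - 2)^-1.
have eta'0 : 0 < eta' by exact: powR_gt0.
pose d := Num.min (eta' / (2 * e1)) (1 / 10 / e1).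
have d0 : 0 < d.
  rewrite lt_min; apply/andP; split; apply: divr_gt0 => //; lra.
pose r := (Num.truncn (kappa / d ^+ 2)).+1.
have r0 : 0 < r%:R :> R by rewrite ltr0n.
pose s0 := Num.sqrt (kappa / r%:R).
have s00 : 0 < s0 by rewrite sqrtr_gt0 divr_gt0.
have s0E : s0 ^+ 2 = kappa / r%:R by rewrite sqr_sqrtr// ltW// divr_gt0.
have s0d : s0 <= d.
  rewrite -(@ler_pXn2r _ 2) ?nnegrE ?(ltW s00) ?(ltW d0)// s0E.
  rewrite ler_pdivrMr// mulrC -ler_pdivrMr ?exprn_gt0//.
  by rewrite ltW// truncnS_gt.
exists r, s0; split => //.
- by rewrite s0E mulrC divfK// gt_eqF.
- have : s0 <= 1 / 10 / e1 by rewrite (le_trans s0d)// ge_min lexx orbT.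
  by rewrite ler_pdivlMr// mulrC.
- set x := 2 * e1 * s0.
  have x0 : 0 < x by rewrite mulr_gt0// mulr_gt0.
  have xe : x <= eta'.
    have : s0 <= eta' / (2 * e1) by rewrite (le_trans s0d)// ge_min lexx.
    by rewrite ler_pdivlMr ?mulr_gt0// mulrC.
  have xq : pw x = x `^ (q - 2) * x ^+ 2.
    rewrite /normpow gtr0_norm// -powR_mulrn ?(ltW x0)// -powRD ?subrK//.
    by rewrite (gt_eqF x0) implybT.
  have xq2 : x `^ (q - 2) <= eta.
    rewrite (le_trans (ge0_ler_powR (ltW q20) _ _ xe)) ?nnegrE ?(ltW x0) ?(ltW eta'0)//.
    by rewrite /eta' -powRrM mulVf ?gt_eqF// powRr1// ltW.
  have x2 : x ^+ 2 * r%:R = 4 * e1 ^+ 2 * kappa.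
    by rewrite /x !exprMn s0E; field; rewrite gt_eqF.
  have -> : B * (pw x * Y) * r%:R = x `^ (q - 2) * (B * Y * (4 * e1 ^+ 2 * kappa)).
    by rewrite -x2 xq; ring.
  by rewrite -ler_pdivlMr ?mul1r// -invr_gt0.
Qed.

Lemma le_exp2 (C e : R) : 0 < e -> exists2 M : nat, (0 < M)%N & C <= e * 2 ^+ M.
Proof.
move=> e0; exists (Num.truncn (C / e)).+1 => //.
rewrite -ler_pdivrMl// mulrC (le_trans (ltW (truncnS_gt _)))//.
have -> : 2 ^+ (Num.truncn (C / e)).+1 = (2 ^ (Num.truncn (C / e)).+1)%N%:R :> R.
  by rewrite natrX.
by rewrite ler_nat ltnW// ltn_expl.
Qed.

Lemma bm_if (b : R -> bool) f g : measurable_fun setT b -> bm f -> bm g ->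
  bm (fun t => if b t then f t else g t).
Proof.
move=> mb [mf [A fA]] [mg [A' gA]]; split; first exact: measurable_fun_ifT.
exists (Num.max A A') => t; case: ifP => _; first by rewrite le_max fA.
by rewrite le_max gA orbT.
Qed.

Lemma damp_ge0 h (c : R) s t : (forall t, h t ^+ 2 = 1) -> 0 < c <= 1 / 10 ->
  0 <= damp h c s t.
Proof.
move=> h1 c01; apply: prodr_ge0 => n _.
have := scaled_cosn_le n (h1 t) c01.
by rewrite ler_norml => /andP[]; move: (c * _) => x; nra.
Qed.

(* The contribution of the low-order terms cancels by the moment conditions;
   the weight [pw (2 ^+ m.+1)] comes from [pw_sum]. *)
Lemma riesz_combination f h (s0 : R) s (w : seq (R * R)) (M : nat) (A : nat -> R) (V Ybig : R) :
  bm f -> bm h -> 0 < s0 -> 1 <= Ybig ->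
  (forall p, p \in w -> s0 <= p.2 <= e1 * s0) ->
  \sum_(p <- w) p.1 = 1 ->
  (forall m, (0 < m <= M)%N -> \sum_(p <- w) p.1 * p.2 ^+ m = 0) ->
  (forall m, (m < (size s).+1)%N -> fam_bound q (esym f h s m) (A m)) ->
  \sum_(m < (size s).+1) (pw (2 * e1 * s0) * Ybig) ^+ m * A m <= V ->
  fam_bound q (fun t => f t * (\sum_(p <- w) p.1 * riesz h p.2 s t) - f t)
    (pw 2 * pw (\sum_(p <- w) `|p.1|) / Ybig ^+ M * V).
Proof.
move=> bf bh s00 Y1 wn w1 wm HA AV.
have Y0 : 0 < Ybig by rewrite (lt_le_trans ltr01).
have be m : bm (esym f h s m) by exact: bm_esym.
(* The weights have sum 1, so the term of order 0 is exactly [f], which is subtracted; hence the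
   value 0. *)
pose mo m := if m is 0%N then 0 else \sum_(p <- w) p.1 * p.2 ^+ m.
set L := \sum_(p <- w) `|p.1|.
have L0' : 0 <= L by exact: sumr_ge0.
have E : (fun t => f t * (\sum_(p <- w) p.1 * riesz h p.2 s t) - f t) =
    (fun t => \sum_(m < (size s).+1) mo m * esym f h s m t).
  apply/funext => t; rewrite mulr_sumr.
  have -> : \sum_(p <- w) f t * (p.1 * riesz h p.2 s t) =
      \sum_(m < (size s).+1) (\sum_(p <- w) p.1 * p.2 ^+ m) * esym f h s m t.
    transitivity (\sum_(p <- w) \sum_(m < (size s).+1) p.1 * p.2 ^+ m * esym f h s m t).
      apply: eq_bigr => p _; rewrite mulrCA riesz_esym mulr_sumr.
      by apply: eq_bigr => m _; rewrite mulrA.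
    by rewrite exchange_big; apply: eq_bigr => m _; rewrite mulr_suml.
  rewrite big_ord_recl [RHS]big_ord_recl/= mul0r add0r esym0.
  under eq_bigr do rewrite expr0 mulr1.
  by rewrite w1 mul1r addrAC subrr add0r.
have mo_le m : `|mo m| <= L * (e1 * s0) ^+ m.
  case: m => [|m]; first by rewrite normr0 expr0 mulr1.
  rewrite (le_trans (ler_norm_sum _ _ _))// mulr_suml big_seq [leRHS]big_seq.
  apply: ler_sum => p /wn/andP[p1 p2]; rewrite normrM ler_wpM2l//.
  have p0 : 0 <= p.2 by rewrite (le_trans (ltW s00)).
  rewrite normrX ger0_norm// lerXn2r ?nnegrE//.
  by rewrite mulr_ge0 ?expR_ge0// ltW.
pose C := pw 2 * pw L / Ybig ^+ M.
have C0 : 0 <= C by rewrite divr_ge0 ?exprn_ge0 ?(ltW Y0)// mulr_ge0 ?pw_ge0.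
have coef m : pw (2 ^+ m.+1) * pw (mo m) <= C * (pw (2 * e1 * s0) * Ybig) ^+ m.
  have [mM|mM] := leqP m M.
    have -> : mo m = 0.
      by case: m mM => [//|m] mM; rewrite /mo wm// mM.
    rewrite pw0// mulr0 mulr_ge0// exprn_ge0// mulr_ge0 ?pw_ge0//; exact: ltW.
  have h1 : pw (mo m) <= pw (L * (e1 * s0) ^+ m).
    apply: le_pw => //; apply: le_trans (mo_le m) _.
    by rewrite ger0_norm// mulr_ge0// exprn_ge0// mulr_ge0 ?expR_ge0// ltW.
  apply: (@le_trans _ _ (pw (2 ^+ m.+1) * pw (L * (e1 * s0) ^+ m))).
    by rewrite ler_wpM2l// pw_ge0.
  have -> : pw (2 ^+ m.+1) * pw (L * (e1 * s0) ^+ m) =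
      pw 2 * pw L * pw (2 * e1 * s0) ^+ m.
    rewrite -pwX// -!pwM//; congr pw; rewrite !exprMn exprS; ring.
  (* Only [m > M] is left, where [Ybig ^+ m / Ybig ^+ M] is at least 1: this is where the
     cancellation becomes the gain [Ybig ^+ M]. *)
  have -> : C * (pw (2 * e1 * s0) * Ybig) ^+ m =
      pw 2 * pw L * pw (2 * e1 * s0) ^+ m * (Ybig ^+ m / Ybig ^+ M).
    by rewrite /C exprMn; ring.
  rewrite -[leLHS]mulr1 ler_wpM2l//.
    by rewrite mulr_ge0 ?exprn_ge0 ?pw_ge0// mulr_ge0 ?pw_ge0.
  rewrite ler_pdivlMr ?exprn_gt0// mul1r.
  by rewrite ler_weXn2l// ltnW.
rewrite /fam_bound E.
apply: (@sb_mono _ _ (fun n => \sum_(m < (size s).+1)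
   C * ((pw (2 * e1 * s0) * Ybig) ^+ m * pw (hart (esym f h s m) n)))
   (\sum_(m < (size s).+1) C * ((pw (2 * e1 * s0) * Ybig) ^+ m * A m))).
- move=> n; rewrite hart_sum; last by move=> m; apply: bmZ.
  under eq_bigr do rewrite hartZ//.
  rewrite (le_trans (@pw_sum _ _ q2 _ (fun m => mo m * hart (esym f h s m) n)))//.
  apply: ler_sum => m _; rewrite pwM// mulrA [leRHS]mulrA ler_wpM2r ?pw_ge0//.
- by rewrite -mulr_sumr ler_wpM2l.
- move=> l ul; rewrite exchange_big; apply: ler_sum => m _ /=.
  rewrite -mulr_sumr -mulr_sumr ler_wpM2l// ler_wpM2l ?HA//.
  by rewrite exprn_ge0// mulr_ge0 ?pw_ge0// ltW.
Qed.

(** The mean square of what the cut-off removes. [sqr_weighted_sum] reduces the combination to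
    single nodes, [riesz_sqr_bad] replaces each squared Riesz product by a multiple of [damp], and
    the mean of [damp] is known. *)
Lemma riesz_bad_mean f h (s0 th Af : R) s (w : seq (R * R)) :
  bm f -> bm h -> (forall t, h t ^+ 2 = 1) -> 0 < s0 -> e1 * s0 <= 1 / 10 ->
  th = s0 / 32 -> (forall t, `|f t| <= Af) ->
  (forall p, p \in w -> s0 <= p.2 <= e1 * s0) ->
  (forall p, p \in w -> mean (damp h p.2 s) <= (1 - p.2 ^+ 2 / 16) ^+ size s) ->
  mean (fun t => (if th * (size s)%:R <= h t * (\sum_(n <- s) cosn n t) then 0
                  else f t * (\sum_(p <- w) p.1 * riesz h p.2 s t)) ^+ 2) <=
  Af ^+ 2 * (\sum_(p <- w) `|p.1|) ^+ 2 * expR (- (s0 ^+ 2 / 32)) ^+ size s.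
Proof.
move=> bf bh h1 s00 s01 thE fA wn wd; set N := size s.
have wc p : p \in w -> 0 < p.2 <= 1 / 10.
  by move=> /wn/andP[p1 p2]; rewrite (lt_le_trans s00)//= (le_trans p2).
set L := \sum_(p <- w) `|p.1|.
have L0' : 0 <= L by exact: sumr_ge0.
have bX : bm (fun t => f t * (\sum_(p <- w) p.1 * riesz h p.2 s t)).
  by apply: bmM => //; apply: bm_sum => p; apply: bmZ; exact: bm_riesz.
have bg : bm (fun t => h t * (\sum_(n <- s) cosn n t)).
  by apply: bmM => //; apply: bm_sum => n; exact: bm_cosn.
have mgood : measurable_fun setT
    (fun t => th * N%:R <= h t * (\sum_(n <- s) cosn n t)).
  by apply: measurable_fun_ler; [exact: measurable_cst | case: bg].
have bD : bm (fun t => Af ^+ 2 * L * \sum_(p <- w)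
    (`|p.1| * expR (p.2 * th * N%:R)) * damp h p.2 s t).
  by apply: bmZ; apply: bm_sum => p; apply: bmZ; exact: bm_damp.
apply: (@le_trans _ _ (mean (fun t => Af ^+ 2 * L * \sum_(p <- w)
    (`|p.1| * expR (p.2 * th * N%:R)) * damp h p.2 s t))).
  apply: le_mean => //; first by apply: bmX; apply: bm_if => //; exact: bm_cst.
  move=> t; case: ifPn => [_|].
    rewrite expr0n/=; apply: mulr_ge0; first by rewrite mulr_ge0// sqr_ge0.
    rewrite big_seq; apply: sumr_ge0 => p hp.
    by rewrite mulr_ge0 ?damp_ge0 ?wc// mulr_ge0// expR_ge0.
  rewrite -ltNge => /ltW bad; rewrite exprMn -mulrA; apply: ler_pM.
  - exact: sqr_ge0.
  - exact: sqr_ge0.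
  - rewrite -[leLHS]real_normK ?num_real// lerXn2r ?nnegrE//.
    exact: le_trans (fA t).
  - rewrite (le_trans (sqr_weighted_sum w (fun p => riesz h p.2 s t)))//.
    rewrite ler_wpM2l// big_seq [leRHS]big_seq; apply: ler_sum => p hp.
    rewrite -mulrA ler_wpM2l//; apply: riesz_sqr_bad => //; exact: wc.
rewrite meanZ; last by apply: bm_sum => p; apply: bmZ; exact: bm_damp.
rewrite mean_sum; last by move=> p; apply: bmZ; exact: bm_damp.
rewrite -[leLHS]mulrA -[leRHS]mulrA; apply: ler_wpM2l; first exact: sqr_ge0.
rewrite (expr2 L) -[leRHS]mulrA; apply: ler_wpM2l => //; rewrite mulr_suml big_seq [leRHS]big_seq.
apply: ler_sum => p hp; rewrite meanZ; last exact: bm_damp.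
rewrite -[leLHS]mulrA ler_wpM2l//.
have /andP[p0 p1] := wc _ hp.
have /andP[p2 p3] := wn _ hp.
have p21 : p.2 ^+ 2 <= 1 by rewrite expr2; nra.
rewrite (le_trans (ler_wpM2l (expR_ge0 _) (wd p hp)))// -/N.
rewrite mulrC (mulrC _ N%:R) expRM_natl -exprMn lerXn2r ?nnegrE ?expR_ge0//.
  by rewrite mulr_ge0 ?expR_ge0// subr_ge0; lra.
(* With [th = s0 / 32] and [s0 <= p.2], the loss [p.2 * th] is at most half of the gain
   [p.2 ^+ 2 / 16]. *)
apply: (@le_trans _ _ (expR (- (p.2 ^+ 2 / 16)) * expR (p.2 * th))).
  by rewrite ler_wpM2r ?expR_ge0// expR_ge1Dx.
rewrite -expRD ler_expR thE; nra.
Qed.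

Lemma stage : exists2 th : R, 0 < th <= 1 &
  forall f (P : R -> R) (e : R), bm f -> measurable_fun setT P -> 0 < e ->
  exists s f', [/\ (0 < size s)%N, bm f',
    fam_bound q (fun t => f' t - f t) e &
    forall t, f' t != 0 -> f t != 0 /\
      th * `|P t| <= P t * ((\sum_(n <- s) cosn n t) / (size s)%:R)].
Proof.
have [r [s0 [r0 s00 rs0 es0 BY]]] := stage_parameters.
have e2 := @e1_ge2 R; have L6 := L0_ge6.
pose th := s0 / 32.
have th0 : 0 < th by rewrite divr_gt0.
exists th; first by rewrite th0 /th; nra.
move=> f P e bf mP e0.
have [Af Af0 fA] := bm_ge0 bf.
(* At a zero of [P] the required inequality reads [0 <= 0], so either sign would serve; what counts
   is [h ^+ 2 = 1] everywhere. *)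
pose h t : R := if 0 <= P t then 1 else -1.
have h1 t : h t ^+ 2 = 1 by rewrite /h; case: ifP => _; rewrite ?sqrrN expr1n.
have bh : bm h.
  apply: bm_if; [|exact: bm_cst|exact: bm_cst].
  by apply: measurable_fun_ler => //; exact: measurable_cst.
have bhf : bm (fun t => h t * f t) by exact: bmM.
have [V1 V10 fV1] := sb_pw_sqr_ex q2 (bessel bf).
have [V2 V20 fV2] := sb_pw_sqr_ex q2 (bessel bhf).
have p20 : 0 <= pw 2 by exact: pw_ge0.
have L0p : 1 <= pw L0 by apply: one_le_pw; lra.
have Y1 : 1 <= Y by rewrite /Y; nra.
pose e' := Num.min 1 e.
have e'0 : 0 < e' by rewrite lt_min ltr01.
(* The first summand controls the two errors, each a constant over [2 ^+ M]. The last [Af ^+ 2],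
   together with [e' <= 1], keeps the mean square of the removed part below 1, as [sb_pw_sqr]
   demands. *)
have [M M0 MP] := le_exp2 (pw 2 * (pw 2 * (V1 + V2) + Af ^+ 2) + Af ^+ 2) e'0.
have M2 : 0 < 2 ^+ M :> R by rewrite exprn_gt0.
have [w [wn w1 wm wt]] := moment_weights M0 s00.
rewrite -/L0 in wt.
set y := pw (2 * e1 * s0) * Y in BY.
have y0 : 0 < y.
  rewrite mulr_gt0//; last by rewrite (lt_le_trans ltr01).
  by rewrite powR_gt0// normr_gt0 gt_eqF// !mulr_gt0// expR_gt0.
(* With [r] and [s0] fixed, both exponents [N s0^2] and [N s0^q] are proportional to [M]. *)
pose N := (r * M)%N.
have nodes1 : forall c, c \in [seq p.2 | p <- w] -> 0 < c <= 1.
  move=> c /mapP[p /wn/andP[p1 p2] ->]; rewrite (lt_le_trans s00)//=.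
  by rewrite (le_trans p2)// (le_trans es0)//; lra.
have [s [sN sd [A [HA AV]]]] := lacunary_frequencies q2 N.+1 bf bh h1 nodes1 y0 V10 fV1 fV2 N.
pose X t := \sum_(p <- w) p.1 * riesz h p.2 s t.
have bX : bm (fun t => f t * X t).
  by apply: bmM => //; apply: bm_sum => p; apply: bmZ; exact: bm_riesz.
pose good t := th * (size s)%:R <= h t * (\sum_(n <- s) cosn n t).
have mgood : measurable_fun setT good.
  apply: measurable_fun_ler; first exact: measurable_cst.
  by have [] : bm (fun t => h t * (\sum_(n <- s) cosn n t));
    [apply: bmM => //; apply: bm_sum => n; exact: bm_cosn|].
pose W t := if good t then 0 else f t * X t.
have bW : bm W by apply: bm_if => //; exact: bm_cst.
exists s, (fun t => if good t then f t * X t else 0).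
have sN0 : (0 < size s)%N by rewrite sN muln_gt0 r0.
split => //.
- by apply: bm_if => //; exact: bm_cst.
- pose L := \sum_(p <- w) `|p.1|.
  have L0' : 0 <= L by exact: sumr_ge0.
  have LM : L <= L0 ^+ M := wt.
  have HF : fam_bound q (fun t => f t * X t - f t) (pw 2 * (V1 + V2) / 2 ^+ M).
    have G : pw L * (1 + B * y) ^+ N <= Y ^+ M / 2 ^+ M.
      have -> : Y ^+ M / 2 ^+ M = pw L0 ^+ M * e1 ^+ M.
        by rewrite /Y !exprMn; field; rewrite gt_eqF.
      have B0 : 0 <= B by rewrite /B addr_ge0// mulr_ge0.
      apply: ler_pM.
      - exact: pw_ge0.
      - by rewrite exprn_ge0// addr_ge0// mulr_ge0// ltW.
      - rewrite -pwX//; apply: le_pw => //.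
        by rewrite ger0_norm// (le_trans LM)// ler_norm.
      rewrite /N exprM lerXn2r ?nnegrE ?exprn_ge0 ?expR_ge0//.
        by rewrite addr_ge0// mulr_ge0 ?(ltW y0)// addr_ge0// mulr_ge0.
      rewrite (le_trans (geq_expR_pow r _))//; last by rewrite ler_expR.
      by rewrite mulr_ge0 ?(ltW y0)// addr_ge0// mulr_ge0.
    rewrite -sN in HA AV; have := riesz_combination bf bh s00 Y1 wn w1 wm HA AV.
    apply: sb_mono => //; rewrite -/L sN.
    have YM : 0 < Y ^+ M by rewrite exprn_gt0// (lt_le_trans ltr01).
    have -> : pw 2 * pw L / Y ^+ M * ((1 + (pw 2 * 2 + 1) * y) ^+ N * (V1 + V2)) =
      pw 2 * (V1 + V2) * (pw L * (1 + B * y) ^+ N / Y ^+ M) by rewrite /B; ring.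
    rewrite ler_wpM2l//; first by rewrite mulr_ge0// addr_ge0 ?ltW.
    by rewrite ler_pdivrMr// [leRHS]mulrC.
  have HW : fam_bound q W (Af ^+ 2 / 2 ^+ M).
    have WM : mean (fun t => W t ^+ 2) <= Af ^+ 2 / 2 ^+ M.
      have := riesz_bad_mean bf bh h1 s00 es0 (erefl th) fA wn.
      move=> /(_ s) H; apply: (le_trans (H _)).
        by move=> p hp; rewrite sN; apply: sd; exact: map_f.
      rewrite -mulrA ler_wpM2l ?sqr_ge0// -/L sN /N exprM -expRM_natl.
      apply: (@le_trans _ _ ((L0 ^+ M) ^+ 2 * ((2 * L0 ^+ 2)^-1) ^+ M)).
        apply: ler_pM; rewrite ?exprn_ge0 ?expR_ge0//.
          by rewrite lerXn2r ?nnegrE// exprn_ge0// (le_trans _ L6).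
        rewrite lerXn2r ?nnegrE ?expR_ge0 ?invr_ge0 ?mulr_ge0 ?sqr_ge0//.
        have -> : r%:R * - (s0 ^+ 2 / 32) = - (2 * L0 ^+ 2).
          by rewrite mulrN mulrA rs0 /kappa; field.
        have z0 : 0 < 2 * L0 ^+ 2 by rewrite mulr_gt0// exprn_gt0// (lt_le_trans _ L6).
        rewrite expRN lef_pV2 ?posrE ?expR_gt0//.
        by rewrite (le_trans _ (expR_ge1Dx _))// lerDr.
      rewrite exprAC -exprMn -exprVn lerXn2r ?nnegrE ?mulr_ge0 ?invr_ge0 ?mulr_ge0 ?sqr_ge0//.
      rewrite invfM mulrCA mulfV ?mulr1// sqrf_eq0 gt_eqF//; lra.
    apply: sb_pw_sqr => //; last by apply: sb_mono (bessel bW).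
    rewrite ler_pdivrMr// mul1r (le_trans _ (le_trans MP _))//.
      by rewrite lerDr mulr_ge0// addr_ge0 ?sqr_ge0// mulr_ge0// addr_ge0 ?ltW.
    by rewrite ger_pMl// ge_min lexx.
  have -> : (fun t => (if good t then f t * X t else 0) - f t) =
            (fun t => (f t * X t - f t) - W t).
    by apply/funext => t; rewrite /W; case: ifP => _; ring.
  apply: (@sb_mono _ _ (fun n => pw 2 * (pw (hart (fun t => f t * X t - f t) n) + pw (hart W n)))
     (pw 2 * (pw 2 * (V1 + V2) / 2 ^+ M + Af ^+ 2 / 2 ^+ M))).
  + move=> n; rewrite hartB//; last exact: bmB.
    have -> : pw (hart W n) = pw (- hart W n) by rewrite /normpow normrN.
    exact: pwD.
  + have -> : pw 2 * (pw 2 * (V1 + V2) / 2 ^+ M + Af ^+ 2 / 2 ^+ M) =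
       pw 2 * (pw 2 * (V1 + V2) + Af ^+ 2) / 2 ^+ M by field; rewrite gt_eqF.
    rewrite ler_pdivrMr// (le_trans _ (le_trans MP _))//.
      by rewrite lerDl sqr_ge0.
    by rewrite ler_pM2r// ge_min lexx orbT.
  + by apply: sbZ => //; exact: sbD.
- move=> t; case: ifPn => [g|_]; last by rewrite eqxx.
  rewrite mulf_eq0 negb_or => /andP[ft _]; split => //.
  have sN0' : 0 < (size s)%:R :> R by rewrite ltr0n.
  rewrite mulrA ler_pdivlMr//.
  move: g; rewrite /good /h; case: (leP 0 (P t)) => Pt g.
    rewrite ger0_norm// mulrAC mulrC ler_wpM2l//; lra.
  rewrite ltr0_norm//.
  have -> : th * - P t * (size s)%:R = P t * (- (th * (size s)%:R)) by ring.
  by rewrite ler_wnM2l ?(ltW Pt)// lerNr -mulN1r.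
Qed.

End Stage.

(** * Fourier inversion *)

Section PeriodicFunctions.
Context {R : realType}.
Implicit Types (f : R -> R).

Definition per f : Prop := forall t, f (t + 2 * pi) = f t.

Lemma per_int f (k : int) t : per f -> f (t + k%:~R * (2 * pi)) = f t.
Proof.
move=> pf; have H (m : nat) u : f (u + m%:R * (2 * pi)) = f u.
  elim: m u => [|m IH] u; first by rewrite mul0r addr0.
  by rewrite -natr1 mulrDl mul1r addrA pf IH.
case: k => m; first exact: H.
by rewrite NegzE mulrNz mulNr -[LHS](H m.+1) subrK.
Qed.

Lemma mod_2pi (a t : R) : exists k : int, a <= t + k%:~R * (2 * pi) < a + 2 * pi.
Proof.
exists (- Num.floor ((t - a) / (2 * pi))); rewrite mulrNz mulNr.
have p0 := @twopi_gt0 R.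
have := Num.Theory.floor_itv ((t - a) / (2 * pi)).
set F := Num.floor _; have -> : (F + 1)%:~R = F%:~R + 1 :> R by rewrite intrD.
rewrite ler_pdivlMr// ltr_pdivrMr// => /andP[h1 h2].
move: p0 h1 h2; move: (2 * pi) (F%:~R : R) => p x p0 h1 h2; apply/andP; split; lra.
Qed.

Lemma per_cas (n : int) : per (fun t => cas (n%:~R * t)).
Proof.
move=> t /=; rewrite mulrDr /cas cosD sinD cos_int_2pi.
have -> : sin (n%:~R * (2 * pi)) = 0 :> R.
  have := cos2Dsin2 (n%:~R * (2 * pi) : R).
  rewrite cos_int_2pi expr1n => /eqP; rewrite -subr_eq0 addrAC subrr add0r.
  by rewrite expf_eq0/= => /eqP.
by rewrite !mulr1 !mulr0 subr0 addr0.
Qed.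

Lemma per_bounded f : per f -> continuous f -> exists B, forall t, `|f t| <= B.
Proof.
move=> pf cf; have cnf : continuous (fun t => `|f t|).
  by move=> t; apply: cvg_norm; exact: cf.
have [c _ cP] := @EVT_max R (fun t => `|f t|) 0 (2 * pi) (ltW twopi_gt0)
  (continuous_subspaceT cnf).
exists `|f c| => t; have [k /andP[k0 k1]] := mod_2pi 0 t.
by rewrite -(per_int k t pf) cP// in_itv/= k0 ltW// -[X in _ < X]add0r.
Qed.

Lemma bm_periodic f : per f -> continuous f -> bm f.
Proof.
by move=> pf cf; split; [exact: continuous_measurable_fun|exact: per_bounded].
Qed.

Lemma is_derive_continuous f (df : R -> R) :
  (forall t : R, is_derive t 1 f (df t)) -> continuous f.
Proof.
by move=> dF t; apply: differentiable_continuous; apply/derivable1_diffP;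
   have [] := dF t.
Qed.

Lemma continuous_cas (a : R) : continuous (fun t => cas (a * t)).
Proof.
move=> t; apply: (@continuous_comp _ _ _ (fun t => a * t) cas).
  by apply: cvgM; [exact: cvg_cst | exact: cvg_id].
by apply: cvgD; [exact: continuous_cos | exact: continuous_sin].
Qed.

(** Integration by parts; the index is reflected because the derivative of [cas (n t)] is
    [n cas (- n t)]. *)
Lemma hart_deriv f (df : R -> R) (n : int) :
  per f -> (forall t : R, is_derive t 1 f (df t)) -> continuous df -> bm df ->
  hart df n = - n%:~R * hart f (- n).
Proof.
move=> pf dF cdf bdf; have cf := is_derive_continuous dF.
have bf := bm_periodic pf cf.
have b1 : bm (fun t => df t * cas (n%:~R * t)) by apply: bmM => //; exact: bm_cas.
have b2 : bm (fun t => f t * cas ((- n)%:~R * t)) by apply: bmM => //; exact: bm_cas.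
apply/eqP; rewrite mulNr -addr_eq0; apply/eqP.
rewrite /hart -meanZ// -meanD//; last exact: bmZ.
apply: (@mean_deriv_periodic _ (fun t => f t * cas (n%:~R * t))).
- move=> t; have dft := dF t; rewrite /cas.
  apply: is_derive_eq; rewrite /GRing.scale/= mulrNz !mulNr cosN sinN; ring.
- move=> t; apply: cvgD; apply: cvgM; [exact: cdf|exact: continuous_cas|exact: cvg_cst|].
  by apply: cvgM; [exact: cf|exact: continuous_cas].
- by rewrite -[2 * pi]add0r pf per_cas.
Qed.

Lemma hart_deriv2 f (df ddf : R -> R) (B : R) (n : int) : per f -> per df ->
  (forall t : R, is_derive t 1 f (df t)) ->
  (forall t : R, is_derive t 1 df (ddf t)) -> continuous ddf -> bm ddf ->
  (forall t, `|ddf t| <= B) ->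
  n%:~R ^+ 2 * `|hart f n| <= 2 * B.
Proof.
move=> pf pdf dF ddF cddf bddf B2.
have cdf := is_derive_continuous ddF.
have E : hart ddf n = - (n%:~R ^+ 2 * hart f n).
  rewrite (hart_deriv _ pdf ddF)// (hart_deriv _ pf dF)//; last exact: bm_periodic.
  by rewrite opprK mulrNz; ring.
have -> : n%:~R ^+ 2 * `|hart f n| = `|hart ddf n|.
  by rewrite E normrN [RHS]normrM (ger0_norm (sqr_ge0 _)).
apply: ler_norm_mean; first by apply: bmM => //; exact: bm_cas.
by move=> t; rewrite normrM mulrC ler_pM// cas_le2.
Qed.

(** Shifted sines and cosines are combinations of [cas (n t)] and [cas (- n t)] with coefficients
    bounded independently of [n] and [x], so the threshold is uniform in the phase. *)
Lemma riemann_lebesgue_phase f (e : R) : bm f -> 0 < e ->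
  exists D : nat, forall n : nat, (D < n)%N -> forall x,
    `|mean (fun t => f t * cos (n%:R * (t - x)))| <= e /\
    `|mean (fun t => f t * sin (n%:R * (t - x)))| <= e.
Proof.
move=> bf e0; have e2 : 0 < e / 2 by rewrite divr_gt0.
have [D DP] := riemann_lebesgue bf e2.
exists D => n Dn x.
have h1 := DP n%:Z Dn; have h2 : `|hart f (- n%:Z)| <= e / 2 by apply: DP; rewrite abszN.
have b1 m : bm (fun t => f t * cas (m%:~R * t)) by apply: bmM => //; exact: bm_cas.
have key (c1 c2 : R) (F : R -> R) : `|c1| <= 2 -> `|c2| <= 2 ->
    (forall t, F t = (cas (n%:Z%:~R * t) * c1 + cas ((- n%:Z)%:~R * t) * c2) / 2) ->
    `|mean (fun t => f t * F t)| <= e.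
  move=> c12 c22 FE.
  have -> : mean (fun t => f t * F t) = c1 / 2 * hart f n%:Z + c2 / 2 * hart f (- n%:Z).
    rewrite -!meanZ// -meanD; [|exact: bmZ|exact: bmZ].
    by congr mean; apply/funext => t; rewrite FE; ring.
  have k (c h : R) : `|c| <= 2 -> `|h| <= e / 2 -> `|c / 2 * h| <= e / 2.
    move=> hc hh; rewrite normrM normrM [`|2^-1|]ger0_norm// -[leRHS]mul1r ler_pM//.
    by rewrite ler_pdivrMr// mul1r.
  by rewrite (le_trans (ler_normD _ _))// (le_trans (lerD (k _ _ c12 h1) (k _ _ c22 h2)))//; lra.
have cs (a b : R) : `|a| <= 1 -> `|b| <= 1 -> `|a - b| <= 2.
  by move=> a1 b1'; rewrite (le_trans (ler_normB _ _))//; lra.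
split.
- apply: (key (cas (n%:R * x)) (cos (n%:R * x) - sin (n%:R * x))).
  + exact: cas_le2.
  + by apply: cs; [exact: cos_max|exact: sin_max].
  + move=> t; rewrite mulrNz mulNr mulrBr cosB /cas cosN sinN -[_%:~R]/(n%:R); by field.
- apply: (key (cos (n%:R * x) - sin (n%:R * x)) (- cas (n%:R * x))).
  + by apply: cs; [exact: cos_max|exact: sin_max].
  + by rewrite normrN; exact: cas_le2.
  + move=> t; rewrite mulrNz mulNr mulrBr sinB /cas cosN sinN -[_%:~R]/(n%:R); by field.
Qed.

End PeriodicFunctions.

Section Dirichlet.
Context {R : realType}.

Definition sym_sum (a : int -> R) (N : nat) : R :=
  a 0 + \sum_(k < N) (a k.+1%:Z + a (- k.+1%:Z)).

Definition dirichlet (N : nat) (u : R) : R := 1 + \sum_(k < N) 2 * cos (k.+1%:R * u).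

(** Both sides are [sin ((N + 1/2) u)]; it is left expanded so that the oscillation has the integer
    frequency [N], as in the Riemann-Lebesgue lemma. *)
Lemma dirichletE N u :
  sin (u / 2) * dirichlet N u = sin (u / 2) * cos (N%:R * u) + cos (u / 2) * sin (N%:R * u).
Proof.
elim: N => [|N IH].
  by rewrite /dirichlet big_ord0 addr0 mul0r cos0 sin0 mulr0 addr0.
have -> : dirichlet N.+1 u = dirichlet N u + 2 * cos (N.+1%:R * u).
  by rewrite /dirichlet big_ord_recr/= addrA.
rewrite mulrDr IH.
have -> : N.+1%:R * u = N%:R * u + u by rewrite -[N.+1%:R]natr1 mulrDl mul1r.
set v := N%:R * u; set y := v + u; set w := u / 2.
have E : cos w * sin y - sin w * cos y = sin w * cos v + cos w * sin v.
  have -> : cos w * sin y - sin w * cos y = sin (y - w) by rewrite sinB; ring.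
  rewrite -sinD; congr sin; rewrite /y /w; by field.
by rewrite -E; ring.
Qed.

(** By the mean value theorem [v * cos v <= sin v]. At [v = w / 2], doubling the angle gives
    [sin w >= w * cos (w / 2) ^+ 2], and the squared cosine is at least [1 / 2] because
    [cos w >= 0]. *)
Lemma half_le_sin (w : R) : 0 <= w <= pi / 2 -> w / 2 <= sin w.
Proof.
have p2 := @pi_gt0 R.
have key (v : R) : 0 <= v <= pi / 2 -> v * cos v <= sin v.
  move=> /andP[v0 v1].
  have [|c ci E] := @MVT_segment R sin cos 0 v v0.
  - by apply: continuous_subspaceT => x; exact: continuous_sin.
  - move: E; rewrite sin0 !subr0 => ->; rewrite mulrC ler_wpM2r//.
    move: ci; rewrite in_itv/= => /andP[c0 c1].
    rewrite leNgt ltr_cos ?in_itv/= ?c0 ?v0 -?leNgt//; lra.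
move=> /andP[w0 w1].
have hw : 0 <= w / 2 <= pi / 2 by apply/andP; split; lra.
have := key _ hw.
have c0 : 0 <= cos (w / 2) by apply: cos_ge0_pihalf; apply/andP; split; lra.
have sE : sin w = 2 * (cos (w / 2) * sin (w / 2)).
  by rewrite -[in LHS](_ : (w / 2) *+ 2 = w) ?sin_mulr2n ?mulr_natl// -mulr_natr; field.
have cE : cos w = 2 * cos (w / 2) ^+ 2 - 1.
  by rewrite -[in LHS](_ : (w / 2) *+ 2 = w) ?cos_mulr2n ?mulr_natl// -mulr_natr; field.
have cw : 0 <= cos w by apply: cos_ge0_pihalf; apply/andP; split; lra.
rewrite sE; move: cE cw c0; move: (cos (w / 2)) (sin (w / 2)) => c s -> cw c0 h.
have : w / 2 * c * c <= s * c by rewrite ler_wpM2r.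
nra.
Qed.

End Dirichlet.

Section FourierInversion.
Context {R : realType}.
Implicit Types (f phi : R -> R).

(** Both sides depend on [t] modulo the period only, so [t] may be moved to within [pi] of [x],
    where the distance is comparable to the sine of its half. *)
Lemma per_lipschitz_sin phi (dphi : R -> R) (B : R) x t : per phi ->
  (forall u : R, is_derive u 1 phi (dphi u)) -> (forall u, `|dphi u| <= B) ->
  `|phi t - phi x| <= 4 * B * `|sin ((t - x) / 2)|.
Proof.
move=> pphi dP B1; have B0 : 0 <= B := le_trans (normr_ge0 _) (B1 0).
have p0 := @pi_gt0 R.
have cphi := is_derive_continuous dP.
have lip (a b : R) : a <= b -> `|phi b - phi a| <= B * (b - a).
  move=> ab; have [|c _ ->] := @MVT_segment R phi dphi a b ab (fun u _ => dP u).
  - exact: continuous_subspaceT.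
  - by rewrite normrM (ger0_norm (_ : 0 <= b - a)) ?subr_ge0// ler_wpM2r ?subr_ge0.
have [k /andP[k0 k1]] := mod_2pi (x - pi) t.
set t' := t + k%:~R * (2 * pi) in k0 k1.
have -> : phi t = phi t' by rewrite /t' per_int.
have tx : `|t' - x| <= pi by rewrite ler_norml; apply/andP; split; lra.
have L : `|phi t' - phi x| <= B * `|t' - x|.
  have [tx'|/ltW tx'] := leP x t'.
    by rewrite [`|t' - x|]ger0_norm ?subr_ge0// lip.
  have -> : `|t' - x| = x - t' by rewrite distrC ger0_norm ?subr_ge0.
  by rewrite distrC lip.
have sq (u : R) : sin (u / 2) ^+ 2 = (1 - cos u) / 2.
  have := cos2Dsin2 (u / 2); rewrite -[in cos u](_ : (u / 2) *+ 2 = u); last first.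
    by rewrite -mulr_natr; field.
  rewrite cos_mulr2n; move: (sin _ ^+ 2) (cos _ ^+ 2) => S C E.
  have -> : S = 1 - C by rewrite -E; ring.
  by rewrite -mulr_natr; field.
have -> : `|sin ((t - x) / 2)| = `|sin ((t' - x) / 2)|.
  apply/eqP; rewrite -(eqrXn2 (n := 2))// ?normr_ge0// !real_normK ?num_real// !sq.
  have -> : t' - x = (t - x) + k%:~R * (2 * pi) by rewrite /t'; ring.
  by rewrite (@per_int R cos)// => u; rewrite [2 * pi]mulr_natl; exact: cosD2pi.
have W : `|t' - x| / 4 <= `|sin ((t' - x) / 2)|.
  have E : `|sin ((t' - x) / 2)| = sin (`|t' - x| / 2).
    have [h|/ltW h] := leP 0 (t' - x).
      rewrite [`|t' - x|]ger0_norm// ger0_norm// sin_ge0_pi//.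
      move: tx; rewrite ger0_norm// => tx; apply/andP; split; lra.
    rewrite [`|t' - x|]ler0_norm// mulNr sinN ler0_norm//.
    rewrite -oppr_ge0 -sinN sin_ge0_pi//.
    move: tx; rewrite ler0_norm// => tx; apply/andP; split; lra.
  rewrite E; apply: le_trans (half_le_sin _); first lra.
  by apply/andP; split; [rewrite divr_ge0|lra].
rewrite (le_trans L)//; have -> : 4 * B * `|sin ((t' - x) / 2)| = B * (4 * `|sin ((t' - x) / 2)|).
  by ring.
rewrite ler_wpM2l//; lra.
Qed.

Lemma sym_sum_hart phi x N : bm phi ->
  sym_sum (fun n => hart phi n * cas (n%:~R * x)) N =
  mean (fun t => phi t * dirichlet N (t - x)).
Proof.
move=> bphi.
have bc k : bm (fun t => 2 * (phi t * cos (k.+1%:R * (t - x)))).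
  apply: bmZ; apply: bmM => //.
  have -> : (fun t => cos (k.+1%:R * (t - x))) = (fun t : R =>
      cos (k.+1%:R * x) * cos (k.+1%:R * t) + sin (k.+1%:R * x) * sin (k.+1%:R * t)).
    by apply/funext => t; rewrite mulrBr cosB; ring.
  by apply: bmD; apply: bmZ; [exact: bm_cos|exact: bm_sin].
have bh n : bm (fun t => phi t * cas (n%:~R * t)) by apply: bmM => //; exact: bm_cas.
transitivity (mean (fun t => phi t + \sum_(k < N) 2 * (phi t * cos (k.+1%:R * (t - x))))).
  rewrite meanD//; last exact: bm_sum.
  rewrite mean_sum// /sym_sum; congr (_ + _).
    rewrite mul0r /cas cos0 sin0 addr0 mulr1; congr mean; apply/funext => t.
    by rewrite mul0r /cas cos0 sin0 addr0 mulr1.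
  apply: eq_bigr => k _; rewrite ![hart _ _ * _]mulrC /hart -!meanZ// -meanD; [|exact: bmZ|exact: bmZ].
  congr mean; apply/funext => t.
  rewrite mulrNz !mulNr mulrBr cosB /cas !cosN !sinN -[k.+1%:~R]/(k.+1%:R : R).
  ring.
congr mean; apply/funext => t.
by rewrite /dirichlet mulrDr mulr1 mulr_sumr; congr (_ + _); apply: eq_bigr => k _; ring.
Qed.

Lemma bm_shift_trig (g : R -> R) (c x : R) : continuous g -> (forall u, `|g u| <= 1) ->
  bm (fun t => g ((t - x) * c)).
Proof.
move=> cg g1; split; last by exists 1 => t; exact: g1.
apply: continuous_measurable_fun => t.
apply: (@continuous_comp _ _ _ (fun t => (t - x) * c) g); last exact: cg.
apply: cvgM; last exact: cvg_cst.
by apply: cvgB; [exact: cvg_id|exact: cvg_cst].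
Qed.

(* The difference quotient against [sin ((t - x) / 2)] is bounded, so the
   Riemann-Lebesgue lemma applies to it. *)
Lemma fourier_inversion phi (dphi : R -> R) x (e : R) : per phi -> 0 < e ->
  (forall u : R, is_derive u 1 phi (dphi u)) -> bm dphi ->
  exists D : nat, forall N : nat, (D < N)%N ->
    `|sym_sum (fun n => hart phi n * cas (n%:~R * x)) N - phi x| <= e.
Proof.
move=> pphi e0 dP bdphi; have [B B0 B1] := bm_ge0 bdphi.
have cphi := is_derive_continuous dP.
have bphi := bm_periodic pphi cphi.
pose psi t := phi t - phi x.
have bpsi : bm psi by apply: bmB => //; exact: bm_cst.
pose sn t := sin ((t - x) / 2); pose cs t := cos ((t - x) / 2).
have bsn : bm sn by apply: bm_shift_trig; [exact: continuous_sin|exact: sin_max].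
have bcs : bm cs by apply: bm_shift_trig; [exact: continuous_cos|exact: cos_max].
have psi_sn t : `|psi t| <= 4 * B * `|sn t| by exact: per_lipschitz_sin dP B1.
(* This is [psi * cs / sn] in a visibly measurable form; at the zeros of [sn] the factor [sn t]
   makes it 0. *)
pose kap t := psi t * cs t * sn t * (sn t ^+ 2) `^ (-1).
have kapE t : sn t * kap t = psi t * cs t.
  have [s0|s0] := eqVneq (sn t) 0.
    have := psi_sn t; rewrite s0 normr0 mulr0 normr_le0 => /eqP ->.
    by rewrite !mul0r.
  by rewrite /kap powR_inv1 ?sqr_ge0//; field.
have bkap : bm kap.
  split.
    apply: measurable_funM.
      by apply: measurable_funM; [apply: measurable_funM; [case: bpsi|case: bcs]|case: bsn].
    apply: (@measurableT_comp _ _ _ _ _ _ (fun y : R => y `^ (-1))); first exact: measurable_powR.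
    by have [] := bmX 2 bsn.
  exists (4 * B) => t.
  have [s0|s0] := eqVneq (sn t) 0.
    by rewrite /kap s0 mulr0 mul0r normr0 mulr_ge0.
  have sp : 0 < `|sn t| by rewrite normr_gt0.
  rewrite -(ler_pM2l sp) -normrM kapE normrM mulrC -[leRHS]mulrC.
  rewrite -[leRHS]mul1r ler_pM//; exact: cos_max.
have e2 : 0 < e / 2 by rewrite divr_gt0.
have [D1 D1P] := riemann_lebesgue_phase bpsi e2.
have [D2 D2P] := riemann_lebesgue_phase bkap e2.
exists (maxn D1 D2) => N; rewrite gtn_max => /andP[/D1P/(_ x)[h1 _] /D2P/(_ x)[_ h2]].
rewrite sym_sum_hart//.
have bcN : bm (fun t => cos (N%:R * (t - x))).
  under eq_fun do rewrite mulrC; apply: bm_shift_trig; [exact: continuous_cos|exact: cos_max].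
have bsN : bm (fun t => sin (N%:R * (t - x))).
  under eq_fun do rewrite mulrC; apply: bm_shift_trig; [exact: continuous_sin|exact: sin_max].
have bD : bm (fun t => dirichlet N (t - x)).
  apply: bmD; first exact: bm_cst.
  apply: bm_sum => k; apply: bmZ; under eq_fun do rewrite mulrC.
  apply: bm_shift_trig; [exact: continuous_cos|exact: cos_max].
(* Obtained from [sym_sum_hart] for the constant 1, whose only nonzero coefficient has index 0. *)
have mD : mean (fun t => dirichlet N (t - x)) = 1.
  have := sym_sum_hart x N (bm_cst 1).
  under [in RHS]eq_fun do rewrite mul1r.
  move=> <-; rewrite /sym_sum mul0r /cas cos0 sin0 addr0 mulr1.
  have h n : hart (fun=> (1 : R)) n = (n == 0)%:R.
    rewrite /hart; under eq_fun do rewrite mul1r.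
    by rewrite meanD ?mean_cos ?mean_sin ?addr0//; [exact: bm_cos|exact: bm_sin].
  rewrite h big1 ?addr0// => k _.
  by rewrite !h/= !mul0r addr0.
have -> : mean (fun t => phi t * dirichlet N (t - x)) - phi x =
   mean (fun t => psi t * cos (N%:R * (t - x))) + mean (fun t => kap t * sin (N%:R * (t - x))).
  have E : phi x = mean (fun t => phi x * dirichlet N (t - x)) by rewrite meanZ// mD mulr1.
  rewrite [X in _ - X = _]E -meanB; [|exact: bmM|exact: bmZ].
  rewrite -meanD; [|exact: bmM|exact: bmM].
  congr mean; apply/funext => t; rewrite -mulrBl -/(psi t).
  have [s0|s0] := eqVneq (sn t) 0.
    have -> : psi t = 0.
      by have := psi_sn t; rewrite s0 normr0 mulr0 normr_le0 => /eqP.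
    by rewrite /kap s0 !mulr0 !mul0r addr0.
  have DE : sn t * dirichlet N (t - x) =
    sn t * cos (N%:R * (t - x)) + cs t * sin (N%:R * (t - x)) := dirichletE _ _.
  apply: (mulfI s0).
  transitivity (psi t * (sn t * dirichlet N (t - x))); first by ring.
  rewrite DE; transitivity (psi t * (sn t * cos (N%:R * (t - x))) +
    (psi t * cs t) * sin (N%:R * (t - x))); first by ring.
  by rewrite -kapE; ring.
by rewrite (le_trans (ler_normD _ _))// (le_trans (lerD h1 h2))//; lra.
Qed.

Lemma sum_inv_sqr (N m : nat) : (0 < N)%N ->
  \sum_(k < m) ((N + k).+1%:R ^+ 2)^-1 <= N%:R^-1 - (N + m)%:R^-1 :> R.
Proof.
move=> N0; elim: m => [|m IH]; first by rewrite big_ord0 addn0 subrr.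
rewrite big_ord_recr/= addnS.
have n0 : 0 < (N + m)%:R :> R by rewrite ltr0n addn_gt0 N0.
have : ((N + m).+1%:R ^+ 2)^-1 <= (N + m)%:R^-1 - (N + m).+1%:R^-1 :> R.
  rewrite -natr1; move: ((N + m)%:R) n0 => y y0.
  have y1 : 0 < y + 1 by lra.
  have -> : y^-1 - (y + 1)^-1 = (y * (y + 1))^-1 by field; rewrite !gt_eqF.
  rewrite lef_pV2 ?posrE ?mulr_gt0 ?exprn_gt0//; nra.
by move=> h; rewrite (le_trans (lerD IH h))// addrA subrK.
Qed.

Lemma sum_inv_sqr_le2 (m : nat) : \sum_(k < m) (k.+1%:R ^+ 2)^-1 <= 2 :> R.
Proof.
case: m => [|m]; first by rewrite big_ord0.
rewrite big_ord_recl/= expr1n invr1.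
have := @sum_inv_sqr 1 m isT; rewrite invr1 => h.
rewrite (le_trans (lerD (lexx 1) h))// -[2%:R](natrD _ 1 1) lerD2l gerBl invr_ge0.
by rewrite ler0n.
Qed.

(** The coefficients of [phi] of index [n] are at most [2 * B2 / n ^+ 2], hence absolutely summable,
    and pair with those of [f]. The bound sees [f] only through [e]: its supremum [A] affects the
    error of truncation, which tends to 0. *)
Lemma mean_mul_le_hart f phi (dphi ddphi : R -> R) (B0 B2 e : R) :
  bm f -> per phi -> per dphi -> per ddphi ->
  (forall t : R, is_derive t 1 phi (dphi t)) ->
  (forall t : R, is_derive t 1 dphi (ddphi t)) -> continuous ddphi ->
  (forall t, `|phi t| <= B0) -> (forall t, `|ddphi t| <= B2) ->
  (forall n, `|hart f n| <= e) ->
  `|mean (fun t => f t * phi t)| <= e * (2 * B0 + 8 * B2).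
Proof.
move=> bf pphi pd pdd dP ddP cdd Bphi Bdd fe.
have [A A0 fA] := bm_ge0 bf.
have e0 : 0 <= e := le_trans (normr_ge0 _) (fe 0).
have B20 : 0 <= B2 := le_trans (normr_ge0 _) (Bdd 0).
have cd := is_derive_continuous ddP.
have bphi := bm_periodic pphi (is_derive_continuous dP).
have bd := bm_periodic pd cd.
have bdd := bm_periodic pdd cdd.
have hle (n : nat) (s : bool) : `|hart phi ((-1) ^+ s * n.+1%:Z)| <= 2 * B2 * (n.+1%:R ^+ 2)^-1.
  have n0 : 0 < n.+1%:R ^+ 2 :> R by rewrite exprn_gt0.
  have := hart_deriv2 ((-1) ^+ s * n.+1%:Z) pphi pd dP ddP cdd bdd Bdd.
  rewrite intrM exprMn -[n.+1%:~R]/(n.+1%:R : R) rmorph_sign sqrr_sign mul1r.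
  by rewrite mulrC ler_pdivlMr.
have hle1 n : `|hart phi n.+1%:Z| <= 2 * B2 * (n.+1%:R ^+ 2)^-1.
  by have := hle n false; rewrite expr0 mul1r.
have hle2 n : `|hart phi (- n.+1%:Z)| <= 2 * B2 * (n.+1%:R ^+ 2)^-1.
  by have := hle n true; rewrite expr1 mulN1r.
pose S N t := sym_sum (fun n => hart phi n * cas (n%:~R * t)) N.
have bS N : bm (S N).
  apply: bmD; first by apply: bmZ; exact: bm_cas.
  by apply: bm_sum => k; apply: bmD; apply: bmZ; exact: bm_cas.
have bfc n : bm (fun t => f t * cas (n%:~R * t)) by apply: bmM => //; exact: bm_cas.
(* [fourier_inversion] is pointwise; comparing [S N] with a much later partial sum yields a rate
   that is uniform in [x]. *)
have tail N x : (0 < N)%N -> `|S N x - phi x| <= 8 * B2 * N%:R^-1.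
  move=> N0; apply/ler_addgt0Pr => d d0.
  have [D DP] := fourier_inversion x pphi d0 dP bd.
  have [m Dm] : exists m, (D < N + m)%N by exists D.+1; rewrite addnS ltnS leq_addl.
  rewrite -(subrKA (S (N + m)%N x)) (le_trans (ler_normD _ _))// lerD//; last exact: DP.
  have -> : S N x - S (N + m)%N x = - \sum_(k < m)
     (hart phi (N + k).+1%:Z * cas ((N + k).+1%:Z%:~R * x) +
      hart phi (- (N + k).+1%:Z) * cas ((- (N + k).+1%:Z)%:~R * x)).
    rewrite /S /sym_sum big_split_ord/= addrA opprD addrA subrr add0r.
    by [].
  rewrite normrN (le_trans (ler_norm_sum _ _ _))//.
  apply: (@le_trans _ _ (\sum_(k < m) 8 * B2 * ((N + k).+1%:R ^+ 2)^-1)).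
    apply: ler_sum => k _; rewrite (le_trans (ler_normD _ _))//.
    have c2 (a b c : R) : `|a| <= c -> `|b| <= 2 -> `|a * b| <= c * 2.
      by move=> ha hb; rewrite normrM ler_pM.
    have := c2 _ _ _ (hle1 (N + k)%N) (cas_le2 ((N + k).+1%:Z%:~R * x)).
    have := c2 _ _ _ (hle2 (N + k)%N) (cas_le2 ((- (N + k).+1%:Z)%:~R * x)).
    move=> h2 h1; rewrite (le_trans (lerD h1 h2))//; move: (_^-1) => z; lra.
  rewrite -mulr_sumr ler_wpM2l ?mulr_ge0// (le_trans (sum_inv_sqr m N0))//.
  by rewrite gerBl invr_ge0.
have mS N : `|mean (fun t => f t * S N t)| <= e * (2 * B0 + 8 * B2).
  have -> : mean (fun t => f t * S N t) =
      hart phi 0 * hart f 0 + \sum_(k < N) (hart phi k.+1%:Z * hart f k.+1%:Z +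
        hart phi (- k.+1%:Z) * hart f (- k.+1%:Z)).
    rewrite /S /sym_sum; transitivity (mean (fun t =>
       hart phi 0 * (f t * cas (0%:~R * t)) + \sum_(k < N)
        (hart phi k.+1%:Z * (f t * cas (k.+1%:Z%:~R * t)) +
         hart phi (- k.+1%:Z) * (f t * cas ((- k.+1%:Z)%:~R * t))))).
      congr mean; apply/funext => t; rewrite mulrDr mulr_sumr mulrCA; congr (_ + _).
      by apply: eq_bigr => k _; rewrite mulrDr !(mulrCA (f t)).
    have bk k : bm (fun t => hart phi k.+1%:Z * (f t * cas (k.+1%:Z%:~R * t)) +
         hart phi (- k.+1%:Z) * (f t * cas ((- k.+1%:Z)%:~R * t))).
      by apply: bmD; exact: bmZ.
    rewrite meanD; [|exact: bmZ|exact: bm_sum].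
    rewrite meanZ// mean_sum//; congr (_ + _); apply: eq_bigr => k _.
    by rewrite meanD ?meanZ//; exact: bmZ.
  rewrite (le_trans (ler_normD _ _))// mulrDr lerD//.
    rewrite normrM mulrC ler_pM//; apply: ler_norm_mean; first by apply: bmM => //; exact: bm_cas.
    by move=> t; rewrite normrM mulrC ler_pM// cas_le2.
  rewrite (le_trans (ler_norm_sum _ _ _))//.
  apply: (@le_trans _ _ (\sum_(k < N) e * (4 * B2) * (k.+1%:R ^+ 2)^-1)).
    apply: ler_sum => k _; rewrite (le_trans (ler_normD _ _))//.
    have h1 : `|hart phi k.+1%:Z * hart f k.+1%:Z| <= 2 * B2 * (k.+1%:R ^+ 2)^-1 * e.
      by rewrite normrM ler_pM.
    have h2 : `|hart phi (- k.+1%:Z) * hart f (- k.+1%:Z)| <= 2 * B2 * (k.+1%:R ^+ 2)^-1 * e.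
      by rewrite normrM ler_pM.
    by rewrite (le_trans (lerD h1 h2))//; move: (_^-1) => z; lra.
  rewrite -mulr_sumr -mulrA ler_wpM2l//.
  have -> : 8 * B2 = 4 * B2 * 2 by ring.
  by rewrite ler_wpM2l ?mulr_ge0// sum_inv_sqr_le2.
apply/ler_addgt0Pr => d d0.
pose N := (Num.truncn (A * (8 * B2) / d)).+1.
have N0 : 0 < N%:R :> R by rewrite ltr0n.
have -> : mean (fun t => f t * phi t) = mean (fun t => f t * S N t) - mean (fun t => f t * (S N t - phi t)).
  rewrite -meanB; [|exact: bmM|by apply: bmM => //; exact: bmB].
  by congr mean; apply/funext => t; ring.
rewrite (le_trans (ler_normB _ _))// lerD//.
apply: (@le_trans _ _ (A * (8 * B2 * N%:R^-1))).
  apply: ler_norm_mean; first by apply: bmM => //; exact: bmB.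
  by move=> t; rewrite normrM ler_pM// tail.
rewrite mulrA ler_pdivrMr// [leRHS]mulrC -ler_pdivrMr//.
by rewrite ltW// truncnS_gt.
Qed.

End FourierInversion.

(** * Convergence by telescoping majorants *)

Section Telescoping.
Context {R : realType}.

(** The sequence [u - w] is nondecreasing and bounded above, so it converges, and [w] tends to 0. *)
Lemma telescoping_cvg (u w : nat -> R) :
  (forall k, `|u k.+1 - u k| <= w k - w k.+1) -> w @ \oo --> (0 : R) ->
  cvgn u /\ forall k, `|limn u - u k| <= w k.
Proof.
move=> uw w0.
have step k m : `|u (k + m)%N - u k| <= w k - w (k + m)%N.
  elim: m => [|m IH]; first by rewrite addn0 !subrr normr0.
  rewrite addnS -(subrKA (u (k + m)%N)) (le_trans (ler_normD _ _))//.
  by have := uw (k + m)%N; lra.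
have wd : nonincreasing_seq w.
  move=> m n /subnK <-; rewrite addnC -subr_ge0.
  exact: le_trans (normr_ge0 _) (step _ _).
have wge0 k : 0 <= w k.
  have cw : cvgn w by apply/cvg_ex; exists 0.
  by rewrite -(cvg_lim (@Rhausdorff R) w0) nonincreasing_cvgn_ge.
have vd : nondecreasing_seq (fun k => u k - w k).
  move=> m n /subnK <-; rewrite addnC.
  by have := step m (n - m)%N; rewrite ler_norml => /andP[]; lra.
have vcv : cvgn (fun k => u k - w k).
  apply: nondecreasing_is_cvgn => //; exists (u 0%N + w 0%N) => _ [k _ <-].
  have := step 0%N k; rewrite add0n ler_norml => /andP[_].
  by have := wge0 k; lra.
have ucv : cvgn u.
  have -> : u = (fun k => (u k - w k) + w k) by apply/funext => k; rewrite subrK.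
  by apply: is_cvgD => //; apply/cvg_ex; exists 0.
split=> // k.
have h m : (k <= m)%N -> `|u m - u k| <= w k.
  move=> /subnK <-; rewrite addnC (le_trans (step _ _))// gerBl//.
rewrite ler_norml; apply/andP; split.
  rewrite lerBrDr addrC; apply: limr_ge => //.
  near=> m; have km : (k <= m)%N by near: m; exact: nbhs_infty_ge.
  by have := h m km; rewrite ler_norml => /andP[]; lra.
rewrite lerBlDr; apply: limr_le => //.
near=> m; have km : (k <= m)%N by near: m; exact: nbhs_infty_ge.
by have := h m km; rewrite ler_norml => /andP[]; lra.
Unshelve. all: by end_near.
Qed.

Lemma geometric_cvg0 (C x : R) : 0 <= x < 1 -> (fun k => C * x ^+ k) @ \oo --> (0 : R).
Proof.
by move=> /andP[x0 x1]; apply: cvg_geometric; rewrite ger0_norm.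
Qed.

Lemma halving_cvg (u : nat -> R) (C : R) :
  (forall k, `|u k.+1 - u k| <= C * 2^-1 ^+ k.+1) ->
  cvgn u /\ forall k, `|limn u - u k| <= C * 2^-1 ^+ k.
Proof.
move=> uC; apply: telescoping_cvg; last by apply: geometric_cvg0; lra.
by move=> k; rewrite (le_trans (uC k))// exprS; move: (_ ^+ k) => z; lra.
Qed.

End Telescoping.

(** * The set and the distribution *)

Section Construction.
Context {R : realType} (q : R).
Context (q2 : 2 < q).
Local Notation pw := (normpow q).

(* A countable family of continuous periodic functions that is rich enough to
   separate disjoint compact sets by sign. *)
Fixpoint cos_max_fun (l : seq (rat * rat)) (t : R) : R :=
  if l is p :: l' then Num.max (cos (t - ratr p.1) - ratr p.2) (cos_max_fun l' t)
  else -1.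

Definition sep_fun (k : nat) : R -> R :=
  if unpickle k is Some l then cos_max_fun l else cst 1.

Lemma cos_comp_continuous (g : R -> R) : continuous g -> continuous (fun t => cos (g t)).
Proof.
by move=> cg t; apply: (@continuous_comp _ _ _ g cos); [exact: cg|exact: continuous_cos].
Qed.

Lemma max_continuous (f g : R -> R) : continuous f -> continuous g ->
  continuous (fun t => Num.max (f t) (g t)).
Proof.
move=> cf cg; under eq_fun do rewrite maxr_absE.
move=> t; apply: cvgM; last exact: cvg_cst.
by apply: cvgD; [apply: cvgD; [exact: cf|exact: cg]|apply: cvg_norm; apply: cvgB; [exact: cf|exact: cg]].
Qed.

Lemma sep_fun_continuous k : continuous (sep_fun k).
Proof.
rewrite /sep_fun; case: unpickle => [l|]; last by move=> t; exact: cvg_cst.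
elim: l => [|p l IH] /=; first by move=> t; exact: cvg_cst.
apply: max_continuous => // t; apply: cvgB; last exact: cvg_cst.
apply: (@cos_comp_continuous (fun t => t - ratr p.1)) => u.
by apply: cvgB; [exact: cvg_id|exact: cvg_cst].
Qed.

Lemma cos_2pi_periodic (t : R) : cos (t + 2 * pi) = cos t.
Proof. by rewrite [2 * pi]mulr_natl; exact: cosD2pi. Qed.

Lemma sep_fun_per k : per (sep_fun k).
Proof.
rewrite /sep_fun; case: unpickle => [l|]//.
elim: l => [|p l IH] //= t; rewrite IH; congr Num.max.
by rewrite addrAC cos_2pi_periodic.
Qed.

Definition avgcos (s : seq nat) (t : R) : R := (\sum_(n <- s) cosn n t) / (size s)%:R.

Lemma cosn_continuous n : continuous (@cosn R n).
Proof.
apply: (@cos_comp_continuous (fun t => n%:R * t)) => t.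
by apply: cvgM; [exact: cvg_cst | exact: cvg_id].
Qed.

Lemma cosn_per n : per (@cosn R n).
Proof.
move=> t; rewrite /cosn mulrDr (@per_int R cos n%:Z)//.
exact: cos_2pi_periodic.
Qed.

Lemma avgcos_continuous s : continuous (avgcos s).
Proof.
move=> t; apply: cvgM; last exact: cvg_cst.
elim: s => [|n s IH].
  by rewrite big_nil; under eq_fun do rewrite big_nil; exact: cvg_cst.
by under eq_fun do rewrite big_cons; rewrite big_cons; apply: cvgD; [exact: cosn_continuous|].
Qed.

Lemma avgcos_per s : per (avgcos s).
Proof. by move=> t; congr (_ / _); apply: eq_bigr => n _; exact: cosn_per. Qed.

Lemma avgcos_le1 s t : `|avgcos s t| <= 1.
Proof.
case: s => [|n s]; first by rewrite /avgcos big_nil mul0r normr0.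
rewrite /avgcos normrM [`|_^-1|]ger0_norm ?invr_ge0//.
rewrite ler_pdivrMr ?ltr0n// mul1r (le_trans (ler_norm_sum _ _ _))//.
apply: (@le_trans _ _ (\sum_(i <- n :: s) 1)).
  by apply: ler_sum => i _; exact: cosn_le1.
by rewrite big_const_seq count_predT iter_addr_0.
Qed.

(** Where [sep_fun k] is nonzero, the average has its sign and absolute value at least [th]; where
    it vanishes the condition is void. Multiplying by [sep_fun k] instead of its sign keeps the
    condition closed. *)
Definition good (th : R) (nu : nat -> seq nat) (k : nat) : set R :=
  [set t | th * `|sep_fun k t| <= sep_fun k t * avgcos (nu k) t].

Definition good_set th nu : set R := \bigcap_k good th nu k.

Lemma good_closed th nu k : closed (good th nu k).
Proof.
pose F t := sep_fun k t * avgcos (nu k) t - th * `|sep_fun k t|.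
have cF : continuous F.
  move=> t; apply: cvgB; first by apply: cvgM; [exact: sep_fun_continuous|exact: avgcos_continuous].
  by apply: cvgM; [exact: cvg_cst|apply: cvg_norm; exact: sep_fun_continuous].
have -> : good th nu k = F @^-1` [set x | 0 <= x].
  by apply/seteqP; split => t /=; rewrite subr_ge0.
by apply: closed_comp; [move=> t _; exact: cF|exact: closed_ge].
Qed.

Lemma good_per th nu k t : good th nu k (t + 2 * pi) <-> good th nu k t.
Proof. by rewrite /good /= sep_fun_per avgcos_per. Qed.

Lemma construction : exists2 th : R, 0 < th <= 1 &
  exists (F : nat -> R -> R) (nu : nat -> seq nat), [/\ F 0%N = cst 1,
    forall k, bm (F k), forall k, (0 < size (nu k))%N,
    forall k, fam_bound q (fun t => F k.+1 t - F k t)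
       (pw (2^-1 ^+ k.+2) * 2^-1 ^+ k.+2) &
    forall k t, F k.+1 t != 0 -> F k t != 0 /\ good th nu k t].
Proof.
have [th th01 stageP] := stage q2; exists th => //.
(* The first factor cancels the weight that [pw_sum] puts on the increment of stage [k]; the second
   makes what remains summable. *)
have e0 k : 0 < pw (2^-1 ^+ k.+2) * 2^-1 ^+ k.+2.
  by rewrite mulr_gt0 ?powR_gt0 ?normr_gt0 ?expf_neq0 ?exprn_gt0.
have mP k : measurable_fun setT (sep_fun k).
  by apply: continuous_measurable_fun; exact: sep_fun_continuous.
pose Q (kf : nat * (R -> R)) (sf : seq nat * (R -> R)) := bm kf.2 ->
    [/\ (0 < size sf.1)%N, bm sf.2,
    fam_bound q (fun t => sf.2 t - kf.2 t) (pw (2^-1 ^+ kf.1.+2) * 2^-1 ^+ kf.1.+2) &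
    forall t, sf.2 t != 0 -> kf.2 t != 0 /\
      th * `|sep_fun kf.1 t| <= sep_fun kf.1 t * avgcos sf.1 t].
have [nxt nxtP] : {nxt & forall kf, Q kf (nxt kf)}.
  apply: (@choice _ _ Q) => -[k f]; have [bf|nbf] := pselect (bm f); last first.
    by exists ([::], f).
  have [s [f' H]] := stageP f (sep_fun k) _ bf (mP k) (e0 k).
  by exists (s, f').
pose F := fix F k := if k is k'.+1 then (nxt (k', F k')).2 else cst 1.
have bF k : bm (F k).
  by elim: k => [|k IH]; [exact: bm_cst | have [] := nxtP (k, F k) IH].
exists F, (fun k => (nxt (k, F k)).1); split => // k;
by have [? ? ? ?] := nxtP (k, F k) (bF k).
Qed.

End Construction.

Section SmoothFunctions.
Context {R : realType}.
Implicit Types (f g : R -> R) (phi : R -> R[i]).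

Definition smooth f : Prop := per f /\ forall n t, derivable (derive1n n f) t 1.

Lemma per_derive1 f : per f -> (forall t : R, derivable f t 1) -> per (derive1 f).
Proof.
move=> pf df t; rewrite !derive1E.
have d1 : is_derive (t + 2 * pi) 1 f ('D_1 f (t + 2 * pi)) by exact: derivableP.
have d2 : is_derive t 1 (fun u : R => u + 2 * pi) 1.
  by apply: is_derive_eq; rewrite addr0.
have d3 := @is_derive1_comp R f (fun u : R => u + 2 * pi) t _ _ d1 d2.
have E : f \o (fun u : R => u + 2 * pi) = f by apply/funext => u /=; rewrite pf.
by rewrite E in d3; rewrite [RHS](@derive_val _ _ _ t 1 f _ d3) mulr1.
Qed.

Lemma smooth_per f n : smooth f -> per (derive1n n f).
Proof.
move=> [pf df]; elim: n => [//|n IH]; rewrite derive1nS.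
by apply: per_derive1 => // t; exact: df.
Qed.

Lemma smooth_is_derive f n (t : R) : smooth f ->
  is_derive t 1 (derive1n n f) (derive1n n.+1 f t).
Proof. by move=> [_ df]; rewrite derive1nS derive1E; exact: derivableP. Qed.

Lemma smooth_continuous f n : smooth f -> continuous (derive1n n f).
Proof.
move=> sf; apply: (@is_derive_continuous R _ (derive1n n.+1 f)) => t.
exact: smooth_is_derive.
Qed.

Lemma smooth_bm f n : smooth f -> bm (derive1n n f).
Proof.
by move=> sf; apply: bm_periodic; [exact: smooth_per|exact: smooth_continuous].
Qed.

Lemma test_functionP phi :
  test_function phi <-> smooth (re_part phi) /\ smooth (im_part phi).
Proof.
split=> [[pphi dphi]|[[p1 d1] [p2 d2]]].
  split; split=> [t|n t]; try by have [] := dphi n t.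
  - by rewrite /re_part pphi.
  - by rewrite /im_part pphi.
split=> [t|n t]; last by split; [exact: d1|exact: d2].
have := p1 t; have := p2 t; rewrite /re_part /im_part.
by case: (phi t) => a b; case: (phi (t + 2 * pi)) => a' b' /= -> ->.
Qed.

Lemma normr_re_normc (z : R[i]) : `|complex.Re z| <= normc z.
Proof.
case: z => a b /=; rewrite -sqrtr_sqr ler_wsqrtr// lerDl sqr_ge0//.
Qed.

Lemma normr_im_normc (z : R[i]) : `|complex.Im z| <= normc z.
Proof.
case: z => a b /=; rewrite -sqrtr_sqr ler_wsqrtr// lerDr sqr_ge0//.
Qed.

Lemma normc_le_add (z : R[i]) : normc z <= `|complex.Re z| + `|complex.Im z|.
Proof.
case: z => a b /=; rewrite -[leRHS]ger0_norm ?addr_ge0// -sqrtr_sqr ler_wsqrtr//.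
rewrite sqrrD !real_normK ?num_real// -addrA addrCA addrC -addrA lerD2l.
by rewrite lerDl mulrn_wge0// mulr_ge0.
Qed.

Lemma sup_norm_ge phi k t : test_function phi ->
  normc (cderiven k phi t) <= sup_norm (cderiven k phi).
Proof.
move=> /test_functionP[sr si].
have [A _ hA] := bm_ge0 (smooth_bm k sr); have [B _ hB] := bm_ge0 (smooth_bm k si).
apply: ub_le_sup; last by exists t.
exists (A + B) => _ [u _ <-]; rewrite (le_trans (normc_le_add _))//.
by apply: lerD; [exact: hA|exact: hB].
Qed.

Lemma sup_norm_ge0 phi k : test_function phi -> 0 <= sup_norm (cderiven k phi).
Proof.
move=> tphi; apply: le_trans (sup_norm_ge k 0 tphi).
exact: le_trans (normr_ge0 _) (normr_re_normc _).
Qed.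

End SmoothFunctions.

Section LimitDistribution.
Context {R : realType} (q : R) (q2 : 2 < q) (F : nat -> R -> R).
Context (F0 : F 0%N = cst 1) (bF : forall k, bm (F k)).
Context (dF : forall k, fam_bound q (fun t => F k.+1 t - F k t)
       (normpow q (2^-1 ^+ k.+2) * 2^-1 ^+ k.+2)).
Local Notation pw := (normpow q).

Definition limfun (f : R -> R) : R := limn (fun k => mean (fun t => F k t * f t)).

Lemma hart_step k n : `|hart (fun t => F k.+1 t - F k t) n| <= 2^-1 ^+ k.+2.
Proof.
have d0 : 0 < 2^-1 ^+ k.+2 :> R by rewrite exprn_gt0.
have h : pw (hart (fun t => F k.+1 t - F k t) n) <= pw (2^-1 ^+ k.+2).
  rewrite (le_trans (sb_le n (dF k)))// ger_pMr ?powR_gt0 ?normr_gt0 ?gt_eqF//.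
  by apply: exprn_ile1 => //; lra.
rewrite leNgt; apply/negP => hlt; move: h; rewrite leNgt => /negP; apply.
rewrite /normpow [`|2^-1 ^+ _|]ger0_norm ?(ltW d0)//; apply: gt0_ltr_powR => //.
- exact: lt_trans q2.
- by rewrite nnegrE ltW.
Qed.

(** By [mean_mul_le_hart] the increments pair with [f] to a geometric series of total [B0 + 4 * B2];
    the initial function 1 contributes a further [B0]. *)
Lemma limfun_smooth f (B0 B2 : R) : smooth f -> (forall t, `|f t| <= B0) ->
  (forall t, `|derive1n 2 f t| <= B2) ->
  cvgn (fun k => mean (fun t => F k t * f t)) /\ `|limfun f| <= 2 * B0 + 4 * B2.
Proof.
move=> sf fB0 fB2; have bf := smooth_bm 0 sf; rewrite derive1n0 in bf.
have b0 : 0 <= B0 := le_trans (normr_ge0 _) (fB0 0).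
have b2 : 0 <= B2 := le_trans (normr_ge0 _) (fB2 0).
have st k : `|mean (fun t => F k.+1 t * f t) - mean (fun t => F k t * f t)| <=
    (B0 + 4 * B2) * 2^-1 ^+ k.+1.
  rewrite -meanB; [|exact: bmM|exact: bmM].
  have -> : (fun t => F k.+1 t * f t - F k t * f t) = (fun t => (F k.+1 t - F k t) * f t).
    by apply/funext => t; rewrite mulrBl.
  have -> : (B0 + 4 * B2) * 2^-1 ^+ k.+1 = 2^-1 ^+ k.+2 * (2 * B0 + 8 * B2).
    by rewrite [in RHS]exprS; field.
  apply: (@mean_mul_le_hart R _ f (derive1n 1 f) (derive1n 2 f)).
  - by apply: bmB.
  - by case: sf.
  - exact: smooth_per.
  - exact: smooth_per.
  - by move=> t; exact: (smooth_is_derive 0 t sf).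
  - by move=> t; exact: smooth_is_derive.
  - exact: smooth_continuous.
  - exact: fB0.
  - exact: fB2.
  - by move=> n; exact: hart_step.
have [cv lim] := halving_cvg st; split => //.
have := lim 0%N; rewrite expr0 mulr1 F0 => h.
have m0 : `|mean (fun t => cst 1 t * f t)| <= B0.
  by apply: ler_norm_mean; [apply: bmM => //; exact: bm_cst|move=> t; rewrite mul1r].
rewrite /limfun -[limn _](subrK (mean (fun t => cst 1 t * f t))).
rewrite (le_trans (ler_normD _ _))// (le_trans (lerD h m0))//; lra.
Qed.

Lemma limfun_cvg f : smooth f -> cvgn (fun k => mean (fun t => F k t * f t)).
Proof.
move=> sf; have [B0 _ h0] := bm_ge0 (smooth_bm 0 sf).
have [B2 _ h2] := bm_ge0 (smooth_bm 2 sf).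
by have [] := limfun_smooth sf h0 h2.
Qed.

Lemma limfun_linear (a b : R) f g h : smooth f -> smooth g -> smooth h ->
  limfun (fun t => a * f t + b * g t + h t) = a * limfun f + b * limfun g + limfun h.
Proof.
move=> sf sg sh.
have bf := smooth_bm 0 sf; have bg := smooth_bm 0 sg; have bh := smooth_bm 0 sh.
rewrite !derive1n0 in bf bg bh.
have E : (fun k => mean (fun t => F k t * (a * f t + b * g t + h t))) =
  (fun k => a * mean (fun t => F k t * f t) + b * mean (fun t => F k t * g t) +
     mean (fun t => F k t * h t)).
  apply/funext => k; have bFf := bmM (bF k) bf; have bFg := bmM (bF k) bg.
  have bFh := bmM (bF k) bh.
  rewrite -!meanZ// -meanD; [|exact: bmZ|exact: bmZ].
  rewrite -meanD//; last by apply: bmD; exact: bmZ.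
  by congr mean; apply/funext => t; ring.
rewrite /limfun E; apply: cvg_lim => //.
apply: cvgD; last exact: limfun_cvg.
by apply: cvgD; apply: cvgM; [exact: cvg_cst|exact: limfun_cvg|exact: cvg_cst|exact: limfun_cvg].
Qed.

Definition limhart (n : int) : R := limn (fun k => hart (F k) n).

Lemma limhart_cvg n : cvgn (fun k => hart (F k) n) /\
  forall k, `|limhart n - hart (F k) n| <= 2^-1 * 2^-1 ^+ k.
Proof.
apply: halving_cvg => k; rewrite -hartB// -exprS; exact: hart_step.
Qed.

(** [F K] is [F 0] plus its increments, and [pw_sum] with the chosen error sizes bounds its
    coefficients in l^q independently of [K]. *)
Lemma limhart_sb : exists V, sb (fun n => pw (limhart n)) V.
Proof.
have [V0 _ hV0] := sb_pw_sqr_ex q2 (bessel (bF 0)).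
have p20 : 0 <= pw 2 by exact: pw_ge0.
pose x j n := if j is j'.+1 then hart (fun t => F j'.+1 t - F j' t) n else hart (F 0%N) n.
have xE K n : hart (F K) n = \sum_(j < K.+1) x j n.
  elim: K => [|K IH]; first by rewrite big_ord1.
  by rewrite big_ord_recr/= -IH hartB// addrC subrK.
have sbF K : sb (fun n => pw (hart (F K) n)) (pw 2 * V0 + 1).
  pose W j := if j is j'.+1 then pw (2^-1 ^+ j'.+2) * 2^-1 ^+ j'.+2 else V0 : R.
  have xW j : sb (fun n => pw (x j n)) (W j) by case: j => [|j]; [exact: hV0|exact: dF].
  apply: (@sb_mono _ _ (fun n => \sum_(j < K.+1) pw (2 ^+ j.+1) * pw (x j n))
     (\sum_(j < K.+1) pw (2 ^+ j.+1) * W j)).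
  - by move=> n; rewrite xE; exact: (@pw_sum _ _ q2 _ (x^~ n)).
  - rewrite big_ord_recl/= expr1 lerD2l.
    have -> : \sum_(i < K) pw (2 ^+ (bump 0 i).+1) * (pw (2^-1 ^+ i.+2) * 2^-1 ^+ i.+2) =
       \sum_(i < K) 2^-1 ^+ i.+2.
      apply: eq_bigr => i _; rewrite mulrA -pwM// -exprMn mulfV// expr1n.
      by rewrite /normpow normr1 powR1 mul1r.
    have -> : \sum_(i < K) 2^-1 ^+ i.+2 = 2^-1 - 2^-1 ^+ K.+1 :> R.
      elim: K => [|K IH]; first by rewrite big_ord0 expr1 subrr.
      rewrite big_ord_recr/= IH [2^-1 ^+ K.+2]exprS; move: (_ ^+ K.+1) => z; lra.
    have : 0 <= 2^-1 ^+ K.+1 :> R by rewrite exprn_ge0.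
    lra.
  - move=> s us; rewrite exchange_big; apply: ler_sum => j _ /=.
    by rewrite -mulr_sumr ler_wpM2l ?pw_ge0// xW.
exists (pw 2 * (pw 2 * V0 + 1 + 1)) => s us.
(* Replacing the limit by stage [K] costs at most [2^-1 ^+ K] per index before the factor [pw 2],
   and [size s * 2^-1 ^+ size s <= 1] whatever [s] is. *)
pose K := size s.
apply: (@le_trans _ _ (\sum_(n <- s) pw 2 * (pw (hart (F K) n) + 2^-1 ^+ K))).
  apply: ler_sum => n _; have [_ /(_ K) h] := limhart_cvg n.
  have -> : limhart n = hart (F K) n + (limhart n - hart (F K) n) by rewrite addrC subrK.
  rewrite (le_trans (pwD q2 _ _))// ler_wpM2l// lerD2l.
  have k1 : 2^-1 ^+ K <= 1 :> R by apply: exprn_ile1 => //; lra.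
  have k0 : 0 <= 2^-1 ^+ K :> R by rewrite exprn_ge0.
  have h' : `|limhart n - hart (F K) n| <= 2^-1 ^+ K by lra.
  rewrite (le_trans (pw_le_sqr q2 (le_trans h' k1)))//.
  rewrite -[leLHS]real_normK ?num_real// expr2 -[leRHS]mulr1 ler_pM//.
  exact: le_trans h' k1.
rewrite -mulr_sumr ler_wpM2l// big_split/= lerD ?sbF//.
rewrite big_const_seq count_predT iter_addr_0 -/K -[leLHS]mulr_natr exprVn.
rewrite mulrC ler_pdivrMr ?exprn_gt0// mul1r -natrX ler_nat ltnW// ltn_expl//.
Qed.

Lemma limfun_cos (n : int) :
  limfun (fun t => cos (n%:~R * t)) = (limhart n + limhart (- n)) / 2.
Proof.
apply: cvg_lim => //.
under eq_fun do rewrite mean_mul_cos//.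
apply: cvgM; last exact: cvg_cst.
by apply: cvgD; [have [] := limhart_cvg n|have [] := limhart_cvg (- n)].
Qed.

Lemma limfun_sin (n : int) :
  limfun (fun t => sin (n%:~R * t)) = (limhart n - limhart (- n)) / 2.
Proof.
apply: cvg_lim => //.
have E k : mean (fun t => F k t * sin (n%:~R * t)) = (hart (F k) n - hart (F k) (- n)) / 2.
  have b m : bm (fun t => F k t * cas (m%:~R * t)) by apply: bmM => //; exact: bm_cas.
  rewrite mulrC /hart -meanB// -meanZ; last exact: bmB.
  by congr mean; apply/funext => t; rewrite mulrNz mulNr /cas cosN sinN; field.
under eq_fun do rewrite E.
apply: cvgM; last exact: cvg_cst.
by apply: cvgB; [have [] := limhart_cvg n|have [] := limhart_cvg (- n)].
Qed.

Definition limdist (phi : R -> R[i]) : R[i] :=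
  Complex (limfun (re_part phi)) (limfun (im_part phi)).

Lemma limdist_distribution : schwartz_distribution limdist.
Proof.
split=> [a phi psi /test_functionP[pr pim] /test_functionP[sr si]|].
  rewrite /limdist; case: a => x y.
  have -> : re_part (fun t => Complex x y * phi t + psi t) =
     (fun t => x * re_part phi t + (- y) * im_part phi t + re_part psi t).
    apply/funext => t; rewrite /re_part /im_part; case: (phi t) => ? ?; case: (psi t) => ? ? /=.
    by rewrite mulNr.
  have -> : im_part (fun t => Complex x y * phi t + psi t) =
     (fun t => x * im_part phi t + y * re_part phi t + im_part psi t).
    by apply/funext => t; rewrite /re_part /im_part; case: (phi t) => ? ?; case: (psi t) => ? ?.
  rewrite !limfun_linear//; congr Complex => //=.
  by rewrite mulNr.
(* The real and the imaginary part each contribute twice the norm of order 0 and four times that of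
   order 2. *)
exists 2%N, 8 => phi tphi; have [sr si] := (test_functionP phi).1 tphi.
pose s k := sup_norm (cderiven k phi).
have s0 k : 0 <= s k by exact: sup_norm_ge0.
have hr k t : `|derive1n k (re_part phi) t| <= s k.
  by apply: le_trans (sup_norm_ge k t tphi); exact: (normr_re_normc (cderiven k phi t)).
have hi k t : `|derive1n k (im_part phi) t| <= s k.
  by apply: le_trans (sup_norm_ge k t tphi); exact: (normr_im_normc (cderiven k phi t)).
have [_ h1] := limfun_smooth sr (hr 0%N) (hr 2%N).
have [_ h2] := limfun_smooth si (hi 0%N) (hi 2%N).
rewrite (le_trans (normc_le_add _))// (le_trans (lerD h1 h2))//.
rewrite !big_ord_recr big_ord0/= -/(s 0%N) -/(s 1%N) -/(s 2%N).
move: (s0 0%N) (s0 1%N) (s0 2%N); move: (s 0%N) (s 1%N) (s 2%N) => x y z; lra.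
Qed.

Lemma smooth_cst (c : R) : smooth (cst c).
Proof.
split=> // n t; have -> : derive1n n (cst c) = cst (if n is 0%N then c else 0) :> (R -> R).
  elim: n => [//|n IH]; rewrite derive1nS IH; apply/funext => u.
  by rewrite derive1_cst.
exact: derivable_cst.
Qed.

(** Tested on the constant 1: [F 0] has mean 1 and all later changes of the mean add up to at most
    [1 / 2]. *)
Lemma limdist_nonzero : nonzero_distribution limdist.
Proof.
exists (cst 1).
  by apply/test_functionP; split; exact: smooth_cst.
apply/eqP => /(congr1 (@complex.Re R)) /= h.
have [_ /(_ 0%N)] := limhart_cvg 0.
have E k : hart (F k) 0 = mean (fun t => F k t * 1).
  by congr mean; apply/funext => t; rewrite mul0r /cas cos0 sin0 addr0.
rewrite /limhart; under eq_fun do rewrite E.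
rewrite -/(limfun (cst 1)); rewrite -/(re_part (cst 1)) in h.
have -> : limfun (cst 1) = 0 by exact: h.
rewrite E F0; under eq_fun do rewrite mul1r.
by rewrite mean_cst sub0r normrN normr1 expr0 mulr1; lra.
Qed.

Lemma ell_of_sb (c : int -> R[i]) (p V : R) : sb (fun n => normc (c n) `^ p) V -> ell p c.
Proof.
move=> cV; rewrite /ell; apply: (@le_lt_trans _ _ V%:E); last exact: ltry.
apply: ge_ereal_sup => _ [A [finA _] <-].
rewrite fsbig_finite//= sumEFin lee_fin.
exact: cV (finmap.fset_uniq _).
Qed.

Lemma limdist_ell : ell q (dist_fourier limdist).
Proof.
have [V hV] := limhart_sb.
have E n : dist_fourier limdist n =
    Complex ((limhart n + limhart (- n)) / 2) ((limhart (- n) - limhart n) / 2).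
  rewrite /dist_fourier /limdist.
  rewrite (_ : re_part (expi (- n)) = (fun t => cos ((- n)%:~R * t)))//.
  rewrite (_ : im_part (expi (- n)) = (fun t => sin ((- n)%:~R * t)))//.
  by rewrite limfun_cos limfun_sin opprK addrC.
apply: (@ell_of_sb _ _ (pw 2 * (V + V))).
apply: (@sb_mono _ _ (fun n => pw 2 * (pw (limhart n) + pw (limhart (- n)))) (pw 2 * (V + V))) => //.
  move=> n; rewrite E; set z := Complex _ _.
  have zle : `|normc z| <= `| `|limhart n| + `|limhart (- n)| |.
    rewrite ger0_norm; last exact: le_trans (normr_ge0 _) (normr_re_normc _).
    rewrite ger0_norm ?addr_ge0// (le_trans (normc_le_add _))//=.
    rewrite !normrM [`|2^-1|]ger0_norm//.
    have := ler_normD (limhart n) (limhart (- n)).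
    have := ler_normB (limhart (- n)) (limhart n).
    lra.
  have -> : normc z `^ q = pw (normc z).
    by rewrite /normpow ger0_norm//; exact: le_trans (normr_ge0 _) (normr_re_normc _).
  rewrite (le_trans (le_pw q2 zle))// (le_trans (pwD q2 _ _))//.
  by rewrite /normpow !normr_id.
apply: sbZ; first exact: pw_ge0.
apply: sbD; first exact: hV.
exact: (@sb_comp R (fun n => - n) (fun n => pw (limhart n)) V oppr_inj hV).
Qed.

End LimitDistribution.

Section Support.
Context {R : realType}.

Lemma compact_avoid (A : set R) (G : nat -> set R) : compact A ->
  (forall k, closed (G k)) -> A `&` \bigcap_k G k = set0 ->
  exists k0 : nat, forall t, A t -> exists2 k, (k < k0)%N & ~ G k t.
Proof.
move=> cA cG AG; move: cA; rewrite compact_cover => cA.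
have [|t At|D _ DP] := cA nat setT (fun k => ~` G k).
- by move=> k _; exact: closed_openC.
- apply: contrapT => h; have : (A `&` \bigcap_k G k) t.
    by split => // k _; apply: contrapT => nG; apply: h; exists k.
  by rewrite AG.
exists (\max_(k <- finmap.enum_fset D) k.+1)%N => t /DP [k /= kD nG].
by exists k => //; rewrite (big_rem k)//= leq_maxl.
Qed.

(** By compactness finitely many of the [G k] already exclude every point of the support of a test
    function that avoids the intersection. [F k] vanishes off [G j] for all [j < k], so its product
    with that test function is 0 from some stage on. *)
Lemma limdist_supports (F : nat -> R -> R) (G : nat -> set R) :
  (forall k t, F k.+1 t != 0 -> F k t != 0 /\ G k t) ->
  (forall k, closed (G k)) -> (forall k t, G k (t + 2 * pi) <-> G k t) ->
  supports (\bigcap_k G k) (limdist F).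
Proof.
move=> FG cG pG t tS; apply: contrapT => nK.
apply: (tS (~` \bigcap_k G k)) => //.
  split; last by apply: closed_openC; exact: closed_bigI.
  move=> u; split=> h Gu; apply: h => k _; [by apply/pG; exact: Gu|by apply/(pG k u); exact: Gu].
move=> phi tphi sphi.
have FG' k : forall k' u, (k' < k)%N -> F k u != 0 -> G k' u.
  elim: k => [//|k IH] k' u; rewrite ltnS leq_eqVlt => /predU1P[->|kk] /FG[Fk Gk] //.
  exact: IH.
have [k0 k0P] : exists k0 : nat, forall u, (`[0, 2 * pi]%classic `&` fun_support phi) u ->
    exists2 k, (k < k0)%N & ~ G k u.
  apply: compact_avoid => //.
    apply: compact_closedI; first exact: segment_compact.
    exact: closed_closure.
  by apply/seteqP; split => // u [[_ su] Gu]; exact: (sphi u su).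
have zero (f : R -> R) : (forall u, f u != 0 -> phi u != 0) -> limfun F f = 0.
  move=> fphi; apply: cvg_lim => //; apply: cvg_near_cst.
  near=> k; have kk : (k0 <= k)%N by near: k; exact: nbhs_infty_ge.
  rewrite -[RHS](mean_cst 0); apply: eq_mean_on => u u2.
  have [->|fu] := eqVneq (f u) 0; first by rewrite mulr0.
  have [j jk0 nGj] : exists2 k, (k < k0)%N & ~ G k u.
    apply: k0P; split; first by rewrite /= in_itv.
    by apply: subset_closure; exact: fphi.
  have [->|Fu] := eqVneq (F k u) 0; first by rewrite mul0r.
  by exfalso; apply: nGj; apply: (FG' k) => //; exact: leq_trans kk.
rewrite /limdist !zero// => u; apply: contra => /eqP; rewrite /re_part /im_part.
  by move=> ->.
by move=> ->.
Unshelve. all: by end_near.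
Qed.

End Support.

(** * The Helson property *)

Section Separation.
Context {R : realType}.

(** The indicator of [K] is a periodic function, to which [per_int] applies. *)
Lemma per_set_int (K : set R) : (forall t, K (t + 2 * pi) <-> K t) ->
  forall (k : int) t, K (t + k%:~R * (2 * pi)) <-> K t.
Proof.
move=> pK k t; have h : per (fun t : R => (`[< K t >])%:R : R).
  by move=> s; congr (_%:R); congr nat_of_bool; apply/asbool_equiv_eq/pK.
have /eqP := per_int k t h; rewrite eqr_nat.
by case: asboolP => k1; case: asboolP => k2.
Qed.

(** The rational centre is within [e / 4] of [t], and the level lies between [cos (e / 2)] and
    [cos (e / 4)]; so [t] is inside the arc, and every point of the arc is within [3 e / 4] of [t]
    modulo the period. The arc is closed in the second clause, which later gives a strict sign
    outside it. *)
Lemma rational_disc (t d : R) : 0 < d -> exists p : rat * rat,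
  ratr p.2 < cos (t - ratr p.1) /\
  forall b, ratr p.2 <= cos (b - ratr p.1) ->
    exists k : int, `|b + k%:~R * (2 * pi) - t| < d.
Proof.
move=> d0; have p2 := @pi_ge2 R.
pose e := Num.min d 1.
have e0 : 0 < e by rewrite lt_min d0 ltr01.
have e1 : e <= 1 by rewrite ge_min lexx orbT.
have ed : e <= d by rewrite ge_min lexx.
have [a] : exists a : rat, ratr a \in `]t - e / 4, t + e / 4[.
  by apply: rat_in_itvoo; lra.
rewrite in_itv/= => /andP[a1 a2].
have c42 : cos (e / 2) < cos (e / 4) :> R.
  by rewrite ltr_cos ?in_itv/=; [lra|apply/andP; split; lra|apply/andP; split; lra].
have [r] : exists r : rat, ratr r \in `]cos (e / 2), (cos (e / 4) : R)[.
  exact: rat_in_itvoo.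
rewrite in_itv/= => /andP[r1 r2].
exists (a, r); split => /=.
  rewrite (lt_trans r2)// -(cos_norm (t - ratr a)).
  have h : `|t - ratr a| < e / 4 by rewrite ltr_norml; apply/andP; split; lra.
  have h0 := normr_ge0 (t - ratr a).
  by move: h h0; move: `|_| => x h h0; rewrite ltr_cos ?in_itv/= //; apply/andP; split; lra.
move=> b rb; have [k /andP[k1 k2]] := mod_2pi (ratr a - pi) b.
exists k; set b' := b + _ in k1 k2 *.
have cb : cos (b - ratr a) = cos (b' - ratr a) :> R.
  rewrite /b' (_ : b + k%:~R * (2 * pi) - ratr a = (b - ratr a) + k%:~R * (2 * pi)); last by ring.
  by rewrite (@per_int R cos)//; exact: cos_2pi_periodic.
have v : `|b' - ratr a| <= pi by rewrite ler_norml; apply/andP; split; lra.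
have : cos (e / 2) < cos `|b' - ratr a|.
  by rewrite cos_norm -cb (lt_le_trans r1).
rewrite ltr_cos ?in_itv/= ?v ?normr_ge0//; last by apply/andP; split; lra.
rewrite ltr_norml => /andP[v1 v2].
rewrite ltr_norml; apply/andP; split; lra.
Qed.

Lemma cos_max_fun_ge (l : seq (rat * rat)) p t : p \in l ->
  cos (t - ratr p.1) - ratr p.2 <= cos_max_fun l t :> R.
Proof.
elim: l => [//|p' l IH]; rewrite inE => /predU1P[->|pl] /=; first by rewrite le_max lexx.
by rewrite le_max IH ?orbT.
Qed.

Lemma cos_max_fun_lt0 (l : seq (rat * rat)) (t : R) :
  (forall p, p \in l -> cos (t - ratr p.1) < ratr p.2) -> cos_max_fun l t < 0.
Proof.
elim: l => [_|p l IH H] /=; first by rewrite ltrN10.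
rewrite gt_max subr_lt0 H ?mem_head//= IH// => p' pl.
by apply: H; rewrite inE pl orbT.
Qed.

Lemma within_continuous_dist (K : set R) (u : R -> R) (t a : R) :
  {within K, continuous u} -> K t -> 0 < a ->
  exists2 d : R, 0 < d & forall s, K s -> `|s - t| < d -> `|u s - u t| < a.
Proof.
move=> /subspace_continuousP cu Kt a0.
have /cvgrPdist_lt/(_ _ a0) [d/= d0 dP] := cu t Kt.
exists d => // s Ks st; rewrite distrC; apply: dP => //=.
by rewrite distrC.
Qed.

(** [K] is covered by finitely many arcs, on each of which [u] differs from its value at the
    reference point by less than [a], and the arcs with a positive reference value are kept. A point
    with [u >= a] lies in a kept arc, and a point with [u <= - a] in none. *)
Lemma separation (K : set R) (u : R -> R) (a : R) : closed K ->
  (forall t, K (t + 2 * pi) <-> K t) -> per u -> {within K, continuous u} -> 0 < a ->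
  exists k, forall t, K t ->
    (a <= u t -> 0 < sep_fun k t) /\ (u t <= - a -> sep_fun k t < 0).
Proof.
move=> cK pK pu cu a0.
have pKi := per_set_int pK.
have [d dP] : {d : R -> R & forall t, K t -> 0 < d t /\
    forall s, K s -> `|s - t| < d t -> `|u s - u t| < a}.
  apply: (@choice _ _ (fun t d => K t -> 0 < d /\
    forall s, K s -> `|s - t| < d -> `|u s - u t| < a)) => t.
  have [Kt|nK] := pselect (K t); last by exists 0.
  by have [d d0 dP] := within_continuous_dist cu Kt a0; exists d.
have [p pP] : {p : R -> rat * rat & forall t, K t -> ratr (p t).2 < cos (t - ratr (p t).1) /\
    forall b, K b -> ratr (p t).2 <= cos (b - ratr (p t).1) -> `|u b - u t| < a}.
  apply: (@choice _ _ (fun t p => K t -> ratr p.2 < cos (t - ratr p.1) /\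
    forall b, K b -> ratr p.2 <= cos (b - ratr p.1) -> `|u b - u t| < a)) => t.
  have [Kt|nK] := pselect (K t); last by exists (0, 0).
  have [d0 dtP] := dP t Kt.
  have [p [p1 p2]] := rational_disc t d0; exists p => _; split => // b Kb /p2[k bk].
  by rewrite -(per_int k b pu); apply: dtP => //; apply/pKi.
have : compact (`[0, 2 * pi]%classic `&` K).
  by apply: compact_closedI => //; exact: segment_compact.
rewrite compact_cover => cA.
have [|t [t2 Kt]|D DK DP] := cA R K (fun t => [set s | ratr (p t).2 < cos (s - ratr (p t).1)]).
- move=> t _; pose f s : R := cos (s - ratr (p t).1).
  have cf : continuous f.
    apply: (@cos_comp_continuous _ (fun s => s - ratr (p t).1)) => s.
    by apply: cvgB; [exact: cvg_id|exact: cvg_cst].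
  rewrite (_ : [set s | _] = f @^-1` [set x | ratr (p t).2 < x])//.
  by apply: open_comp; [move=> s _; exact: cf|exact: open_gt].
- by exists t => //; have [] := pP t Kt.
pose l := [seq p t | t <- finmap.enum_fset D & 0 < u t].
exists (pickle l) => t Kt; rewrite /sep_fun pickleK; split=> ut.
  have [k /andP[k0 k1]] := mod_2pi 0 t.
  set s := t + k%:~R * (2 * pi) in k0 k1.
  have Ks : K s by apply/pKi.
  have us : u s = u t by rewrite /s per_int.
  have [|r /= rD rs] := DP s.
    by split => //=; rewrite in_itv/= k0 ltW// -[X in _ < X]add0r.
  have Kr : K r by have := DK r rD; rewrite inE.
  have [_ /(_ s Ks (ltW rs))] := pP r Kr; rewrite us ltr_norml => /andP[h1 h2].
  have cs : cos (s - ratr (p r).1) = cos (t - ratr (p r).1) :> R.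
    rewrite /s (_ : t + k%:~R * (2 * pi) - ratr (p r).1 = (t - ratr (p r).1) + k%:~R * (2 * pi)); last by ring.
    by rewrite (@per_int R cos)//; exact: cos_2pi_periodic.
  apply: (@lt_le_trans _ _ (cos (t - ratr (p r).1) - ratr (p r).2)).
    by rewrite subr_gt0 -cs.
  apply: cos_max_fun_ge; apply: map_f; rewrite mem_filter rD andbT; lra.
apply: cos_max_fun_lt0 => q /mapP[r]; rewrite mem_filter => /andP[ur rD] ->.
have Kr : K r by have := DK r rD; rewrite inE.
rewrite ltNge; apply/negP => h.
have [_ /(_ t Kt h)] := pP r Kr; rewrite ltr_norml => /andP[h1 h2]; lra.
Qed.

Lemma within_bounded (K : set R) (u : R -> R) : closed K ->
  (forall t, K (t + 2 * pi) <-> K t) -> per u -> {within K, continuous u} ->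
  exists2 C : R, 0 < C & forall t, K t -> `|u t| <= C.
Proof.
move=> cK pK pu cu.
have pKi := per_set_int pK.
have cA : compact (`[0, 2 * pi]%classic `&` K).
  by apply: compact_closedI => //; exact: segment_compact.
have cu' : {within `[0, 2 * pi]%classic `&` K, continuous u}.
  by apply: continuous_subspaceW cu; exact: subIsetr.
have [M [_ MP]] := compact_bounded (continuous_compact cu' cA).
exists (`|M| + 1); first by rewrite ltr_wpDl.
move=> t Kt; have [k /andP[k0 k1]] := mod_2pi 0 t.
rewrite -(per_int k t pu); apply: MP; first by rewrite (le_lt_trans (ler_norm _))// ltrDl.
exists (t + k%:~R * (2 * pi)) => //; split; last by apply/pKi.
by rewrite /= in_itv/= k0 ltW// -[X in _ < X]add0r.
Qed.

End Separation.

(** * Cosine series with nonnegative summable coefficients *)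

Section CosineSeries.
Context {R : realType}.
Implicit Types (x : nat -> R).

(** The coefficients of [avgcos s] as a cosine polynomial; counting allows for repeated
    frequencies. *)
Definition freq (s : seq nat) (n : nat) : R := (count_mem n s)%:R / (size s)%:R.

Lemma freq_ge0 s n : 0 <= freq s n.
Proof. by rewrite divr_ge0. Qed.

Lemma sum_freq_le1 s D : \sum_(n < D) freq s n <= 1.
Proof.
rewrite -mulr_suml; case: s => [|m s]; first by rewrite invr0 mulr0.
rewrite ler_pdivrMr ?ltr0n// mul1r -natr_sum ler_nat.
elim: (m :: s) => [|k l IH]; first by rewrite big1.
rewrite /= (leq_trans _ (_ : (1 + size l <= _)%N))// big_split/= leq_add//.
rewrite (eq_bigr (fun n : 'I_D => if k == n then 1%N else 0%N)); last by move=> n _; case: eqP.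
rewrite -big_mkcond/= sum1_card; apply: (@leq_trans #|[pred n : 'I_D | n \in [pred n : 'I_D | k == n]]|) => //.
have [kD|kD] := ltnP k D.
  rewrite (fintype.eq_card1 (x := Ordinal kD))// => n; rewrite !inE.
  by apply/eqP/eqP => [E|->//]; apply: val_inj.
rewrite eq_card0// => n; rewrite !inE; apply/negbTE/eqP => E.
by move: (ltn_ord n); rewrite -E ltnNge kD.
Qed.

Lemma avgcos_freq s D t : (forall n, n \in s -> (n < D)%N) ->
  avgcos s t = \sum_(n < D) freq s n * cosn n t.
Proof.
move=> sD; rewrite /avgcos /freq.
under [RHS]eq_bigr do rewrite mulrAC.
rewrite -mulr_suml; congr (_ / _).
elim: s sD => [|m s IH] sD; first by rewrite big_nil big1// => n _; rewrite mul0r.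
rewrite big_cons IH; last by move=> n ns; apply: sD; rewrite inE ns orbT.
under [RHS]eq_bigr do rewrite /= natrD mulrDl.
rewrite big_split/=; congr (_ + _).
have mD : (m < D)%N by apply: sD; rewrite mem_head.
rewrite (bigD1 (Ordinal mD))//= eqxx mul1r big1 ?addr0// => n nm.
suff /negPf -> : m != n by rewrite mul0r.
by apply: contra nm => /eqP E; apply/eqP; apply: val_inj.
Qed.

Lemma cosine_series (K : set R) (th : R) (nu : nat -> seq nat) (u : R -> R) :
  0 < th <= 1 -> K = good_set th nu -> per u -> {within K, continuous u} ->
  exists (x : nat -> R) (X : R), [/\ forall n, 0 <= x n,
    forall D, \sum_(n < D) x n <= X &
    forall t, K t -> (fun D => \sum_(n < D) x n * cosn n t) @ \oo --> u t].
Proof.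
move=> /andP[th0 th1] KE pu cu.
have pK t : K (t + 2 * pi) <-> K t.
  rewrite KE; split=> h k _; [apply/(good_per th nu k t)|apply/good_per]; exact: h.
have cK : closed K by rewrite KE; apply: closed_bigI => k _; exact: good_closed.
have [C C0 uC] := within_bounded cK pK pu cu.
pose rho := 1 - th / 4.
have rho01 : 0 <= rho < 1 by rewrite /rho; apply/andP; split; lra.
have rho0 k : 0 <= rho ^+ k by rewrite exprn_ge0//; case/andP: rho01.
pose a j := C * rho ^+ j / 4.
have a0 j : 0 <= a j by rewrite divr_ge0// mulr_ge0// ltW.
pose ok (j : nat) (v : R -> R) := [/\ per v, {within K, continuous v} &
   forall t, K t -> `|v t| <= C * rho ^+ j].
pose Q (jv : nat * (R -> R)) (k : nat) := ok jv.1 jv.2 ->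
  ok jv.1.+1 (fun t => jv.2 t - a jv.1 * avgcos (nu k) t).
have [nxt nxtP] : {nxt & forall jv, Q jv (nxt jv)}.
  apply: (@choice _ _ Q) => -[j v].
  have [okv|nok] := pselect (ok j v); last by exists 0%N.
  have [pv cv vC] := okv.
  have crho : 0 < C * rho ^+ j by rewrite mulr_gt0// exprn_gt0// /rho; lra.
  have c10 : 0 < C * rho ^+ j / 10 by rewrite divr_gt0.
  have [k kP] := separation cK pK pv cv c10.
  exists k => _; split => /=.
  - by move=> t; rewrite pv avgcos_per.
  - move=> t; apply: cvgB; first exact: cv.
    apply: cvgM; first exact: cvg_cst.
    by apply: continuous_subspaceT; exact: avgcos_continuous.
  - move=> t Kt; have [k1 k2] := kP t Kt; have := vC t Kt.
    have gt : good th nu k t by move: Kt; rewrite KE; apply.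
    have := avgcos_le1 (nu k) t; move: gt k1 k2; rewrite /good/= /a.
    have -> : C * rho ^+ j.+1 = C * rho ^+ j * rho by rewrite exprSr mulrA.
    move: (C * rho ^+ j) crho => c c0'; move: (avgcos _ _) (sep_fun _ _) (v t) => g P y.
    rewrite !ler_norml /rho => hg k1 k2 /andP[g1 g2] /andP[y1 y2].
    (* Subtracting [c * g / 4] lowers a value above [c / 10] by at least [th * c / 4] and at most
       [c / 4], so it cannot overshoot below [- rho * c]; the negative case is symmetric. In
       between, the result stays below [c / 10 + c / 4], and [rho >= 3 / 4]. *)
    have [yc|yc] := leP (c / 10) y.
      have P0 := k1 yc; move: hg; rewrite gtr0_norm// mulrC ler_pM2l// => hg.
      apply/andP; split; nra.
    have [yc'|yc'] := leP y (- (c / 10)).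
      have P0 := k2 yc'; move: hg; rewrite ltr0_norm// mulrN -mulNr mulrC.
      rewrite (ler_nM2l P0) => hg.
      apply/andP; split; nra.
    apply/andP; split; nra.
pose v := fix v j : R -> R := if j is j'.+1
  then (fun t => v j' t - a j' * avgcos (nu (nxt (j', v j'))) t) else u.
pose s j := nu (nxt (j, v j)).
have vok j : ok j (v j).
  elim: j => [|j IH]; last exact: (nxtP (j, v j)).
  by split => // t Kt; rewrite expr0 mulr1; exact: uC.
have vE J t : v J t = u t - \sum_(j < J) a j * avgcos (s j) t.
  elim: J => [|J IH] /=; first by rewrite big_ord0 subr0.
  by rewrite IH big_ord_recr/= opprD addrA.
pose XJ J n := \sum_(j < J) a j * freq (s j) n.
(* The tail sum of the [a j] from [J] on, since [1 - rho = th / 4]. *)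
pose w J := C / th * rho ^+ J.
have w0 : w @ \oo --> (0 : R) by exact: geometric_cvg0.
have wa J : w J - w J.+1 = a J.
  rewrite /w /a exprS /rho; move: (_ ^+ J) => z; field; lra.
have sumX D J : `|\sum_(n < D) XJ J.+1 n - \sum_(n < D) XJ J n| <= w J - w J.+1.
  rewrite wa -sumrB (eq_bigr (fun n : 'I_D => a J * freq (s J) n)); last first.
    by move=> n _; rewrite /XJ big_ord_recr/= addrAC subrr add0r.
  rewrite -mulr_sumr normrM (ger0_norm (a0 J)) -[leRHS]mulr1 ler_wpM2l//.
  by rewrite ger0_norm ?sum_freq_le1// sumr_ge0// => n _; exact: freq_ge0.
pose x n := limn (fun J => XJ J n).
have XJ0 J n : 0 <= XJ J n.
  by apply: sumr_ge0 => j _; rewrite mulr_ge0 ?freq_ge0.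
have xcv n : cvgn (fun J => XJ J n) /\ forall J, `|x n - XJ J n| <= w J.
  apply: telescoping_cvg => // J; rewrite wa /XJ big_ord_recr/= addrAC subrr add0r.
  rewrite normrM (ger0_norm (a0 J)) -[leRHS]mulr1 ler_wpM2l//.
  rewrite ger0_norm ?freq_ge0// (le_trans _ (sum_freq_le1 (s J) n.+1))//.
  by rewrite big_ord_recr/= lerDr sumr_ge0// => i _; exact: freq_ge0.
have XJmono J J' n : (J <= J')%N -> XJ J n <= XJ J' n.
  move=> /subnK <-; rewrite addnC /XJ big_split_ord/= lerDl sumr_ge0// => j _.
  by rewrite mulr_ge0 ?freq_ge0.
have XJx J n : XJ J n <= x n.
  have [cv _] := xcv n; apply: limr_ge => //.
  by near=> J'; apply: XJmono; near: J'; exact: nbhs_infty_ge.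
have sumx D J : \sum_(n < D) x n - \sum_(n < D) XJ J n <= w J.
  have [cv /(_ J) h] := telescoping_cvg (sumX D) w0.
  have E : limn (fun J => \sum_(n < D) XJ J n) = \sum_(n < D) x n.
    apply: cvg_lim => //; elim: (D) => [|D' IH].
      by rewrite big_ord0; under eq_fun do rewrite big_ord0; exact: cvg_cst.
    rewrite big_ord_recr/=; under eq_fun do rewrite big_ord_recr/=.
    by apply: cvgD => //; have [] := xcv D'.
  by move: h; rewrite E; exact: le_trans (ler_norm _).
exists x, (w 0%N); split.
- by move=> n; exact: le_trans (XJ0 0%N n) (XJx _ _).
- move=> D; have := sumx D 0%N; rewrite [X in _ - X]big1 ?subr0// => n _.
  by rewrite /XJ big_ord0.
move=> t Kt; apply/cvgrPdist_le => e e0.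
have /cvgrPdist_le/(_ (e / 2)) := w0; rewrite divr_gt0// => /(_ isT) h1.
have /cvgrPdist_le/(_ (e / 2)) := geometric_cvg0 C rho01; rewrite divr_gt0// => /(_ isT) h2.
have [J [wJ CJ]] : exists J, w J <= e / 2 /\ C * rho ^+ J <= e / 2.
  have [J _ JP] := filterI h1 h2; exists J; have [] := JP J (leqnn J).
  by rewrite !sub0r !normrN => wJ CJ; split; [exact: le_trans (ler_norm _) wJ|exact: le_trans (ler_norm _) CJ].
(* Beyond every frequency of the first [J] averages, so that these are fully expanded within the
   range [D]. *)
pose D0 := (\max_(j < J) \max_(n <- s j) n.+1)%N.
near=> D; have D0D : (D0 <= D)%N by near: D; exact: nbhs_infty_ge.
have E : \sum_(j < J) a j * avgcos (s j) t = \sum_(n < D) XJ J n * cosn n t.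
  transitivity (\sum_(j < J) \sum_(n < D) a j * freq (s j) n * cosn n t).
    apply: eq_bigr => j _; rewrite (@avgcos_freq (s j) D).
      by rewrite mulr_sumr; apply: eq_bigr => n _; rewrite mulrA.
    move=> n ns; apply: leq_trans D0D.
    rewrite /D0 (bigD1 j)//= leq_max; apply/orP; left.
    by rewrite (big_rem n)//= leq_maxl.
  by rewrite exchange_big; apply: eq_bigr => n _; rewrite /XJ mulr_suml.
have -> : u t - \sum_(n < D) x n * cosn n t =
   v J t - \sum_(n < D) (x n - XJ J n) * cosn n t.
  rewrite vE E; under [X in _ = _ - X]eq_bigr do rewrite mulrBl.
  by rewrite sumrB; ring.
have [_ _ /(_ t Kt) vJ] := vok J.
have hs : `|\sum_(n < D) (x n - XJ J n) * cosn n t| <= e / 2.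
  rewrite (le_trans (ler_norm_sum _ _ _))//.
  apply: (@le_trans _ _ (\sum_(n < D) (x n - XJ J n))).
    apply: ler_sum => n _; rewrite normrM ger0_norm ?subr_ge0//.
    by rewrite ler_piMr ?subr_ge0// cosn_le1.
  by rewrite sumrB; exact: le_trans (sumx D J) wJ.
rewrite (le_trans (ler_normB _ _))// (le_trans (lerD (le_trans vJ CJ) hs))//.
by rewrite -splitr.
Unshelve. all: by end_near.
Qed.

Definition cos_sum (x : nat -> R) (t : R) : R := limn (fun D => \sum_(n < D) x n * cosn n t).

Lemma cos_sum_uniform x (X : R) : (forall n, 0 <= x n) ->
  (forall D, \sum_(n < D) x n <= X) ->
  exists r : nat -> R, r @ \oo --> (0 : R) /\
  forall t, cvgn (fun D => \sum_(n < D) x n * cosn n t) /\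
    forall D, `|cos_sum x t - \sum_(n < D) x n * cosn n t| <= r D.
Proof.
move=> x0 xX; pose s D := \sum_(n < D) x n.
have scv : cvgn s.
  apply: nondecreasing_is_cvgn; last by exists X => _ [D _ <-]; exact: xX.
  apply/nondecreasing_seqP => D; rewrite /s big_ord_recr/= lerDl; exact: x0.
exists (fun D => limn s - s D).
have r0 : (fun D => limn s - s D) @ \oo --> (0 : R).
  by rewrite -[X in _ --> X](subrr (limn s)); apply: cvgB => //; exact: cvg_cst.
split => // t; apply: telescoping_cvg => // D.
have sS : s D.+1 = s D + x D by rewrite /s big_ord_recr.
rewrite big_ord_recr/= addrAC subrr add0r sS.
have -> : limn s - s D - (limn s - (s D + x D)) = x D by ring.
by rewrite normrM ger0_norm// ler_piMr ?cosn_le1.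
Qed.

Lemma bm_cos_sum x (X : R) : (forall n, 0 <= x n) ->
  (forall D, \sum_(n < D) x n <= X) -> bm (cos_sum x).
Proof.
move=> x0 xX; have [r [_ rP]] := cos_sum_uniform x0 xX.
have bS D : bm (fun t => \sum_(n < D) x n * cosn n t).
  by apply: bm_sum => n; apply: bmZ; exact: bm_cosn.
split.
  apply: (@measurable_fun_cvg _ _ _ setT (fun D t => \sum_(n < D) x n * cosn n t)).
    by move=> D; have [] := bS D.
  by move=> t _; have [] := rP t.
by exists (r 0%N) => t; have [_ /(_ 0%N)] := rP t; rewrite big_ord0 subr0.
Qed.

Lemma cos_sum_per x : per (cos_sum x).
Proof.
by move=> t; rewrite /cos_sum; under eq_fun do under eq_bigr do rewrite cosn_per.
Qed.

(** Uniform convergence permits termwise integration. The sums are assumed eventually constant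
    because, by orthogonality, at most one term survives when [g] is a cosine or a sine. *)
Lemma mean_cos_sum x (X : R) (g : R -> R) (l : R) : (forall n, 0 <= x n) ->
  (forall D, \sum_(n < D) x n <= X) -> bm g -> (forall t, `|g t| <= 1) ->
  (\forall D \near \oo, \sum_(n < D) x n * mean (fun t => cosn n t * g t) = l) ->
  mean (fun t => cos_sum x t * g t) = l.
Proof.
move=> x0 xX bg g1 hl; have [r [r0 rP]] := cos_sum_uniform x0 xX.
have bG := bm_cos_sum x0 xX.
have bS D : bm (fun t => \sum_(n < D) x n * cosn n t).
  by apply: bm_sum => n; apply: bmZ; exact: bm_cosn.
apply/eqP; rewrite -subr_eq0 -normr_le0; apply/ler_addgt0Pr => e e0; rewrite add0r.
have /cvgrPdist_le/(_ e e0) h2 := r0.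
have [D [lD rD]] : exists D, \sum_(n < D) x n * mean (fun t => cosn n t * g t) = l /\ r D <= e.
  have [D _ DP] := filterI hl h2; exists D; have [? h] := DP D (leqnn D).
  by split => //; move: h; rewrite sub0r normrN; exact: le_trans (ler_norm _).
have -> : l = mean (fun t => (\sum_(n < D) x n * cosn n t) * g t).
  rewrite -lD; have bc n : bm (fun t => x n * (cosn n t * g t)).
    by apply: bmZ; apply: bmM => //; exact: bm_cosn.
  transitivity (mean (fun t => \sum_(n < D) x n * (cosn n t * g t))).
    rewrite mean_sum//; apply: eq_bigr => n _; rewrite meanZ//.
    by apply: bmM => //; exact: bm_cosn.
  by congr mean; apply/funext => t; rewrite mulr_suml; apply: eq_bigr => n _; rewrite mulrA.
rewrite -meanB; [|exact: bmM|exact: bmM].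
apply: le_trans rD; apply: ler_norm_mean; first by apply: bmB; exact: bmM.
move=> t; rewrite -mulrBl normrM -[leRHS]mulr1 ler_pM//.
by have [_] := rP t.
Qed.

Lemma mean_cosn2 (n m : nat) :
  mean (fun t : R => cosn n t * cosn m t) = if n == m then (if m == 0%N then 1 else 2^-1) else 0.
Proof.
have -> : mean (fun t : R => cosn n t * cosn m t) =
    mean (fun t => 2^-1 * (cos ((n%:Z - m%:Z)%:~R * t) + cos ((n%:Z + m%:Z)%:~R * t)) : R).
  congr mean; apply/funext => t.
  by rewrite intrB intrD mulrBl mulrDl cosB cosD /cosn -![_%:~R]/(_%:R); field.
rewrite meanZ; last by apply: bmD; exact: bm_cos.
rewrite meanD; [|exact: bm_cos|exact: bm_cos].
rewrite !mean_cos subr_eq0 eqz_nat -PoszD eqz_nat addn_eq0.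
have [->|nm] := eqVneq n m.
  rewrite andbb; case: ifP => _; rewrite ?addr0 ?mulr1//.
  by rewrite -[1 + 1]/(2%:R) mulVf.
case: (n =P 0%N) nm => [->|_]; last by rewrite addr0 mulr0.
by case: m => [//|m] _; rewrite addr0 mulr0.
Qed.

Lemma mean_cosn_sin (n : nat) (m : int) : mean (fun t : R => cosn n t * sin (m%:~R * t)) = 0.
Proof.
have -> : mean (fun t : R => cosn n t * sin (m%:~R * t)) =
    mean (fun t => 2^-1 * (sin ((m - n%:Z)%:~R * t) + sin ((m + n%:Z)%:~R * t)) : R).
  congr mean; apply/funext => t.
  by rewrite intrB intrD mulrBl mulrDl sinB sinD /cosn -[n%:~R]/(n%:R); field.
rewrite meanZ; last by apply: bmD; exact: bm_sin.
by rewrite meanD ?mean_sin ?addr0 ?mulr0//; exact: bm_sin.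
Qed.

Definition half_coef x (m : nat) : R := if m is 0%N then x 0%N else x m / 2.

Lemma mean_cos_sum_cos x (X : R) (m : int) : (forall n, 0 <= x n) ->
  (forall D, \sum_(n < D) x n <= X) ->
  mean (fun t => cos_sum x t * cos (m%:~R * t)) = half_coef x `|m|%N.
Proof.
move=> x0 xX.
have -> : (fun t => cos_sum x t * cos (m%:~R * t)) = (fun t => cos_sum x t * cosn `|m| t).
  apply/funext => t; congr (_ * _); rewrite /cosn; case: m => k//=.
  by rewrite NegzE mulrNz mulNr cosN.
apply: (mean_cos_sum x0 xX); [exact: bm_cosn|exact: cosn_le1|].
near=> D; have mD : (`|m| < D)%N by near: D; exact: nbhs_infty_gt.
rewrite (bigD1 (Ordinal mD))//= big1 ?addr0.
  by rewrite mean_cosn2 eqxx; case: `|m|%N => [|k]/=; rewrite ?mulr1.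
move=> n nm; rewrite mean_cosn2; case: eqP => [E|]; last by rewrite mulr0.
by move/eqP: nm; case; apply: val_inj.
Unshelve. all: by end_near.
Qed.

Lemma mean_cos_sum_sin x (X : R) (m : int) : (forall n, 0 <= x n) ->
  (forall D, \sum_(n < D) x n <= X) ->
  mean (fun t => cos_sum x t * sin (m%:~R * t)) = 0.
Proof.
move=> x0 xX; apply: (mean_cos_sum x0 xX); [exact: bm_sin|by move=> t; exact: sin_max|].
by near=> D; rewrite big1// => n _; rewrite mean_cosn_sin mulr0.
Unshelve. all: by end_near.
Qed.

Lemma sum_uniq_nat x (X : R) (l : seq nat) : (forall n, 0 <= x n) ->
  (forall D, \sum_(n < D) x n <= X) -> uniq l -> \sum_(n <- l) x n <= X.
Proof.
move=> x0 xX ul; pose D := (\max_(n <- l) n.+1)%N.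
have p : perm_eq l [seq n <- iota 0 D | n \in l].
  apply: uniq_perm => //; first by rewrite filter_uniq// iota_uniq.
  move=> n; rewrite mem_filter mem_iota/= add0n; case nl : (n \in l) => //=.
  by rewrite /D (big_rem n)//= leq_maxl.
rewrite (perm_big _ p)/= big_filter (le_trans _ (xX D))//.
rewrite -(big_mkord xpredT x) /index_iota subn0 big_mkcond/=.
by apply: ler_sum => n _; case: ifP.
Qed.

Lemma sb_abs x (X : R) : (forall n, 0 <= x n) -> (forall D, \sum_(n < D) x n <= X) ->
  sb (fun n : int => x `|n|%N) (X + X).
Proof.
move=> x0 xX s us; rewrite (bigID (fun n : int => 0 <= n))/=.
rewrite -[X in X + _]big_filter -[X in _ + X]big_filter.
set s1 := [seq i <- s | 0 <= i]; set s2 := [seq i <- s | ~~ (0 <= i)].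
rewrite -(big_map (fun n : int => `|n|%N) predT x) -[X in _ + X](big_map (fun n : int => `|n|%N) predT x).
apply: lerD; apply: sum_uniq_nat => //; rewrite map_inj_in_uniq ?filter_uniq//.
  by move=> i j; rewrite !mem_filter => /andP[i0 _] /andP[j0 _]; lia.
by move=> i j; rewrite !mem_filter => /andP[i0 _] /andP[j0 _]; lia.
Qed.

End CosineSeries.

(** * Membership in the Wiener algebra and the extension property *)

Section HelsonSet.
Context {R : realType}.

Lemma sum_centered (V : zmodType) (f : int -> V) (N : nat) :
  \sum_(k < N.*2.+1) f (k%:Z - N%:Z) = f 0 + \sum_(k < N) (f k.+1%:Z + f (- k.+1%:Z)).
Proof.
elim: N => [|N IH]; first by rewrite big_ord1 big_ord0 [RHS]addr0.
rewrite doubleS big_ord_recl [X in _ + X = _]big_ord_recr [X in _ = _ + X]big_ord_recr/=.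
rewrite [RHS]addrA -IH.
have -> : \sum_(i < N.*2.+1) f ((bump 0 i)%:Z - N.+1%:Z) = \sum_(k < N.*2.+1) f (k%:Z - N%:Z).
  by apply: eq_bigr => i _; congr f; rewrite /bump add1n; lia.
rewrite [LHS]addrC -addrA; congr (_ + (_ + _)); congr f; rewrite ?/bump; lia.
Qed.

(** Both parts are even, so the Fourier coefficients at [n] and [- n] agree and each carries half of
    the cosine coefficient, except at [n = 0]; recombining them turns the symmetric partial sums
    into cosine sums. *)
Lemma wiener_cos_sum (x1 x2 : nat -> R) (X1 X2 : R) :
  (forall n, 0 <= x1 n) -> (forall D, \sum_(n < D) x1 n <= X1) ->
  (forall n, 0 <= x2 n) -> (forall D, \sum_(n < D) x2 n <= X2) ->
  wiener (fun t => Complex (cos_sum x1 t) (cos_sum x2 t)).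
Proof.
move=> x10 xX1 x20 xX2; set g := (fun t => Complex _ _).
have FE n : fun_fourier g n = Complex (half_coef x1 `|n|%N) (half_coef x2 `|n|%N).
  rewrite /fun_fourier /circle_mean; congr Complex.
    rewrite -[LHS]/(mean (re_part (fun t => g t * expi (- n) t))).
    transitivity (mean (fun t => cos_sum x1 t * cos ((- n)%:~R * t) -
        cos_sum x2 t * sin ((- n)%:~R * t))); first by [].
    rewrite meanB.
    - by rewrite (mean_cos_sum_cos _ x10 xX1) (mean_cos_sum_sin _ x20 xX2) subr0 abszN.
    - by apply: bmM; [exact: bm_cos_sum xX1|exact: bm_cos].
    - by apply: bmM; [exact: bm_cos_sum xX2|exact: bm_sin].
  rewrite -[LHS]/(mean (im_part (fun t => g t * expi (- n) t))).
  transitivity (mean (fun t => cos_sum x1 t * sin ((- n)%:~R * t) +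
      cos_sum x2 t * cos ((- n)%:~R * t))); first by [].
  rewrite meanD.
  - by rewrite (mean_cos_sum_cos _ x20 xX2) (mean_cos_sum_sin _ x10 xX1) add0r abszN.
  - by apply: bmM; [exact: bm_cos_sum xX1|exact: bm_sin].
  - by apply: bmM; [exact: bm_cos_sum xX2|exact: bm_cos].
have hc (x : nat -> R) m : (forall n, 0 <= x n) -> 0 <= half_coef x m <= x m.
  move=> x0; case: m => [|m] /=; first by rewrite x0 lexx.
  by have := x0 m.+1; move: (x m.+1) => y y0; apply/andP; split; lra.
split.
- by move=> t; rewrite /g !cos_sum_per.
- apply: (@ell_of_sb _ _ _ ((X1 + X1) + (X2 + X2))).
  apply: (@sb_mono _ _ (fun n : int => x1 `|n|%N + x2 `|n|%N) ((X1 + X1) + (X2 + X2))) => //.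
    move=> n; have nc0 : 0 <= normc (fun_fourier g n).
      exact: le_trans (normr_ge0 _) (normr_re_normc _).
    rewrite powRr1// (le_trans (normc_le_add _))// FE/=.
    have /andP[a1 a2] := hc x1 `|n|%N x10; have /andP[b1 b2] := hc x2 `|n|%N x20.
    by rewrite !ger0_norm// lerD.
  by apply: sbD; exact: sb_abs.
move=> t.
have [r1 [r10 r1P]] := cos_sum_uniform x10 xX1.
have [r2 [r20 r2P]] := cos_sum_uniform x20 xX2.
have PE N : trig_partial_sum (fun_fourier g) N t =
    Complex (\sum_(n < N.+1) x1 n * cosn n t) (\sum_(n < N.+1) x2 n * cosn n t).
  rewrite /trig_partial_sum (sum_centered (fun m => fun_fourier g m * expi m t)).
  have c0 : cosn 0 t = 1 :> R by rewrite /cosn mul0r cos0.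
  elim: N => [|N IH].
    rewrite big_ord0 addr0 !big_ord1 FE /expi mul0r cos0 sin0 c0 !mulr1 /=.
    by congr Complex; ring.
  rewrite big_ord_recr/= addrA IH !FE /= /expi.
  rewrite [X in _ = Complex X _]big_ord_recr [X in _ = Complex _ X]big_ord_recr/=.
  rewrite mulrNz !mulNr cosN sinN -[N.+1%:~R]/(N.+1%:R : R) -/(cosn N.+1 t).
  by congr Complex => /=; field.
(* The partial sum of index [N] contains the [N.+1] cosines of frequencies [0] to [N], hence the
   shift. *)
have rr0 : (fun N => r1 N.+1 + r2 N.+1) @ \oo --> (0 : R).
  by rewrite -[X in _ --> X]addr0; apply: cvgD; [rewrite -(cvg_shiftS r1) in r10|rewrite -(cvg_shiftS r2) in r20].
apply: (squeeze_cvgr (f := fun=> 0) (h := fun N => r1 N.+1 + r2 N.+1)) => //; last exact: cvg_cst.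
near=> N; rewrite PE; apply/andP; split.
  exact: le_trans (normr_ge0 _) (normr_re_normc _).
rewrite (le_trans (normc_le_add _))//=; apply: lerD.
  by have [_ h] := r1P t; exact: h.
by have [_ h] := r2P t; exact: h.
Unshelve. all: by end_near.
Qed.

Lemma helson_good_set (th : R) (nu : nat -> seq nat) : 0 < th <= 1 -> helson (good_set th nu).
Proof.
move=> th01; split.
  split; last by apply: closed_bigI => k _; exact: good_closed.
  by move=> t; split=> h k _; [apply/(good_per th nu k t)|apply/good_per]; exact: h.
move=> f pf [cr ci].
have pr : per (re_part f) by move=> t; rewrite /re_part pf.
have pi' : per (im_part f) by move=> t; rewrite /im_part pf.
have [x1 [X1 [x10 xX1 x1P]]] := cosine_series th01 erefl pr cr.
have [x2 [X2 [x20 xX2 x2P]]] := cosine_series th01 erefl pi' ci.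
exists (fun t => Complex (cos_sum x1 t) (cos_sum x2 t)).
  exact: wiener_cos_sum xX1 x20 xX2.
move=> t Kt; rewrite /cos_sum.
rewrite (cvg_lim (@Rhausdorff R) (x1P t Kt)) (cvg_lim (@Rhausdorff R) (x2P t Kt)).
by rewrite /re_part /im_part; case: (f t).
Qed.

End HelsonSet.

Theorem theorem3 (R : realType) (q : R) (hq : 2 < q) :
  exists K : set R,
    helson K /\
    exists S : (R -> R[i]) -> R[i],
      [/\ schwartz_distribution S, nonzero_distribution S, supports K S
        & ell q (dist_fourier S)].
Proof.
have [th th01 [F [nu [F0 bF _ dF FG]]]] := construction hq.
exists (good_set th nu); split; first exact: helson_good_set.
exists (limdist F); split.
- by apply: (limdist_distribution hq).
- by apply: (limdist_nonzero hq).
- apply: limdist_supports FG _ _ => k; [exact: good_closed|move=> t; exact: good_per].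
- by apply: (limdist_ell hq).
Qed.
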